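(* Suppose that the operator $A$, its discretizations $\boldsymbol{A}_n$ and the parameters $\{\lambda_n\},\{\gamma_n\},\{\rho_n\}$ satisfy assumptions (A1) and (A2) stated in the context. Then for any $(u,v)\in W_1^s(\Omega)\times W_1^r(\Omega,[0,1])$ we have $$\lim_{n\to\infty}E_n(u,v)=E(u,v).$$
   Context: Setting. $\Omega=(0,1)^2$; $h=2^{-n}$. For multi-indices, $|\alpha|=\alpha_1+\alpha_2$, $\partial^\alpha=\partial_2^{\alpha_2}\partial_1^{\alpha_1}$, $\beta\le\alpha$ is componentwise, and $\beta<\alpha$ means $\beta\le\alpha$, $\beta\ne\alpha$. B-spline framelets. Fix $m\in\mathbb{N}$ and the univariate B-spline tight framelet system of order $m$: masks $q_0,\dots,q_m$ given (up to sign) by $\widehat q_l(\xi)=\sum_kq_l[k]e^{-i\xi k}=i^l\sqrt{\binom ml}\,e^{-ij\xi/2}\sin^l(\xi/2)\cos^{m-l}(\xi/2)$, with $j=0$ for $m$ even and $j=1$ for $m$ odd; $\phi$ is the B-spline with $\int\phi=1$, $\phi(x)=2\sum_kq_0[k]\phi(2x-k)$, and $\psi_l(x)=2\sum_kq_l[k]\phi(2x-k)$. In two dimensions, $q_\alpha[k]=q_{\alpha_1}[k_1]q_{\alpha_2}[k_2]$, $\psi_\alpha(x)=\psi_{\alpha_1}(x_1)\psi_{\alpha_2}(x_2)$ (with $\psi_0=\phi$), $\phi(x)=\phi(x_1)\phi(x_2)$, and $\mathbb{B}=\{0,\dots,m\}^2\setminus\{0\}$. Each $\psi_\alpha$ has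 vanishing moments of order $\alpha$; let $\varphi_\alpha\in L_2(\mathbb{R}^2)$ be the unique compactly supported function with $\partial^\alpha\varphi_\alpha=\psi_\alpha$ (distributionally), and $c_\alpha=\int_{\mathbb{R}^2}\varphi_\alpha\,dx\ne0$. Grids. $\phi_{n,k}=2^n\phi(2^n\cdot-k)$; $\mathbb{O}_n=\{k\in\mathbb{Z}^2:2^{-n}k\in\overline\Omega\}$; $\mathbb{M}_n=\{k\in\mathbb{O}_n:\mathrm{supp}(\phi_{n,k})\subseteq\overline\Omega\}$; $\mathbb{K}_n=\{k\in\mathbb{M}_n:k+S_\alpha\subseteq\mathbb{M}_n\ \forall\alpha\in\mathbb{B}\cup\{0\}\}$, where $S_\alpha$ is the support of $q_\alpha$. For $\boldsymbol u\in\mathbb{R}^{\mathbb{M}_n}$ and $k\in\mathbb{K}_n$, $(\boldsymbol W_\alpha\boldsymbol u)[k]=\sum_{j}q_\alpha[j-k]\boldsymbol u[j]$. For $\boldsymbol u\in\mathbb{R}^{\mathbb{M}_n}$, $\|\boldsymbol u\|_p^p=h^2\sum_{k\in\mathbb{M}_n}|\boldsymbol u[k]|^p$. $\boldsymbol T_n:L_2(\Omega)\to\mathbb{R}^{\mathbb{M}_n}$, $(\boldsymbol T_nu)[k]=2^n\langle u,\phi_{n,k}\rangle$. Continuous functional. $\mathbb{I},\mathbb{I}',\mathbb{I}''\subseteq\mathbb{B}$ are nonempty index sets such that there is $\alpha\in\mathbb{I}$ with $\alpha>\beta$ for all $\beta\in\mathbb{I}'$; $s=\max_{\alpha\in\mathbb{I}\cup\mathbb{I}'}|\alpha|$,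 $r=\max_{\alpha\in\mathbb{I}''}|\alpha|$. $W_1^s(\Omega)=\{u\in L_1(\Omega):\partial^\alpha u\in L_1(\Omega),|\alpha|\le s\}$, and $W_1^r(\Omega,[0,1])=\{v\in W_1^r(\Omega):0\le v\le1\text{ a.e.}\}$. With $f\in L_2(\Omega)$, $$E(u,v)=\int_\Omega(1-v)\Big(\sum_{\alpha\in\mathbb{I}}|\partial^\alpha u|^2\Big)^{1/2}dx+\int_\Omega v\Big(\sum_{\alpha\in\mathbb{I}'}|\partial^\alpha u|^2\Big)^{1/2}dx+\int_\Omega\Big(\sum_{\alpha\in\mathbb{I}''}|\partial^\alpha v|^2\Big)^{1/2}dx+\tfrac12\|Au-f\|_{L_2(\Omega)}^2 .$$ Discrete functional. $\boldsymbol A_n$ is a linear operator on $\mathbb{R}^{\mathbb{M}_n}$ and $$E_n(u,v)=h^2\sum_{k\in\mathbb{K}_n}(1-\boldsymbol T_nv[k])\Big(\sum_{\alpha\in\mathbb{B}}\lambda_\alpha|(\boldsymbol W_\alpha\boldsymbol T_nu)[k]|^2\Big)^{1/2}+h^2\sum_{k\in\mathbb{K}_n}\boldsymbol T_nv[k]\Big(\sum_{\alpha\in\mathbb{B}}\gamma_\alpha|(\boldsymbol W_\alpha\boldsymbol T_nu)[k]|^2\Big)^{1/2}$$ $$\qquad+h^2\sum_{k\in\mathbb{K}_n}\Big(\sum_{\alpha\in\mathbb{B}}\rho_\alpha|(\boldsymbol W_\alpha\boldsymbol T_nv)[k]|^2\Big)^{1/2}+\tfrac12\|\boldsymbol A_n\boldsymbol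 T_nu-\boldsymbol T_nf\|_2^2,$$ where $\lambda_\alpha,\gamma_\alpha,\rho_\alpha$ depend on $n$. Assumptions. (A1) $A:L_2(\Omega)\to L_2(\Omega)$ is continuous and linear, and $\lim_{n\to\infty}\|\boldsymbol T_nAu-\boldsymbol A_n\boldsymbol T_nu\|_2=0$ for all $u\in L_2(\Omega)$. (A2) For $\alpha\in\mathbb{I}$, $\lambda_\alpha=(c_\alpha^{-1}2^{|\alpha|(n-1)})^2$; for $\alpha\in\mathbb{J}:=\mathbb{B}\setminus\mathbb{I}$, $0\le\lambda_\alpha\le O(2^{2|\beta|(n-1)})$ as $n\to\infty$ for some $\beta\in\mathbb{B}\cup\{0\}$ (depending on $\alpha$, not on $n$) with $0\le\beta<\alpha$ and $|\beta|\le s$. The $\gamma_\alpha$ are chosen the same way with $\mathbb{I}$ replaced by $\mathbb{I}'$, and the $\rho_\alpha$ the same way with $\mathbb{I}$ replaced by $\mathbb{I}''$ and $s$ replaced by $r$. *)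

(* Defs.v *)
From HB Require Import structures.
From mathcomp Require Import all_boot all_order all_algebra.
From mathcomp Require Import finmap.
From mathcomp Require Import complex.
From mathcomp Require Import all_classical all_reals all_analysis.

Set Implicit Arguments.
Unset Strict Implicit.
Unset Printing Implicit Defensive.

Import Order.TTheory GRing.Theory Num.Theory.
Import numFieldNormedType.Exports.

Local Open Scope classical_set_scope.
Local Open Scope ring_scope.

(** * Multi-indices *)

Definition mord (a : nat * nat) : nat := (a.1 + a.2)%N.

Definition mle (b a : nat * nat) : bool := (b.1 <= a.1)%N && (b.2 <= a.2)%N.

Definition mlt (b a : nat * nat) : bool := mle b a && (b != a).

(* The indices of the two-dimensional framelet system: {0, ..., m}^2. *)
Notation fidx m := ('I_m.+1 * 'I_m.+1)%type.

Definition midx (m : nat) (a : fidx m) : nat * nat := (val a.1, val a.2).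

Definition framelet_idx (m : nat) : {set fidx m} := [set~ (ord0, ord0)]%SET.

Definition max_order (m : nat) (J : {set fidx m}) : nat :=
  (\max_(a in J) mord (midx a))%N.

(** * Function spaces on subsets of the plane *)

Section Plane.
Variable R : realType.
Implicit Types (U : set (R * R)) (u v f g t : R * R -> R) (a : nat * nat).

Definition leb2 := (@lebesgue_measure R \x @lebesgue_measure R)%E.

Definition Omega : set (R * R) := `]0, 1[ `*` `]0, 1[.

(* L_p(U); functions are considered through their restriction to U, extended
   by zero, and are not quotiented by almost everywhere equality. *)
Definition Lp (p : R) U u : Prop := (u \_ U) \in Lfun leb2 p%:E.

Definition L2norm U u : R := fine ('N[leb2]_2%:E[EFin \o (u \_ U)])%E.

Definition pd1 t : R * R -> R :=
  fun x => 'D_((1, 0) : R^o * R^o) (t : R^o * R^o -> R^o) x.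
Definition pd2 t : R * R -> R :=
  fun x => 'D_((0, 1) : R^o * R^o) (t : R^o * R^o -> R^o) x.

Definition pd a t : R * R -> R := iter a.2 pd2 (iter a.1 pd1 t).

(* The word w lists the successive variables of an iterated partial derivative:
   true for x_1, false for x_2. *)
Definition smooth t : Prop :=
  forall w : seq bool,
    let g := foldr (fun b => if b then pd1 else pd2) t w in
    [/\ continuous (g : R^o * R^o -> R^o),
        forall x, derivable (g : R^o * R^o -> R^o) x (1, 0) &
        forall x, derivable (g : R^o * R^o -> R^o) x (0, 1)].

Definition supp t : set (R * R) := closure [set x | t x != 0].

Definition test_function U t : Prop :=
  [/\ smooth t, compact (supp t) & supp t `<=` U].

(* g is the distributional derivative of order a of u on U. This is meant for
   locally integrable u and g only. *)
Definition is_weak_derivative U a u g : Prop :=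
  forall t, test_function U t ->
    (\int[leb2]_(x in U) (u x * pd a t x)) =
    (-1) ^+ mord a * (\int[leb2]_(x in U) (g x * t x)).

Definition W1 (s : nat) U u : Prop :=
  Lp 1 U u /\
  forall a, (mord a <= s)%N -> exists g, Lp 1 U g /\ is_weak_derivative U a u g.

Definition W1_01 (r : nat) U v : Prop :=
  W1 r U v /\ {ae leb2, forall x, U x -> 0 <= v x <= 1}.

(* A representative of the derivative of order a of u on U; it is unique up to
   almost everywhere equality on U, and arbitrary if there is none in L_1(U). *)
Definition weakD U a u : R * R -> R :=
  xget (cst 0) [set g | Lp 1 U g /\ is_weak_derivative U a u g].

(* A, seen as acting on representatives, is a continuous linear operator on
   L_2(U); compatibility with almost everywhere equality is a consequence of
   continuity. *)
Definition continuous_linear_L2 U (A : (R * R -> R) -> R * R -> R) : Prop :=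
  [/\ forall u, Lp 2 U u -> Lp 2 U (A u),
      forall (c : R) u v, Lp 2 U u -> Lp 2 U v ->
        {ae leb2, forall x, U x ->
           A (fun y => c * u y + v y) x = c * A u x + A v x} &
      forall u, Lp 2 U u -> forall e : R, 0 < e -> exists2 d : R, 0 < d &
        forall v, Lp 2 U v ->
          L2norm U (u \- v) < d -> L2norm U (A u \- A v) < e].

(** * B-spline framelets *)

(* The cardinal B-spline of degree d, supported on [0, d + 1]: the convolution
   of d + 1 copies of the indicator function of the unit interval. *)
Fixpoint cardinal_bspline (d : nat) : R -> R :=
  if d is d'.+1 then
    fun x => \int[@lebesgue_measure R]_(t in `[0, 1])
               cardinal_bspline d' (x - t)
  else \1_`[0, 1[.

(* The B-spline of order m > 0. The shift is the one determined by the phase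
   factor of the masks below: phi is centered at 0 if m is even and at 1/2 if m
   is odd. *)
Definition bspline (m : nat) (x : R) : R :=
  cardinal_bspline m.-1 (x + (m./2)%:R).

(* e^{i t} *)
Definition cis (t : R) : R[i] := Complex (cos t) (sin t).

(* The masks are only prescribed up to sign; the refinement equation fixes the
   sign of q_0. *)
Definition bspline_masks (m : nat) (q : nat -> int -> R) : Prop :=
  [/\ forall l, (l <= m)%N -> finite_set [set k | q l k != 0],
      forall l, (l <= m)%N -> exists eps : bool, forall xi : R,
        \sum_(k \in [set: int]) (real_complex R (q l k) * cis (- (xi * k%:~R))) =
        (-1) ^+ eps * Complex 0 1 ^+ l *
        real_complex R (Num.sqrt 'C(m, l)%:R) *
        cis (- ((odd m)%:R * xi / 2)) *
        real_complex R (sin (xi / 2) ^+ l * cos (xi / 2) ^+ (m - l)) &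
      forall x, bspline m x =
        2 * \sum_(k \in [set: int]) (q 0%N k * bspline m (2 * x - k%:~R))].

Definition psi1 (m : nat) (q : nat -> int -> R) (l : nat) (x : R) : R :=
  if l is 0%N then bspline m x
  else 2 * \sum_(k \in [set: int]) (q l k * bspline m (2 * x - k%:~R)).

Definition phi (m : nat) (x : R * R) : R := bspline m x.1 * bspline m x.2.

Definition psi (m : nat) (q : nat -> int -> R) (a : nat * nat) (x : R * R) : R :=
  psi1 m q a.1 x.1 * psi1 m q a.2 x.2.

Definition mask2 (q : nat -> int -> R) (a : nat * nat) (k : int * int) : R :=
  q a.1 k.1 * q a.2 k.2.

(* varphi is the family of compactly supported antiderivatives of the psi. *)
Definition framelet_antiderivatives (m : nat) (q : nat -> int -> R)
    (varphi : fidx m -> R * R -> R) : Prop :=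
  forall al, al \in framelet_idx m ->
    [/\ Lp 2 setT (varphi al),
        exists2 K : set (R * R), compact K &
          {ae leb2, forall x, ~ K x -> varphi al x = 0} &
        is_weak_derivative setT (midx al) (varphi al) (psi m q (midx al))].

Definition framelet_const (m : nat) (varphi : fidx m -> R * R -> R)
    (al : fidx m) : R :=
  \int[leb2]_x varphi al x.

(** * Grids and discrete operators *)

Definition gridpt (n : nat) (k : int * int) : R * R :=
  (2 ^- n * k.1%:~R, 2 ^- n * k.2%:~R).

Definition phi_nk (m n : nat) (k : int * int) (x : R * R) : R :=
  2 ^+ n * phi m (2 ^+ n * x.1 - k.1%:~R, 2 ^+ n * x.2 - k.2%:~R).

Definition Oset (n : nat) : set (int * int) :=
  [set k | closure Omega (gridpt n k)].

Lemma finite_Oset (n : nat) : finite_set (Oset n).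
Proof.
have cl (x : R * R) : closure Omega x -> 0 <= x.1 <= 1 /\ 0 <= x.2 <= 1.
  have c01 (p : R * R -> R) : {for x, continuous p} ->
      (forall y, Omega y -> 0 < p y < 1) -> closure Omega x -> 0 <= p x <= 1.
    move=> cp hp clx; have : (closure `[(0 : R), 1]) (p x).
      move=> B /cp Bp; have [y [Oy By]] := clx _ Bp.
      exists (p y); split => //=.
      by rewrite in_itv /=; have /andP[/ltW -> /ltW ->] := hp _ Oy.
    rewrite -(closure_id _).1 /=; last exact: interval_closed.
    by rewrite in_itv.
  move=> clx; split; apply: c01 => //.
  - exact: cvg_fst.
  - by move=> y [/=]; rewrite in_itv.
  - exact: cvg_snd.
  - by move=> y [_ /=]; rewrite in_itv.
have bnd (z : int) : 0 <= (2 ^- n : R) * z%:~R <= 1 ->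
    exists2 i : nat, (i < (2 ^ n).+1)%N & i%:Z = z.
  have p2 : 0 < (2 ^- n : R) by rewrite invr_gt0 exprn_gt0.
  rewrite pmulr_rge0 // ler0z => /andP[z0].
  rewrite mulrC ler_pdivrMr ?exprn_gt0 // mul1r.
  case: z z0 => // i _ hi; exists i => //.
  by rewrite ltnS -(ler_nat R) natrX.
pose N := `I_(2 ^ n).+1.
have fN : finite_set [set (i.1%:Z, i.2%:Z) | i in N `*` N].
  by apply: finite_image; apply: finite_setX; exact: finite_II.
apply: sub_finite_set fN => -[k1 k2] /cl[/= /bnd[i hi <-] /bnd[j hj <-]].
by exists (i, j).
Qed.

Definition Mset (m n : nat) : {fset int * int} :=
  fset_set [set k | Oset n k /\ supp (phi_nk m n k) `<=` closure Omega].

Lemma in_Mset (m n : nat) (k : int * int) :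
  k \in Mset m n <-> Oset n k /\ supp (phi_nk m n k) `<=` closure Omega.
Proof.
rewrite in_fset_set ?inE //.
by apply: sub_finite_set (finite_Oset n) => j [].
Qed.

Definition grid_fun (m n : nat) := {ffun Mset m n -> R^o}.

Definition Kset (m n : nat) (q : nat -> int -> R) : {set Mset m n} :=
  [set k : Mset m n | `[< forall (al : fidx m) (j : int * int),
     mask2 q (midx al) j != 0 -> val k + j \in Mset m n >]]%SET.

Definition Wop (m n : nat) (q : nat -> int -> R) (a : nat * nat)
    (w : grid_fun m n) (k : Mset m n) : R :=
  \sum_(j : Mset m n) mask2 q a (val j - val k) * w j.

Definition grid_norm2 (m n : nat) (w : grid_fun m n) : R :=
  Num.sqrt ((2 ^- n) ^+ 2 * \sum_(k : Mset m n) `|w k| ^+ 2).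

Definition Tn (m n : nat) (u : R * R -> R) : grid_fun m n :=
  [ffun k : Mset m n =>
     2 ^+ n * \int[leb2]_(x in Omega) (u x * phi_nk m n (val k) x)].

(** * The functionals *)

Definition gradnorm (m : nat) (J : {set fidx m}) (u : R * R -> R)
    (x : R * R) : R :=
  Num.sqrt (\sum_(al in J) `|weakD Omega (midx al) u x| ^+ 2).

Definition energy (m : nat) (I I' I'' : {set fidx m}) (f : R * R -> R)
    (A : (R * R -> R) -> R * R -> R) (u v : R * R -> R) : R :=
  (\int[leb2]_(x in Omega) ((1 - v x) * gradnorm I u x)) +
  (\int[leb2]_(x in Omega) (v x * gradnorm I' u x)) +
  (\int[leb2]_(x in Omega) gradnorm I'' v x) +
  2^-1 * L2norm Omega (A u \- f) ^+ 2.

Definition Wnorm (m n : nat) (q : nat -> int -> R) (lam : fidx m -> R)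
    (w : grid_fun m n) (k : Mset m n) : R :=
  Num.sqrt (\sum_(al in framelet_idx m) lam al * `|Wop q (midx al) w k| ^+ 2).

Definition energy_n (m n : nat) (q : nat -> int -> R) (lam gam rho : fidx m -> R)
    (f : R * R -> R) (An : grid_fun m n -> grid_fun m n)
    (u v : R * R -> R) : R :=
  (2 ^- n) ^+ 2 *
    (\sum_(k in Kset m n q) (1 - Tn m n v k) * Wnorm q lam (Tn m n u) k) +
  (2 ^- n) ^+ 2 *
    (\sum_(k in Kset m n q) Tn m n v k * Wnorm q gam (Tn m n u) k) +
  (2 ^- n) ^+ 2 *
    (\sum_(k in Kset m n q) Wnorm q rho (Tn m n v) k) +
  2^-1 * grid_norm2 (An (Tn m n u) - Tn m n f) ^+ 2.

(** * Assumptions *)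

Definition assumption_A1 (m : nat) (A : (R * R -> R) -> R * R -> R)
    (An : forall n, grid_fun m n -> grid_fun m n) : Prop :=
  continuous_linear_L2 Omega A /\
  forall u, Lp 2 Omega u ->
    grid_norm2 (Tn m n (A u) - An n (Tn m n u)) @[n --> \oo] --> (0 : R).

(* 2 ^ (d (n - 1)), the exponent being an integer. *)
Definition dyadic (d n : nat) : R := 2 ^ (d%:Z * (n%:Z - 1)).

Definition assumption_A2 (m : nat) (varphi : fidx m -> R * R -> R)
    (J : {set fidx m}) (s : nat) (lam : nat -> fidx m -> R) : Prop :=
  (forall al, al \in J -> forall n,
     lam n al =
     ((framelet_const varphi al)^-1 * dyadic (mord (midx al)) n) ^+ 2) /\
  (forall al, al \in (framelet_idx m :\: J)%SET ->
     (forall n, 0 <= lam n al) /\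
     exists be : fidx m,
       [/\ mlt (midx be) (midx al), (mord (midx be) <= s)%N &
           ((fun n => lam n al) : nat -> R^o) =O_\oo
           ((fun n => dyadic (2 * mord (midx be))%N n) : nat -> R^o)]).

End Plane.

(* Main.v *)
(** Sums over [K_n] are integrals over the unit square of functions that are constant on the cells
of mesh size [2^-n]. On [K_n] the coefficient [(W_al T_n u)[k]] is an integral of [u] against a
combination of dilated B-splines with coefficients those of [(1 - X)^al (1 + X)^(m - al)]. Every factor
[1 - X] is a difference, hence the derivative of a B-spline of one degree more; integrating by parts
turns the coefficient into [(-2^-n)^|be|] times a combination of local B-spline averages of [D^be u], for
every [be <= al]. These averages converge to [D^be u] in [L_1]. For [be = al] the combination has total
weight [2^|al| c_al], which is what the weights [lam], [gam], [rho] compensate; for [be < al] its total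
weight is [0], so that the terms outside of [I], [I'], [I''] vanish in the limit.

In the products with [T_n v] the first factor is bounded by 1 and converges in [L_1], which suffices. In the
fidelity term Jensen's inequality [(P_n w)^2 <= P_n (w^2)] for the averaging operator [P_n] reduces the
convergence of norms to convergence in [L_1]. There [u] has to be in [L_2]: the hypothesis on [I] and [I']
gives [2 <= s], and a function whose mixed derivatives up to order [(1, 1)] are integrable is bounded. *)
Require Import Defs.
From HB Require Import structures.
From mathcomp Require Import all_boot all_order all_algebra.
From mathcomp Require Import finmap complex.
From mathcomp Require Import all_classical all_reals all_analysis.
From mathcomp Require Import measurable_realfun ring lra zify.

Set Implicit Arguments.
Unset Strict Implicit.
Unset Printing Implicit Defensive.

Import Order.TTheory GRing.Theory Num.Theory.
Import numFieldNormedType.Exports.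

Local Open Scope classical_set_scope.
Local Open Scope ring_scope.

(** * Smooth functions of one variable and bump functions *)

Section SmoothFunctions.
Context {R : realType}.
Implicit Types f g : R -> R.

(** Weak derivatives can only be tested with smooth functions supported inside the open square,
    whereas B-splines are not smooth and those near the boundary may touch it. Both defects are
    removed at the bottom of the convolution: the indicator function of the unit interval is
    replaced by [bump j], which is smooth and supported strictly inside. As every spline is built
    from it by the same operator [box], the rule that a derivative is a difference takes the same
    form. The integrations by parts are carried out for the bumps and passed to the limit in [j] by
    dominated convergence, off the null set of grid lines.

    The L_1 convergence of the averages rests on two facts: averaging is an L_1 contraction
    uniformly in n, and near a point where a function is locally constant its averages are
    eventually exact. Dynkin's theorem extends this from rectangles to Borel sets, and density of
    simple functions to L_1.

    The constants c_al are found by testing the definition of [varphi] with the monomial x^al / al!,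
    cut off far away. Their value is a multiple of the total weight of the mask combination, which
    is why the two cancel in the limit. *)

Fixpoint nder (n : nat) (f : R -> R) : Prop :=
  if n is n'.+1 then
    exists g, (forall x : R, is_derive x (1 : R) f (g x)) /\ nder n' g
  else True.

Definition csmooth f : Prop := forall n, nder n f.

Lemma nderW n f : nder n.+1 f -> nder n f.
Proof.
elim: n f => [//|n IH] f [g [fg gn]].
by exists g; split => //; exact: IH.
Qed.

Lemma nderD n f g : nder n f -> nder n g -> nder n (fun x => f x + g x).
Proof.
elim: n f g => [//|n IH] f g [f' [ff' f'n]] [g' [gg' g'n]].
exists (fun x => f' x + g' x); split; last exact: IH.
by move=> x; have := ff' x; have := gg' x => ? ?; exact: is_deriveD.
Qed.

Lemma nderM n f g : nder n f -> nder n g -> nder n (fun x => f x * g x).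
Proof.
elim: n f g => [//|n IH] f g hf hg.
case: (hf) (hg) => [f' [ff' f'n]] [g' [gg' g'n]].
exists (fun x => f x * g' x + g x * f' x); split.
  by move=> x; have := ff' x; have := gg' x => ? ?; exact: is_deriveM.
by apply: nderD; apply: IH => //; exact: nderW.
Qed.

Lemma nder_cst n (c : R) : nder n (fun=> c).
Proof.
elim: n c => [//|n IH] c; exists (fun=> 0); split; last exact: IH.
by move=> x; exact: is_derive_cst.
Qed.

Lemma nderN n f : nder n f -> nder n (fun x => - f x).
Proof.
move=> hf; have -> : (fun x => - f x) = (fun x => (-1) * f x).
  by apply/funext => x; rewrite mulN1r.
by apply: nderM => //; exact: nder_cst.
Qed.

Lemma is_derive_affine f (f' : R -> R) (a b x : R) :
  (forall y : R, is_derive y (1 : R) f (f' y)) ->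
  is_derive x (1 : R) (fun x => f (a * x + b)) (a * f' (a * x + b)).
Proof.
move=> hf.
have h1 : is_derive x (1 : R) (fun x : R => a * x + b) a.
  have := @is_deriveD R R R (fun x : R => a * x) (fun=> b) x 1 a 0 => /=.
  rewrite addr0; apply.
  have := is_deriveZ a (@is_derive_id R R x 1).
  by rewrite /GRing.scale/= mulr1.
by rewrite mulrC; have := hf (a * x + b) => ?; exact: is_derive1_comp.
Qed.

Lemma nder_affine n f (a b : R) : nder n f -> nder n (fun x => f (a * x + b)).
Proof.
elim: n f => [//|n IH] f [f' [ff' f'n]].
exists (fun x => a * f' (a * x + b)); split.
  by move=> x; exact: is_derive_affine.
by apply: nderM; [exact: nder_cst|exact: IH].
Qed.

Lemma nderV n f : (forall x, f x != 0) -> nder n f -> nder n (fun x => (f x)^-1).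
Proof.
move=> f0; elim: n => [//|n IH] hf; case: (hf) => [f' [ff' f'n]].
exists (fun x => - ((f x)^-1 * (f x)^-1) * f' x); split.
  move=> x; have := ff' x => ?; have := is_deriveV (f0 x) (ff' x).
  by rewrite -exprVn expr2.
apply: nderM => //; apply: nderN.
by have /IH hV := nderW hf; exact: nderM.
Qed.

Lemma csmoothD f g : csmooth f -> csmooth g -> csmooth (fun x => f x + g x).
Proof. by move=> hf hg n; exact: nderD. Qed.

Lemma csmoothM f g : csmooth f -> csmooth g -> csmooth (fun x => f x * g x).
Proof. by move=> hf hg n; exact: nderM. Qed.

Lemma csmooth_cst (c : R) : csmooth (fun=> c).
Proof. by move=> n; exact: nder_cst. Qed.

Lemma csmooth_affine f (a b : R) : csmooth f -> csmooth (fun x => f (a * x + b)).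
Proof. by move=> hf n; exact: nder_affine. Qed.

(** Derivatives are unique, so the witnesses of [nder] for the different orders all coincide with
    the classical derivative, and one function serves for every order. *)
Lemma csmooth_derive f : csmooth f ->
  (forall x : R, is_derive x (1 : R) f (f^`()%classic x)) /\ csmooth (f^`()%classic).
Proof.
move=> hf; have key n : (forall x : R, is_derive x (1 : R) f (f^`()%classic x)) /\
   nder n (f^`()%classic).
  have [g [fg gn]] := hf n.+1.
  suff -> : f^`()%classic = g by [].
  by apply/funext => x; rewrite derive1E; have := fg x => ?; rewrite derive_val.
by split; [have [] := key 0%N|move=> n; have [] := key n].
Qed.

Lemma csmooth_continuous f : csmooth f -> continuous f.
Proof.
move=> /csmooth_derive[hf _] x; apply: differentiable_continuous.
by apply/derivable1_diffP; have := hf x => ?; exact: ex_derive.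
Qed.

(** The functions p(1/x) e^(-1/x) extended by 0. A whole family is taken because it is stable under
    differentiation, which sends p to X^2 (p - p'). *)
Definition flat (p : {poly R}) (x : R) : R :=
  if 0 < x then p.[x^-1] * expR (- x^-1) else 0.

Lemma horner_expR_bounded (p : {poly R}) :
  exists C : R, 0 <= C /\ forall y, 0 < y -> `|p.[y]| * expR (- y) <= C.
Proof.
exists (\sum_(i < size p) `|p`_i| * i.+1`!%:R * 2); split.
  by apply: sumr_ge0 => i _; rewrite !mulr_ge0.
move=> y y0; rewrite horner_coef.
apply: (@le_trans _ _ (\sum_(i < size p) `|p`_i| * y ^+ i * expR (- y))).
  rewrite -mulr_suml ler_wpM2r ?expR_ge0//.
  apply: (le_trans (ler_norm_sum _ _ _)); apply: ler_sum => i _.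
  by rewrite normrM (ger0_norm (exprn_ge0 _ (ltW y0))).
apply: ler_sum => i _; rewrite -!mulrA ler_wpM2l//.
rewrite expRN ler_pdivrMr ?expR_gt0// -mulrA.
case: (nat_of_ord i) => [|k].
  rewrite expr0 mul1r; have := @expR_ge1Dx R y; lra.
have := expR_ge1Dxn k (ltW y0).
have k0 : 0 < (k.+1)`!%:R :> R by rewrite ltr0n fact_gt0.
move=> /(ler_wpM2l (ltW k0)); rewrite mulrDr mulr1 mulrCA mulfV ?gt_eqF// mulr1 => h.
have h2 : (k.+1)`!%:R <= (k.+2)`!%:R :> R by rewrite ler_nat leq_fact.
have h3 : (k.+1)`!%:R * expR y <= (k.+2)`!%:R * expR y by rewrite ler_wpM2r// expR_ge0.
have := expR_ge0 y; nra.
Qed.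

(** Boundedness of p(y) y^2 e^(-y) read at y = 1/x. Quadratic decay is what makes the difference
    quotient at 0 tend to 0. *)
Lemma flat_bound (p : {poly R}) :
  exists C : R, 0 <= C /\ forall x : R, `|flat p x| <= C * x ^+ 2.
Proof.
have [C [C0 hC]] := horner_expR_bounded (p * 'X ^+ 2).
exists C; split => // x; rewrite /flat; case: ifPn => [x0|_]; last first.
  by rewrite normr0 mulr_ge0// sqr_ge0.
rewrite -ler_pdivrMr ?exprn_gt0// normrM (ger0_norm (expR_ge0 _)).
have xV : 0 < x^-1 by rewrite invr_gt0.
have := hC _ xV; rewrite hornerM hornerXn normrM.
by rewrite (ger0_norm (exprn_ge0 _ (ltW xV))) exprVn mulrAC.
Qed.

Lemma is_derive_flat (p : {poly R}) (x : R) :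
  is_derive x (1 : R) (flat p) (flat ('X ^+ 2 * (p - p^`())) x).
Proof.
have [x0|x0|->] := ltgtP x 0.
- have -> : flat ('X ^+ 2 * (p - p^`())) x = 0 by rewrite /flat ltNge (ltW x0).
  apply: (near_eq_is_derive (f := fun=> 0 : R)).
  near=> z; rewrite /flat ltNge; suff -> : z <= 0 by [].
  by apply: ltW; near: z; exact: lt_nbhsl.
- have -> : flat ('X ^+ 2 * (p - p^`())) x =
     p.[x^-1] * (expR (- x^-1) * (x ^- 2)) + expR (- x^-1) * (p^`().[x^-1] * (- x ^- 2)).
    rewrite /flat x0 hornerM hornerXn hornerD hornerN exprVn; ring.
  apply: (near_eq_is_derive (f := fun z : R => p.[z^-1] * expR (- z^-1))).
    near=> z; rewrite /flat; suff -> : 0 < z by [].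
    by near: z; exact: lt_nbhsr.
  have xn0 : x != 0 by rewrite gt_eqF.
  have hV : is_derive x (1 : R) (fun z : R => z^-1) (- x ^- 2).
    by have := is_deriveV xn0 (is_derive_id x 1); rewrite /GRing.scale /= mulr1.
  have hp : is_derive (x^-1) (1 : R) (horner p) (p^`().[x^-1]).
    have /derivableP := @derivable_horner R p x^-1.
    by rewrite -derive1E -derivE.
  have h1 : is_derive x (1 : R) (fun z : R => p.[z^-1]) (p^`().[x^-1] * (- x ^- 2)).
    exact: is_derive1_comp.
  have hN : is_derive x (1 : R) (fun z : R => - z^-1) (x ^- 2).
    by rewrite -[x ^- 2]opprK; exact: is_deriveN.
  have h2 : is_derive x (1 : R) (fun z : R => expR (- z^-1)) (expR (- x^-1) * (x ^- 2)).
    exact: is_derive1_comp.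
  exact: is_deriveM.
- have -> : flat ('X ^+ 2 * (p - p^`())) 0 = 0 by rewrite /flat ltxx.
  have [C [C0 hC]] := flat_bound p.
  have hq : h^-1 *: ((flat p \o shift 0) (h *: 1) - flat p 0) @[h --> (0:R)^'] --> (0 : R).
    have hC1 : 0 < C + 1 by lra.
    apply/cvgrPdist_le => e e0; near=> h.
    rewrite sub0r normrN /= /GRing.scale /= mulr1 addr0.
    have -> : flat p 0 = 0 by rewrite /flat ltxx.
    rewrite subr0 normrM normfV.
    have h0 : h != 0 by near: h; exact: nbhs_dnbhs_neq.
    rewrite mulrC ler_pdivrMr ?normr_gt0//.
    apply: (le_trans (hC _)); rewrite -real_normK ?num_real// expr2 mulrA.
    rewrite ler_wpM2r//.
    have : `|h| <= e / (C + 1).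
      by near: h; exact: dnbhs0_le (divr_gt0 e0 hC1).
    rewrite ler_pdivlMr// => hh; have := normr_ge0 h; nra.
  apply: DeriveDef; first by apply/cvg_ex; exists 0.
  exact/cvg_lim.
Unshelve. all: by end_near.
Qed.

Lemma csmooth_flat (p : {poly R}) : csmooth (flat p).
Proof.
move=> n; elim: n p => [//|n IH] p.
by exists (flat ('X ^+ 2 * (p - p^`()))); split; [exact: is_derive_flat|].
Qed.

Definition expflat : R -> R := flat 1.

Lemma expflat_gt0 (x : R) : 0 < x -> 0 < expflat x.
Proof. by move=> x0; rewrite /expflat /flat x0 hornerC mul1r expR_gt0. Qed.

Lemma expflat_eq0 (x : R) : x <= 0 -> expflat x = 0.
Proof. by move=> x0; rewrite /expflat /flat ltNge x0. Qed.

Lemma expflat_ge0 (x : R) : 0 <= expflat x.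
Proof. by case: (ltP 0 x) => [/expflat_gt0/ltW|/expflat_eq0->]. Qed.

Definition smoothstep (x : R) : R := expflat x / (expflat x + expflat (1 - x)).

Lemma smoothstep_den (x : R) : 0 < expflat x + expflat (1 - x).
Proof.
have [x0|x0] := ltP 0 x.
  by apply: ltr_pwDl; [exact: expflat_gt0|exact: expflat_ge0].
by apply: ltr_wpDl; [exact: expflat_ge0|apply: expflat_gt0; lra].
Qed.

Lemma smoothstep01 (x : R) : 0 <= smoothstep x <= 1.
Proof.
rewrite /smoothstep divr_ge0 ?expflat_ge0 ?(ltW (smoothstep_den _))//=.
by rewrite ler_pdivrMr ?smoothstep_den// mul1r lerDl expflat_ge0.
Qed.

Lemma smoothstep0 (x : R) : x <= 0 -> smoothstep x = 0.
Proof. by move=> x0; rewrite /smoothstep expflat_eq0// mul0r. Qed.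

Lemma smoothstep1 (x : R) : 1 <= x -> smoothstep x = 1.
Proof.
move=> x1; rewrite /smoothstep (@expflat_eq0 (1 - x)) ?addr0 ?mulfV//; last lra.
by rewrite gt_eqF// expflat_gt0//; lra.
Qed.

Lemma csmooth_smoothstep : csmooth smoothstep.
Proof.
move=> n; apply: nderM; first exact: csmooth_flat.
apply: nderV => [x|]; first by rewrite gt_eqF// smoothstep_den.
apply: nderD; first exact: csmooth_flat.
have -> : (fun x => expflat (1 - x)) = (fun x => expflat ((-1) * x + 1)).
  by apply/funext => x; rewrite mulN1r addrC.
by apply: nder_affine; exact: csmooth_flat.
Qed.

(** With r = 1/(j+2), the first factor rises on [r, 2r] and the second falls on [1-2r, 1-r]. The
    margin r keeps the support inside the open unit interval. *)
Definition bump (j : nat) (x : R) : R :=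
  smoothstep (j.+2%:R * x - 1) * smoothstep (j.+2%:R * (1 - x) - 1).

Lemma bump01 j (x : R) : 0 <= bump j x <= 1.
Proof.
have /andP[a0 a1] := smoothstep01 (j.+2%:R * x - 1).
have /andP[b0 b1] := smoothstep01 (j.+2%:R * (1 - x) - 1).
by rewrite /bump mulr_ge0//= mulr_ile1.
Qed.

Lemma bump_supp j (x : R) : bump j x != 0 -> j.+2%:R^-1 <= x <= 1 - j.+2%:R^-1.
Proof.
have j0 : 0 < j.+2%:R :> R by [].
have := mulfV (lt0r_neq0 j0); move: (j.+2%:R^-1) => r.
rewrite /bump mulf_eq0 negb_or; move: j.+2%:R j0 => J j0 Jr /andP[h1 h2].
apply/andP; split; rewrite leNgt.
  by apply: contra h1 => h; apply/eqP/smoothstep0; nra.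
by apply: contra h2 => h; apply/eqP/smoothstep0; nra.
Qed.

Lemma bump_eq1 j (x : R) : 2 * j.+2%:R^-1 <= x <= 1 - 2 * j.+2%:R^-1 -> bump j x = 1.
Proof.
have j0 : 0 < j.+2%:R :> R by [].
have := mulfV (lt0r_neq0 j0); move: (j.+2%:R^-1) => r.
rewrite /bump; move: j.+2%:R j0 => J j0 Jr /andP[h1 h2].
by rewrite !smoothstep1 ?mulr1//; nra.
Qed.

Lemma csmooth_bump j : csmooth (bump j).
Proof.
apply: csmoothM.
  have -> : (fun x => smoothstep (j.+2%:R * x - 1)) =
            (fun x => smoothstep (j.+2%:R * x + (- 1))) by [].
  exact/csmooth_affine/csmooth_smoothstep.
have -> : (fun x => smoothstep (j.+2%:R * (1 - x) - 1)) =
          (fun x => smoothstep (- j.+2%:R * x + (j.+2%:R - 1))).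
  by apply/funext => x; congr smoothstep; ring.
exact/csmooth_affine/csmooth_smoothstep.
Qed.

(** The point 0 is excluded because the indicator is 1 there, while every bump vanishes. *)
Lemma bump_cvg (x : R) : x != 0 -> bump j x @[j --> \oo] --> (\1_`[0, 1[ x : R).
Proof.
move=> x0; have [hx|hx] := boolP (0 < x < 1); last first.
  have -> : \1_`[0, 1[ x = 0 :> R.
    rewrite indicE mem_setE in_itv/= le_eqVlt eq_sym (negbTE x0)/=.
    by rewrite (negbTE hx).
  apply: cvg_near_cst; near=> j; apply/eqP; apply: contraNT hx => /bump_supp/andP[h1 h2].
  have : 0 < j.+2%:R^-1 :> R by rewrite invr_gt0.
  by move: j.+2%:R^-1 h1 h2 => J h1 h2 ?; apply/andP; split; lra.
case/andP: hx => h0 h1.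
have -> : \1_`[0, 1[ x = 1 :> R by rewrite indicE mem_setE in_itv/= (ltW h0) h1.
apply: cvg_near_cst; near=> j; apply: bump_eq1.
have : 2 * j.+2%:R^-1 <= Num.min x (1 - x).
  have m0 : 0 < Num.min x (1 - x) by rewrite lt_min h0; lra.
  rewrite ler_pdivrMr//.
  have : 2 / Num.min x (1 - x) <= j.+2%:R.
    near: j; apply: (@filterS _ _ _ (fun j => 2 / Num.min x (1 - x) <= j%:R)).
      by move=> j /le_trans; apply; rewrite ler_nat; do 2 apply: leqW.
    exact: nbhs_infty_ger.
  by rewrite ler_pdivrMr// mulrC.
by move: (2 / _) => r; rewrite le_min => /andP[? ?]; apply/andP; split; lra.
Unshelve. all: by end_near.
Qed.
End SmoothFunctions.

(** * Real-valued Lebesgue integrals *)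

Section RealIntegrals.
Context {d : measure_display} {T : measurableType d} {R : realType}.
Context (mu : {measure set T -> \bar R}).
Implicit Types (D : set T) (f g h : T -> R).

Lemma eq_integrableR D f g : measurable D -> (forall x, D x -> f x = g x) ->
  mu.-integrable D (EFin \o f) -> mu.-integrable D (EFin \o g).
Proof.
move=> mD fg; apply: eq_integrable => // x; rewrite inE => Dx /=.
by rewrite fg.
Qed.

Lemma integrableRD D f g : measurable D -> mu.-integrable D (EFin \o f) ->
  mu.-integrable D (EFin \o g) -> mu.-integrable D (EFin \o (fun x => f x + g x)).
Proof. by move=> mD hf hg; exact: (integrableD mD hf hg). Qed.

Lemma integrableRB D f g : measurable D -> mu.-integrable D (EFin \o f) ->
  mu.-integrable D (EFin \o g) -> mu.-integrable D (EFin \o (fun x => f x - g x)).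
Proof. by move=> mD hf hg; exact: (integrableB mD hf hg). Qed.

Lemma integrableRZ D f (c : R) : measurable D -> mu.-integrable D (EFin \o f) ->
  mu.-integrable D (EFin \o (fun x => c * f x)).
Proof. by move=> mD hf; exact: (integrableZl mD c hf). Qed.

Lemma integrableR_norm D f : measurable D -> mu.-integrable D (EFin \o f) ->
  mu.-integrable D (EFin \o (fun x => `|f x|)).
Proof. by move=> mD hf; exact: (integrable_norm hf). Qed.

Lemma integrableR_sum D (I : Type) (s : seq I) (P : pred I) (h : I -> T -> R) :
  measurable D -> (forall i, mu.-integrable D (EFin \o h i)) ->
  mu.-integrable D (EFin \o (fun x => \sum_(i <- s | P i) h i x)).
Proof.
move=> mD hh; have := @integrable_sum _ _ _ mu D mD _ s P (fun i => EFin \o h i) (fun i _ => hh i).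
by apply: eq_integrable => // x _ /=; rewrite -sumEFin.
Qed.

Lemma Rintegral_sum D (I : Type) (s : seq I) (P : pred I) (h : I -> T -> R) :
  measurable D -> (forall i, mu.-integrable D (EFin \o h i)) ->
  \int[mu]_(x in D) (\sum_(i <- s | P i) h i x) =
  \sum_(i <- s | P i) \int[mu]_(x in D) h i x.
Proof.
move=> mD hh; elim: s => [|i s IH].
  rewrite big_nil; under eq_Rintegral do rewrite big_nil.
  by rewrite Rintegral_cst// mul0r.
rewrite big_cons; under eq_Rintegral do rewrite big_cons.
case: (P i) => //; rewrite RintegralD ?IH//.
exact: integrableR_sum.
Qed.

Lemma integrableR_le D f g : measurable D -> measurable_fun D f ->
  (forall x, D x -> `|f x| <= g x) -> mu.-integrable D (EFin \o g) ->
  mu.-integrable D (EFin \o f).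
Proof.
move=> mD mf fg; apply: le_integrable => //; first exact/measurable_EFinP.
by move=> x Dx /=; rewrite lee_fin (le_trans (fg _ Dx))// ler_norm.
Qed.

Lemma integrableR_bound D f (C : R) : measurable D -> (mu D < +oo)%E ->
  measurable_fun D f -> (forall x, D x -> `|f x| <= C) ->
  mu.-integrable D (EFin \o f).
Proof.
move=> mD muD mf fC; apply: (@integrableR_le _ _ (fun=> C)) => //.
apply: measurable_bounded_integrable => //.
exists `|C|; split; first exact: num_real.
by move=> M CM x _ /=; rewrite ltW.
Qed.

Lemma integrableRM_bound D f h (C : R) : measurable D -> mu.-integrable D (EFin \o f) ->
  measurable_fun D h -> (forall x, D x -> `|h x| <= C) ->
  mu.-integrable D (EFin \o (fun x => f x * h x)).
Proof.
move=> mD hf mh hC; have /measurable_EFinP mf := measurable_int _ hf.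
apply: (@integrableR_le _ _ (fun x => C * `|f x|)) => //.
- exact: measurable_funM.
- by move=> x Dx; rewrite normrM mulrC ler_wpM2r// hC.
- by apply: integrableRZ => //; exact: integrableR_norm.
Qed.

Lemma Rintegral_norm_bound D f h (C : R) : measurable D -> mu.-integrable D (EFin \o f) ->
  measurable_fun D h -> (forall x, D x -> `|h x| <= C) ->
  `|\int[mu]_(x in D) (f x * h x)| <= C * \int[mu]_(x in D) `|f x|.
Proof.
move=> mD hf mh hC; have hfh := integrableRM_bound mD hf mh hC.
apply: (le_trans (le_normr_Rintegral _ _)) => //.
rewrite -RintegralZl//; last exact: integrableR_norm.
apply: le_Rintegral => //; first exact: integrableR_norm.
  by apply: integrableRZ => //; exact: integrableR_norm.
by move=> x Dx; rewrite normrM mulrC ler_wpM2r// hC.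
Qed.

Lemma Rdominated_cvg D (F : nat -> T -> R) f g : measurable D ->
  (forall n, measurable_fun D (F n)) -> measurable_fun D f ->
  {ae mu, forall x, D x -> F n x @[n --> \oo] --> f x} ->
  mu.-integrable D (EFin \o g) ->
  (forall n x, D x -> `|F n x| <= g x) ->
  \int[mu]_(x in D) F n x @[n --> \oo] --> \int[mu]_(x in D) f x.
Proof.
move=> mD mF mf cF ig bF.
have [||||intf _ h] := @dominated_convergence _ _ _ mu D mD (fun n => EFin \o F n)
   (EFin \o f) (EFin \o g) _ _ _ ig _.
- by move=> n; exact/measurable_EFinP.
- exact/measurable_EFinP.
- apply: filterS cF => x h Dx; apply: cvg_EFin; last exact: h.
  by near=> n.
- by apply: nearW => x n Dx /=; rewrite lee_fin bF.
apply: fine_cvg; rewrite fineK//.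
exact: integrable_fin_num.
Unshelve. all: by end_near.
Qed.

Lemma ae_eq_Rintegral D f g : measurable D -> measurable_fun D f -> measurable_fun D g ->
 (\forall x \ae mu, D x -> f x = g x) ->
  \int[mu]_(x in D) f x = \int[mu]_(x in D) g x.
Proof.
move=> mD mf mg fg; congr fine; apply: ae_eq_integral => //; try exact/measurable_EFinP.
by apply: (filterS _ fg) => x h Dx /=; rewrite h.
Qed.

End RealIntegrals.

(** * B-splines as iterated moving averages *)

Section Box.
Context {R : realType}.
Notation mu := (@lebesgue_measure R).
Implicit Types F G : R -> R.

Definition box F (x : R) : R := \int[mu]_(t in `[0, 1]) F (x - t).

(* [F] is the indicator function of [0, 1[ for the B-splines, and one of the functions [bump j] for the
   smooth compactly supported approximations of B-splines that serve as test functions. *)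
Definition spl F (d : nat) : R -> R := iter d box F.

(** The invariant common to the indicator function and the bumps. It is preserved by [box] and
    supplies measurability and uniform domination for all splines. *)
Definition unit_fun F := measurable_fun setT F /\ forall x, 0 <= F x <= 1.

Lemma cardinal_bsplineE d : @cardinal_bspline R d = spl (\1_`[0, 1[) d.
Proof. by elim: d => [//|d IH] /=; apply/funext => x; rewrite IH. Qed.

Lemma unit_fun_norm F x : unit_fun F -> `|F x| <= 1.
Proof. by move=> [_ /(_ x)/andP[F0 F1]]; rewrite ger0_norm. Qed.

Lemma mu_unit : mu `[0, 1] = 1%E.
Proof. by rewrite lebesgue_measure_itv/= lte_fin ltr01 sube0. Qed.

Lemma measurable_fun_reflect F x : measurable_fun setT F ->
  measurable_fun setT (fun t : R => F (x - t)).
Proof.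
move=> mF; apply: measurableT_comp => //.
by apply: measurable_funB => //; exact: measurable_cst.
Qed.

Lemma unit_fun_box_integrable F x : unit_fun F ->
  mu.-integrable `[0, 1] (EFin \o (fun t => F (x - t))).
Proof.
move=> uF; apply: (@integrableR_bound _ _ _ _ _ _ 1) => //.
- by rewrite [X in (X < _)%E]mu_unit ltry.
- by apply: measurable_funTS; apply: measurable_fun_reflect; case: uF.
- by move=> t _; exact: unit_fun_norm.
Qed.

Lemma box_itv F x : unit_fun F -> 0 <= box F x <= 1.
Proof.
move=> uF; have [mF F01] := uF; apply/andP; split.
  by apply: Rintegral_ge0 => t _; case/andP: (F01 (x - t)).
have -> : 1 = \int[mu]_(t in `[0, 1]) 1 :> R.
  by rewrite Rintegral_cst// mul1r [X in fine X]mu_unit.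
apply: le_Rintegral => //; first exact: unit_fun_box_integrable.
  apply: (@integrableR_bound _ _ _ _ _ _ 1) => //.
    by rewrite [X in (X < _)%E]mu_unit ltry.
  by move=> t _; rewrite normr1.
by move=> t _; case/andP: (F01 (x - t)).
Qed.

Lemma measurable_box F : unit_fun F -> measurable_fun setT (box F).
Proof.
move=> [mF F01].
(* Extending the integrand by zero off the window makes [box F] a partial integral over the whole
   line, measurable by Tonelli's theorem. *)
pose f (z : R * R) : \bar R := (F (z.1 - z.2) * \1_`[0, 1] z.2)%:E.
have -> : box F = fine \o (fubini_F mu f).
  apply/funext => x; rewrite /box /Rintegral integral_mkcond /fubini_F /=.
  congr fine; apply: eq_integral => t _; rewrite /f patchE indicE /=.
  by case: ifP => _; rewrite ?mulr1 ?mulr0.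
apply: measurableT_comp => //.
apply: measurable_fun_fubini_tonelli_F.
  apply/measurable_EFinP; apply: measurable_funM; last first.
    by apply: measurableT_comp => //; exact: measurable_indic.
  apply: measurableT_comp => //.
  exact: measurable_funB.
by move=> z; rewrite lee_fin mulr_ge0//; case/andP: (F01 (z.1 - z.2)).
Qed.

Lemma unit_fun_boxP F : unit_fun F -> unit_fun (box F).
Proof.
by move=> uF; split; [exact: measurable_box|move=> x; exact: box_itv].
Qed.

Lemma unit_fun_spl F d : unit_fun F -> unit_fun (spl F d).
Proof. by move=> uF; elim: d => [//|d IH]; exact: unit_fun_boxP. Qed.

Lemma unit_fun_indic : unit_fun (\1_`[0, 1[ : R -> R).
Proof.
split; first exact: measurable_indic.
by move=> x; rewrite indicE; case: (_ \in _); rewrite ?lexx ?ler01.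
Qed.

Lemma box_supp F a b x : (forall y, F y != 0 -> a <= y <= b) ->
  box F x != 0 -> a <= x <= b + 1.
Proof.
move=> hF; apply: contra_neqT => hx.
rewrite /box; under eq_Rintegral => t.
  rewrite inE/= in_itv/= => /andP[t0 t1].
  have -> : F (x - t) = 0.
    by apply: contraNeq hx => /hF/andP[h1 h2]; apply/andP; split; lra.
  over.
by rewrite Rintegral_cst// mul0r.
Qed.

Lemma spl_supp F d a b x : (forall y, F y != 0 -> a <= y <= b) ->
  spl F d x != 0 -> a <= x <= b + d%:R.
Proof.
move=> hF; elim: d x => [|d IH] x; first by rewrite addr0; exact: hF.
by move/(box_supp IH); rewrite -addrA -natr1.
Qed.

Lemma indic_supp (y : R) : \1_`[0, 1[ y != 0 :> R -> 0 <= y <= 1.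
Proof.
rewrite indicE; case: (boolP (_ \in _)); last by rewrite eqxx.
by rewrite inE/= in_itv/= => /andP[-> /ltW ->].
Qed.

Lemma box_sum_le1 F : unit_fun F ->
  (forall N x, \sum_(k < N) F (x - k%:R) <= 1) ->
  forall N x, \sum_(k < N) box F (x - k%:R) <= 1.
Proof.
move=> uF hF N x; rewrite /box.
have /= <- := @Rintegral_sum _ _ R mu `[0, 1] _ (index_enum 'I_N) xpredT
  (fun (k : 'I_N) (t : R) => F (x - k%:R - t)) (measurable_itv _)
  (fun k => unit_fun_box_integrable (x - k%:R) uF).
have -> : forall a, (a <= 1) = (a <= \int[mu]_(t in `[0, 1]) 1 :> R) => [a|].
  by rewrite Rintegral_cst// mul1r [X in fine X]mu_unit.
apply: le_Rintegral => //.
- by apply: integrableR_sum => // k; exact: unit_fun_box_integrable.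
- apply: (@integrableR_bound _ _ _ _ _ _ 1) => //.
    by rewrite [X in (X < _)%E]mu_unit ltry.
  by move=> t _; rewrite normr1.
- move=> t _; apply: le_trans (hF N (x - t)); rewrite le_eqVlt; apply/orP; left.
  by apply/eqP; apply: eq_bigr => k _; congr F; ring.
Qed.

(** A finite piece of the partition of unity by integer translates. The bound survives [box], which
    commutes with translations and averages over a window of length 1. *)
Lemma spl_sum_le1 d N (x : R) : \sum_(k < N) spl (\1_`[0, 1[) d (x - k%:R) <= 1.
Proof.
elim: d N x => [|d IH] N x; last first.
  by apply: box_sum_le1 => //; apply: unit_fun_spl; exact: unit_fun_indic.
suff -> : \sum_(k < N) spl \1_`[0, 1[ 0 (x - k%:R) = (0 <= x < N%:R)%R%:R :> R.
  by case: (_ <= _ < _); rewrite ?lexx ?ler01.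
elim: N => [|N IHN]; first by rewrite big_ord0; case: (ltgtP 0 x).
rewrite big_ord_recr/= IHN indicE mem_setE in_itv/= -natr1.
have N0 : 0 <= N%:R :> R by [].
have [x0|x0] := leP 0 x; last first.
  have -> : (0 <= x - N%:R) = false by apply/negbTE; rewrite -ltNge; lra.
  by rewrite /= addr0.
rewrite subr_ge0 ltrBlDr (addrC 1); have [xN|xN] /= := leP N%:R x; first by rewrite add0r.
by rewrite addr0 (lt_le_trans xN)// lerDl.
Qed.

(** By Tonelli's theorem, averaging over translates preserves the total mass. *)
Lemma integral_spl_affine d (a b : R) : 0 < a ->
  (\int[mu]_x (spl (\1_`[0, 1[) d (a * x - b))%:E = (a^-1)%:E)%E.
Proof.
move=> a0; elim: d b => [|d IH] b.
  rewrite (_ : (fun x => _) = (fun x => (\1_(`[b / a, (b + 1) / a[%classic) x)%:E)); last first.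
    apply/funext => x /=; congr EFin; rewrite !indicE !mem_setE !in_itv/=.
    congr ((nat_of_bool _)%:R); congr andb.
      by rewrite subr_ge0 ler_pdivrMr// mulrC.
    by rewrite ltrBlDr ltr_pdivlMr// (addrC 1) mulrC.
  rewrite integral_indic// setIT.
  rewrite [LHS](lebesgue_measure_itv `[b / a, (b + 1) / a[)/= lte_fin.
  rewrite ltr_pM2r ?invr_gt0// ltrDl ltr01 -EFinB; congr EFin.
  by rewrite -mulrBl addrC addKr mul1r.
have uF : unit_fun (spl (\1_`[0, 1[ : R -> R) d).
  by apply: unit_fun_spl; exact: unit_fun_indic.
have [mF F01] := uF.
pose f (z : R * R) : \bar R :=
  (spl \1_`[0, 1[ d (a * z.1 - b - z.2) * \1_`[0, 1] z.2)%:E.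
transitivity (\int[mu]_x \int[mu]_t f (x, t))%E.
  apply: eq_integral => x _; rewrite /= /box.
  rewrite /Rintegral fineK; last first.
    by apply: integrable_fin_num => //; exact: unit_fun_box_integrable.
  rewrite integral_mkcond; apply: eq_integral => t _; rewrite patchE /f /= indicE.
  by case: ifP => _; rewrite ?mulr1 ?mulr0.
rewrite fubini_tonelli; last 2 first.
- apply/measurable_EFinP; apply: measurable_funM; last first.
    by apply: measurableT_comp => //; exact: measurable_indic.
  apply: measurableT_comp => //; apply: measurable_funB => //.
  apply: measurable_funB; last exact: measurable_cst.
  by apply: measurable_funM => //; exact: measurable_cst.
- by move=> z; rewrite lee_fin mulr_ge0//; case/andP: (F01 (a * z.1 - b - z.2)).
transitivity (\int[mu]_t (a^-1 * \1_`[0, 1] t)%:E)%E.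
  apply: eq_integral => t _; rewrite /f /=.
  under eq_integral do rewrite mulrC EFinM.
  rewrite ge0_integralZl//; last 2 first.
  - apply/measurable_EFinP; apply: measurableT_comp => //.
    apply: measurable_funB; last exact: measurable_cst.
    apply: measurable_funB; last exact: measurable_cst.
    by apply: measurable_funM => //; exact: measurable_cst.
  - by move=> x _; rewrite lee_fin; case/andP: (F01 (a * x - b - t)).
  under eq_integral do rewrite -addrA -opprD.
  by rewrite IH -EFinM mulrC.
under eq_integral do rewrite EFinM.
rewrite ge0_integralZl//; last 2 first.
- by apply/measurable_EFinP; exact: measurable_indic.
- by rewrite lee_fin invr_ge0 ltW.
by rewrite integral_indic// setIT [X in (_ * X)%E]mu_unit mule1.
Qed.

Lemma Rintegral_gt0 (G : R -> R) (a b c e : R) : mu.-integrable `[a, b] (EFin \o G) ->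
  (forall x, 0 <= G x) -> a <= c -> c < e -> e <= b ->
  (forall x, c < x < e -> 0 < G x) -> 0 < \int[mu]_(x in `[a, b]) G x.
Proof.
move=> iG G0 ac ce eb Gpos; rewrite lt_neqAle Rintegral_ge0 ?andbT//.
apply/eqP => /esym h.
have hE : (\int[mu]_(x in `[a, b]) (`|(G x)%:E|) = 0)%E.
  under eq_integral do rewrite gee0_abs ?lee_fin//.
  by rewrite -[LHS]fineK ?integrable_fin_num//; congr EFin.
have mG := measurable_int _ iG.
have [N [mN N0 subN]] := (ae_eq_integral_abs mu (measurable_itv _) mG).1 hE.
have : (mu `]c, e[ <= mu N)%E.
  apply: (@le_measure _ _ _ mu); rewrite ?inE//.
  move=> x /=; rewrite in_itv/= => /andP[cx xe]; apply: subN => /= hx.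
  have : (G x)%:E = 0%E by apply: hx; rewrite in_itv/=; apply/andP; split; lra.
  by move=> [] Gx0; have := Gpos x; rewrite Gx0 ltxx cx xe => /(_ isT).
rewrite N0 leNgt => /negP; apply.
by rewrite [ltRHS](lebesgue_measure_itv `]c, e[)/= lte_fin ce -EFinB lte_fin subr_gt0.
Qed.

Lemma spl_gt0 d (x : R) : 0 < x < d.+1%:R -> 0 < spl (\1_`[0, 1[) d x.
Proof.
elim: d x => [|d IH] x /andP[x0 xd].
  by rewrite /= indicE mem_setE in_itv/= (ltW x0) xd.
have uF : unit_fun (spl (\1_`[0, 1[ : R -> R) d).
  by apply: unit_fun_spl; exact: unit_fun_indic.
have d0 : 0 < d.+1%:R :> R by [].
move: xd; rewrite -natr1 => xd.
(* The interval of those t in the window for which x - t lies inside the support of the spline of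
   degree d. *)
apply: (@Rintegral_gt0 _ _ _ (Num.max 0 (x - d.+1%:R)) (Num.min 1 x)).
- exact: unit_fun_box_integrable.
- by move=> t; case: uF => _ /(_ (x - t))/andP[].
- by rewrite le_max lexx.
- by rewrite gt_max !lt_min; apply/andP; split; apply/andP; split => //; lra.
- by rewrite ge_min lexx.
- move=> t; rewrite gt_max lt_min => /andP[/andP[t0 t1] /andP[t2 t3]].
  by apply: IH; apply/andP; split; lra.
Qed.

Lemma is_derive_primitive F (a x : R) : continuous F -> a < x ->
  is_derive x (1 : R) (fun y => \int[mu]_(t in `[a, y]) F t) (F x).
Proof.
move=> cF ax; have x1 : x < x + 1 by rewrite ltrDl.
have iF : mu.-integrable `[a, x + 1] (EFin \o F).
  apply: continuous_compact_integrable; first exact: segment_compact.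
  exact: continuous_subspaceT.
have [dP] := continuous_FTC1_closed x1 iF ax (cF x).
by rewrite derive1E => <-; exact: DeriveDef.
Qed.

Lemma is_derive_box F x : continuous F -> is_derive x (1 : R) (box F) (F x - F (x - 1)).
Proof.
(* The base point x - 3 lies safely below every y - t with y > x - 1 and t in [0, 1], so that P is a
   primitive of F at all points that occur. *)
move=> cF; pose P (y : R) := \int[mu]_(t in `[x - 3, y]) F t.
have dP (y : R) : x - 3 < y -> is_derive y (1 : R) P (F y).
  exact: is_derive_primitive.
have boxE y : x - 1 < y -> box F y = P y - P (y - 1).
  move=> xy; rewrite /box.
  have := @continuous_FTC2 R (fun t => F (y - t)) (fun t => - P (y - t)) 0 1 ltr01.
  rewrite subr0 -EFinB opprK addrC /Rintegral => -> //.
  - apply: continuous_subspaceT => t; apply: continuous_comp; last exact: cF.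
    by apply: cvgB; [exact: cvg_cst|exact: cvg_id].
  - have dd (t : R) : t < y - x + 3 -> derivable (fun t : R => - P (y - t)) t 1.
      move=> ht; have ht' : x - 3 < y - t by lra.
      have d1 := dP _ ht'.
      have d2 : is_derive t (1 : R) (fun t : R => y - t) (-1).
        have := @is_deriveB R R R (fun=> y) id t 1 0 1 _ _.
        by rewrite sub0r; apply.
      have d3 : is_derive t (1 : R) (fun t : R => P (y - t)) (F (y - t) * -1).
        exact: is_derive1_comp.
      have := is_deriveN d3 => d4; exact: ex_derive.
    have cc (t : R) : t < y - x + 3 -> {for t, continuous (fun t : R => - P (y - t))}.
      by move=> ht; apply: differentiable_continuous; apply/derivable1_diffP; exact: dd.
    split.
    + by move=> t; rewrite in_itv/= => /andP[t0 t1]; apply: dd; lra.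
    + by apply: cvg_at_right_filter; apply: cc; lra.
    + by apply: cvg_at_left_filter; apply: cc; lra.
  - move=> t; rewrite in_itv/= => /andP[t0 t1].
    have ht' : x - 3 < y - t by lra.
    have d1 := dP _ ht'.
    have d2 : is_derive t (1 : R) (fun t : R => y - t) (-1).
      have := @is_deriveB R R R (fun=> y) id t 1 0 1 _ _.
      by rewrite sub0r; apply.
    have d3 : is_derive t (1 : R) (fun t : R => P (y - t)) (F (y - t) * -1).
      exact: is_derive1_comp.
    have := is_deriveN d3; rewrite mulrN1 opprK => d4.
    by rewrite derive1E derive_val.
apply: (near_eq_is_derive (f := fun y : R => P y - P (y - 1))).
  near=> y; rewrite boxE//.
  by near: y; apply: lt_nbhsr; rewrite ltrBlDr ltrDl.
have x3 : x - 3 < x by lra.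
have x31 : x - 3 < x - 1 by lra.
have d0 := dP _ x3; have d1 := dP _ x31.
have d2 : is_derive x (1 : R) (fun y : R => P (y - 1)) (F (x - 1)).
  have d3 : is_derive x (1 : R) (fun t : R => t - 1) 1.
    have := @is_deriveB R R R id (fun=> 1) x 1 1 0 _ _.
    by rewrite subr0; apply.
  by rewrite -[F (x - 1)]mulr1; exact: is_derive1_comp.
exact: is_deriveB.
Unshelve. all: by end_near.
Qed.

Lemma nder_box n F : continuous F -> nder n F -> nder n.+1 (box F).
Proof.
move=> cF hF; exists (fun x => F x - F (x - 1)); split.
  by move=> x; exact: is_derive_box.
apply: nderD => //; apply: nderN.
have -> : (fun x => F (x - 1)) = (fun x => F (1 * x + (-1))).
  by apply/funext => x; rewrite mul1r.
exact: nder_affine.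
Qed.

Lemma csmooth_spl F d : csmooth F -> csmooth (spl F d).
Proof.
move=> sF; elim: d => [//|d IH] n; apply: nderW.
by apply: nder_box; [exact: csmooth_continuous|exact: IH].
Qed.

Lemma is_derive_spl F d x : csmooth F ->
  is_derive x (1 : R) (spl F d.+1) (spl F d x - spl F d (x - 1)).
Proof. by move=> sF; apply: is_derive_box; apply: csmooth_continuous; exact: csmooth_spl. Qed.

Lemma unit_fun_bump j : unit_fun (@bump R j).
Proof.
split; last exact: bump01.
by apply: continuous_measurable_fun; apply: csmooth_continuous; exact: csmooth_bump.
Qed.

Lemma spl_bump_cvg d (x : R) : x != 0 ->
  spl (bump j) d x @[j --> \oo] --> spl (\1_`[0, 1[) d x.
Proof.
elim: d x => [|d IH] x x0; first exact: bump_cvg.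
apply: (Rdominated_cvg (g := fun=> 1)) => //.
- move=> j; apply: measurable_funTS; apply: measurable_fun_reflect.
  by case: (unit_fun_spl d (unit_fun_bump j)).
- apply: measurable_funTS; apply: measurable_fun_reflect.
  by case: (unit_fun_spl d unit_fun_indic).
(* The induction hypothesis fails only where x - t = 0, that is at a single t. *)
- exists [set x]; split => //; first exact: lebesgue_measure_set1.
  move=> t /=; apply: contra_notP => /eqP tx _; apply: IH.
  by rewrite subr_eq0 eq_sym.
- apply: (@integrableR_bound _ _ _ _ _ _ 1) => //.
    by rewrite [X in (X < _)%E]mu_unit ltry.
  by move=> t _; rewrite normr1.
- by move=> j t _; apply: unit_fun_norm; apply: unit_fun_spl; exact: unit_fun_bump.
Qed.

Lemma spl_bump_supp j d (x : R) : spl (bump j) d x != 0 ->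
  j.+2%:R^-1 <= x <= d.+1%:R - j.+2%:R^-1.
Proof.
move=> /(spl_supp (@bump_supp R j)); set r := _^-1.
by rewrite -(natr1 d) => /andP[h1 h2]; apply/andP; split; lra.
Qed.

End Box.

(** * Local B-spline averages on the grid and their convergence in L_1 *)

Section GridAverages.
Context {R : realType}.
Notation mu := (@lebesgue_measure R).
Notation mu2 := (@leb2 R).

Lemma measurable_Omega :
  measurable (@Omega R : set (measurableTypeR R * measurableTypeR R)).
Proof. by apply: measurableX; exact: measurable_itv. Qed.

Lemma leb2X (A B : set R) : measurable A -> measurable B ->
  mu2 (A `*` B) = (mu A * mu B)%E.
Proof. by move=> mA mB; exact: (product_measure1E mu mu mA mB). Qed.

Lemma leb2_Omega : mu2 (@Omega R) = 1%E.
Proof.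
rewrite leb2X//; try exact: measurable_itv.
by rewrite [X in (X * _)%E](lebesgue_measure_itv `]0, 1[)/= lte_fin ltr01 sube0 mul1e
  [LHS](lebesgue_measure_itv `]0, 1[)/= lte_fin ltr01 sube0.
Qed.

Lemma leb2_lines (a b : R) : mu2.-negligible [set x | x.1 = a \/ x.2 = b].
Proof.
have -> : [set x : R * R | x.1 = a \/ x.2 = b] = ([set a] `*` setT) `|` (setT `*` [set b]).
  by apply/seteqP; split => -[x y] /=; [case=> ->; [left|right]|case=> -[]; [left|right]].
apply: negligibleU.
  exists ([set a] `*` setT); split => //; first exact: measurableX.
  by apply: (eq_trans (leb2X _ _)) => //; rewrite [X in (X * _)%E]lebesgue_measure_set1 mul0e.
exists (setT `*` [set b]); split => //; first exact: measurableX.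
by apply: (eq_trans (leb2X _ _)) => //; rewrite [X in (_ * X)%E]lebesgue_measure_set1 mule0.
Qed.

Lemma measurable_tensor (f g : R -> R) : measurable_fun setT f -> measurable_fun setT g ->
  measurable_fun setT (fun x : R * R => f x.1 * g x.2).
Proof.
by move=> mf mg; apply: measurable_funM; apply: measurableT_comp.
Qed.

Lemma ge0_integral_tensor (f g : R -> R) : measurable_fun setT f -> measurable_fun setT g ->
  (forall x, 0 <= f x) -> (forall x, 0 <= g x) ->
  (\int[mu2]_x (f x.1 * g x.2)%:E = \int[mu]_x (f x)%:E * \int[mu]_x (g x)%:E)%E.
Proof.
move=> mf mg f0 g0; rewrite /leb2 fubini_tonelli1/=; last 2 first.
- by apply/measurable_EFinP; exact: measurable_tensor.
- by move=> x; rewrite lee_fin mulr_ge0.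
transitivity (\int[mu]_x ((f x)%:E * \int[mu]_y (g y)%:E))%E.
  apply: eq_integral => x _; rewrite /fubini_F/=.
  under eq_integral do rewrite EFinM.
  rewrite ge0_integralZl//; first exact/measurable_EFinP.
    by move=> y _; rewrite lee_fin.
  by rewrite lee_fin.
rewrite ge0_integralZr//; first exact/measurable_EFinP.
- by move=> x _; rewrite lee_fin.
- by apply: integral_ge0 => y _; rewrite lee_fin.
Qed.

Lemma integrable_tensor (f g : R -> R) : mu.-integrable setT (EFin \o f) ->
  mu.-integrable setT (EFin \o g) ->
  mu2.-integrable setT (EFin \o (fun x => f x.1 * g x.2)).
Proof.
move=> hf hg; have /measurable_EFinP mf := measurable_int _ hf.
have /measurable_EFinP mg := measurable_int _ hg.
apply/integrableP; split; first by apply/measurable_EFinP; exact: measurable_tensor.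
under eq_integral do rewrite /= normrM.
have mn (h : R -> R) : measurable_fun setT h -> measurable_fun setT (fun x => `|h x|).
  by move=> mh; exact: measurableT_comp.
rewrite (ge0_integral_tensor (mn _ mf) (mn _ mg))//.
move/integrableP: hf => [_ ff]; move/integrableP: hg => [_ gg].
by rewrite lte_mul_pinfty// ?integral_ge0// ge0_fin_numE ?integral_ge0//.
Qed.

Lemma Rintegral_tensor (f g : R -> R) : mu.-integrable setT (EFin \o f) ->
  mu.-integrable setT (EFin \o g) ->
  \int[mu2]_x (f x.1 * g x.2) = (\int[mu]_x f x) * (\int[mu]_x g x).
Proof.
move=> hf hg; have hfg := integrable_tensor hf hg.
rewrite /Rintegral -(integral12_prod_meas1 hfg) /fubini_F/=.
rewrite -fineM ?integrable_fin_num//; congr fine.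
transitivity (\int[mu]_x ((\int[mu]_y (g y)%:E) * (f x)%:E))%E.
  apply: eq_integral => x _.
  under eq_integral do rewrite EFinM.
  by rewrite integralZl// muleC.
have /fineK <- := integrable_fin_num measurableT hg.
by rewrite integralZl// muleC.
Qed.

Notation B := (spl (\1_`[0, 1[ : R -> R)).
Implicit Types (k j : int * int) (w : R * R -> R).

(** The tensor product B-spline of bidegree d on the grid of mesh 2^-n, its support having the grid
    point k as lower left corner. The factor 4^n makes it a probability density. *)
Definition kern n (d : nat * nat) k (y : R * R) : R :=
  4 ^+ n * (B d.1 (2 ^+ n * y.1 - k.1%:~R) * B d.2 (2 ^+ n * y.2 - k.2%:~R)).

Lemma unit_fun_B d : unit_fun (B d).
Proof. exact: unit_fun_spl unit_fun_indic. Qed.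

Lemma B_ge0 d x : 0 <= B d x. Proof. by case: (unit_fun_B d) => _ /(_ x)/andP[]. Qed.
Lemma B_le1 d x : B d x <= 1. Proof. by case: (unit_fun_B d) => _ /(_ x)/andP[]. Qed.

Lemma measurable_B_affine d (a b : R) : measurable_fun setT (fun x => B d (a * x - b)).
Proof.
have [mB _] := unit_fun_B d; apply: measurableT_comp => //.
apply: measurable_funB; last exact: measurable_cst.
by apply: measurable_funM => //; exact: measurable_cst.
Qed.

Lemma measurable_kern n (d : nat * nat) k : measurable_fun setT (kern n d k).
Proof.
apply: measurable_funM; first exact: measurable_cst.
by apply: (measurable_tensor (f := fun x => B d.1 (2 ^+ n * x - k.1%:~R))
  (g := fun x => B d.2 (2 ^+ n * x - k.2%:~R))); exact: measurable_B_affine.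
Qed.

Lemma kern_ge0 n (d : nat * nat) k y : 0 <= kern n d k y.
Proof. by rewrite /kern !mulr_ge0// ?B_ge0// exprn_ge0. Qed.

Lemma kern_norm n (d : nat * nat) k y : `|kern n d k y| <= 4 ^+ n.
Proof.
rewrite ger0_norm ?kern_ge0// /kern -[leRHS]mulr1 ler_wpM2l ?exprn_ge0//.
by rewrite mulr_ile1 ?B_ge0 ?B_le1.
Qed.

Lemma integral_kern n (d : nat * nat) k : (\int[mu2]_y (kern n d k y)%:E = 1)%E.
Proof.
under eq_integral do rewrite EFinM.
rewrite ge0_integralZl//; last 2 first.
- apply/measurable_EFinP.
  by apply: (measurable_tensor (f := fun x => B d.1 (2 ^+ n * x - k.1%:~R))
  (g := fun x => B d.2 (2 ^+ n * x - k.2%:~R))); exact: measurable_B_affine.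
- by move=> x _; rewrite lee_fin mulr_ge0 ?B_ge0.
rewrite (ge0_integral_tensor (f := fun x => B d.1 (2 ^+ n * x - k.1%:~R))
  (g := fun x => B d.2 (2 ^+ n * x - k.2%:~R))); last 4 first.
- exact: measurable_B_affine.
- exact: measurable_B_affine.
- by move=> x; exact: B_ge0.
- by move=> x; exact: B_ge0.
have n0 : (0 : R) < 2 ^+ n by rewrite exprn_gt0.
rewrite !integral_spl_affine// -!EFinM; congr EFin.
have -> : (4 : R) = 2 * 2 by lra.
by rewrite exprMn mulrACA !mulfV ?gt_eqF// mulr1.
Qed.

Lemma integrable_kern n (d : nat * nat) k : mu2.-integrable setT (EFin \o kern n d k).
Proof.
apply/integrableP; split; first by apply/measurable_EFinP; exact: measurable_kern.
under eq_integral do rewrite /= ger0_norm ?kern_ge0//.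
by rewrite integral_kern ltry.
Qed.

Lemma Rintegral_kern n (d : nat * nat) k : \int[mu2]_y kern n d k y = 1.
Proof. by rewrite /Rintegral integral_kern. Qed.

Lemma B_supp d x : B d x != 0 -> 0 <= x <= d.+1%:R.
Proof. by move=> /(spl_supp indic_supp); rewrite nat1r. Qed.

Lemma kern_supp n (d : nat * nat) k y : kern n d k y != 0 ->
  (0 <= 2 ^+ n * y.1 - k.1%:~R <= d.1.+1%:R) /\
  (0 <= 2 ^+ n * y.2 - k.2%:~R <= d.2.+1%:R).
Proof.
rewrite /kern !mulf_eq0 !negb_or => /and3P[_ h1 h2].
by split; exact: B_supp.
Qed.

Definition avg n (d : nat * nat) w k : R := \int[mu2]_y (w y * kern n d k y).

Lemma integrable_avg n (d : nat * nat) w k : mu2.-integrable setT (EFin \o w) ->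
  mu2.-integrable setT (EFin \o (fun y => w y * kern n d k y)).
Proof.
move=> hw; apply: (@integrableRM_bound _ _ _ _ _ _ _ (4 ^+ n)) => //.
- exact: measurable_kern.
- by move=> y _; exact: kern_norm.
Qed.

Lemma avgD n (d : nat * nat) w w' k : mu2.-integrable setT (EFin \o w) ->
  mu2.-integrable setT (EFin \o w') ->
  avg n d (fun x => w x + w' x) k = avg n d w k + avg n d w' k.
Proof.
move=> hw hw'; rewrite /avg -RintegralD//; try exact: integrable_avg.
by apply: eq_Rintegral => y _; rewrite mulrDl.
Qed.

Lemma avgZ n (d : nat * nat) w (c : R) k : mu2.-integrable setT (EFin \o w) ->
  avg n d (fun x => c * w x) k = c * avg n d w k.
Proof.
move=> hw; rewrite /avg -RintegralZl//; last exact: integrable_avg.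
by apply: eq_Rintegral => y _; rewrite mulrA.
Qed.

Lemma avg_norm n (d : nat * nat) w k : mu2.-integrable setT (EFin \o w) ->
  `|avg n d w k| <= \int[mu2]_y (`|w y| * kern n d k y).
Proof.
move=> hw; apply: (le_trans (le_normr_Rintegral _ _)) => //; first exact: integrable_avg.
rewrite le_eqVlt; apply/orP; left; apply/eqP; apply: eq_Rintegral => y _.
by rewrite normrM (ger0_norm (kern_ge0 _ _ _ _)).
Qed.

(** The lower left corner of the grid cell containing x. Composing with it turns a grid function
    into a step function of x, so that functions for different n can be compared on the same
    square. *)
Definition cell n (x : R * R) : int * int :=
  (Num.floor (2 ^+ n * x.1), Num.floor (2 ^+ n * x.2)).

Lemma cell_dist (X Y : R) (j : int) (d N : nat) :
  0 <= Y - (Num.floor X + j)%:~R -> Y - (Num.floor X + j)%:~R <= d.+1%:R ->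
  (`|j| + d + 2 <= N)%N -> `|Y - X| <= N%:R.
Proof.
rewrite intrD -natr1 => h1 h2; rewrite -(ler_nat R) !natrD natr_absz intr_norm => hN.
have /andP[f1] := floor_itv X; rewrite intrD => f2.
have := ler_norm (j%:~R : R); have := ler_norm (- j%:~R : R); rewrite normrN => a1 a2.
have d0 : 0 <= d%:R :> R by [].
by rewrite ler_norml; apply/andP; split; lra.
Qed.

(** The density lives within a fixed number of meshes from x, in each coordinate, so the average
    sees only values of w close to x. *)
Lemma avg_near n (d : nat * nat) w x j (e dl : R) : mu2.-integrable setT (EFin \o w) ->
  (forall y, `|y.1 - x.1| < dl -> `|y.2 - x.2| < dl -> `|w y - w x| <= e) ->
  (`|j.1|%N + `|j.2|%N + d.1 + d.2 + 2)%:R < dl * 2 ^+ n ->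
  `|avg n d w (cell n x + j) - w x| <= e.
Proof.
move=> hw wxe hn; set k := cell n x + j.
have -> : w x = \int[mu2]_y (w x * kern n d k y).
  by rewrite RintegralZl// ?Rintegral_kern ?mulr1//; exact: integrable_kern.
have e0 : 0 <= e.
  have dl0 : 0 < dl.
    have := le_lt_trans (ler0n R _) hn.
    by rewrite pmulr_lgt0// exprn_gt0.
  by apply: le_trans (wxe x _ _); rewrite ?normr_ge0// subrr normr0.
rewrite /avg -RintegralB//; last 2 first.
- exact: integrable_avg.
- by apply: integrableRZ => //; exact: integrable_kern.
have iB : mu2.-integrable setT (EFin \o (fun y => w y * kern n d k y - w x * kern n d k y)).
  apply: integrableRB => //; first exact: integrable_avg.
  by apply: integrableRZ => //; exact: integrable_kern.
apply: (le_trans (le_normr_Rintegral _ _)) => //.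
have -> : e = \int[mu2]_y (e * kern n d k y).
  by rewrite RintegralZl// ?Rintegral_kern ?mulr1//; exact: integrable_kern.
apply: le_Rintegral => //.
- exact: integrableR_norm.
- by apply: integrableRZ => //; exact: integrable_kern.
move=> y _; rewrite -mulrBl normrM (ger0_norm (kern_ge0 _ _ _ _)).
have [->|] := eqVneq (kern n d k y) 0; first by rewrite !mulr0.
move=> /kern_supp[/andP[h1 h2] /andP[h3 h4]].
rewrite ler_wpM2r ?kern_ge0//; apply: wxe.
  rewrite -(ltr_pM2r (_ : 0 < 2 ^+ n)) ?exprn_gt0//.
  apply: le_lt_trans hn; rewrite -{1}(@ger0_norm _ (2 ^+ n)) ?exprn_ge0// -normrM mulrBl.
  rewrite [y.1 * _]mulrC [x.1 * _]mulrC.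
  by apply: (@cell_dist _ _ j.1 d.1) => //; lia.
rewrite -(ltr_pM2r (_ : 0 < 2 ^+ n)) ?exprn_gt0//.
apply: le_lt_trans hn; rewrite -{1}(@ger0_norm _ (2 ^+ n)) ?exprn_ge0// -normrM mulrBl.
rewrite [y.2 * _]mulrC [x.2 * _]mulrC.
by apply: (@cell_dist _ _ j.2 d.2) => //; lia.
Qed.

Definition cellset n (i : nat) : set R := `[i%:R / 2 ^+ n, i.+1%:R / 2 ^+ n[.

Lemma cellsetP n i (x : R) : cellset n i x <-> Num.floor (2 ^+ n * x) = i%:Z.
Proof.
have n0 : (0 : R) < 2 ^+ n by rewrite exprn_gt0.
rewrite /cellset /= in_itv/= ler_pdivrMr// ltr_pdivlMr// mulrC.
split=> [h|/eqP].
  by apply: floor_def; rewrite -[X in (i%:Z + X)]/(1%:Z) -PoszD addn1.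
by rewrite floor_eq -[X in (i%:Z + X)]/(1%:Z) -PoszD addn1.
Qed.

Lemma measurable_cellset n i : measurable (cellset n i).
Proof. exact: measurable_itv. Qed.

Lemma measurable_unit_cell n i : measurable (`]0, 1[ `&` cellset n i).
Proof. by apply: measurableI; [exact: measurable_itv|exact: measurable_cellset]. Qed.

Lemma mu_cellset n (i : 'I_(2 ^ n)) : mu (`]0, 1[ `&` cellset n i) = ((2 ^- n)%:E)%E.
Proof.
have n0 : (0 : R) < 2 ^+ n by rewrite exprn_gt0.
have le1 : i.+1%:R / 2 ^+ n <= 1 :> R.
  by rewrite ler_pdivrMr// mul1r -natrX ler_nat.
have hlt : (i%:R / 2 ^+ n < i.+1%:R / 2 ^+ n :> R).
  by rewrite ltr_pM2r ?invr_gt0// ltr_nat.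
have len : i.+1%:R / 2 ^+ n - i%:R / 2 ^+ n = 2 ^- n :> R.
  by rewrite -mulrBl -natr1 addrC addKr mul1r.
apply/eqP; rewrite eq_le; apply/andP; split.
  apply: (@le_trans _ _ (mu (cellset n i))).
    apply: (@le_measure _ _ _ mu); rewrite ?inE; last exact: subIsetr.
      exact: measurable_unit_cell.
    exact: measurable_cellset.
  by rewrite [leLHS](lebesgue_measure_itv `[i%:R / 2 ^+ n, i.+1%:R / 2 ^+ n[)/= lte_fin hlt -EFinB len.
apply: (@le_trans _ _ (mu `]i%:R / 2 ^+ n, i.+1%:R / 2 ^+ n[)).
  by rewrite [leRHS](lebesgue_measure_itv `]i%:R / 2 ^+ n, i.+1%:R / 2 ^+ n[)/= lte_fin hlt -EFinB len.
apply: (@le_measure _ _ _ mu); rewrite ?inE.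
- exact: measurable_itv.
- exact: measurable_unit_cell.
move=> x /=; rewrite /cellset /= !in_itv/= => /andP[h1 h2]; rewrite (ltW h1) h2; split => //.
by rewrite (lt_le_trans h2 le1) andbT (le_lt_trans _ h1)// divr_ge0// ltW.
Qed.

Definition cell_idx n (k : 'I_(2 ^ n) * 'I_(2 ^ n)) : int * int := (k.1%:Z, k.2%:Z).

Lemma floor_unit n (x : R) : 0 < x < 1 ->
  exists i : 'I_(2 ^ n), Num.floor (2 ^+ n * x) = i%:Z.
Proof.
move=> /andP[x0 x1]; have n0 : (0 : R) < 2 ^+ n by rewrite exprn_gt0.
have f0 : 0 <= Num.floor (2 ^+ n * x) by rewrite floor_ge0 mulr_ge0// ltW.
have : Num.floor (2 ^+ n * x) < (2 ^ n)%N%:Z.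
  by rewrite floor_lt_int -[_%:~R]/((2 ^ n)%N%:R) natrX gtr_pMr.
case: (Num.floor _) f0 => // i _; rewrite ltz_nat => hi.
by exists (Ordinal hi).
Qed.

Lemma step_sum n (a : int * int -> R) x : Omega x ->
  a (cell n x) = \sum_(k : 'I_(2 ^ n) * 'I_(2 ^ n))
    a (cell_idx k) * (\1_(cellset n k.1) x.1 * \1_(cellset n k.2) x.2).
Proof.
case=> /=; rewrite !in_itv/= => /(floor_unit n)[i hi] /(floor_unit n)[j hj].
rewrite (bigD1 (i, j))//= big1 ?addr0; last first.
  move=> [i' j'] /=; rewrite xpair_eqE negb_and => /orP[h|h].
    rewrite [\1__ x.1]indicE memNset ?mul0r ?mulr0//.
    by move=> /cellsetP; rewrite hi => -[] /val_inj e; rewrite e eqxx in h.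
  rewrite [\1__ x.2]indicE memNset ?mul0r ?mulr0//.
  by move=> /cellsetP; rewrite hj => -[] /val_inj e; rewrite e eqxx in h.
rewrite !indicE !mem_set ?mulr1; try exact/cellsetP.
by rewrite /cell hi hj.
Qed.

Lemma measurable_cell_indic n (i j : nat) :
  measurable_fun setT (fun x : R * R => \1_(cellset n i) x.1 * \1_(cellset n j) x.2 : R).
Proof.
by apply: (measurable_tensor (f := \1_(cellset n i)) (g := \1_(cellset n j)));
  apply: measurable_indic; exact: measurable_cellset.
Qed.

Lemma cell_indic_norm n (i j : nat) (x : R * R) :
  `|\1_(cellset n i) x.1 * \1_(cellset n j) x.2 : R| <= 1.
Proof. by rewrite !indicE; do 2 case: (_ \in _); rewrite ?mulr0 ?mul0r ?mulr1 ?normr0 ?normr1. Qed.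

Lemma integrable_cell_indic n (i j : nat) :
  mu2.-integrable (@Omega R) (EFin \o (fun x : R * R => \1_(cellset n i) x.1 * \1_(cellset n j) x.2)).
Proof.
apply: (@integrableR_bound _ _ _ _ _ _ 1).
- exact: measurable_Omega.
- by rewrite [X in (X < _)%E]leb2_Omega ltry.
- by apply: measurable_funTS; exact: measurable_cell_indic.
- by move=> x _; exact: cell_indic_norm.
Qed.

Lemma integral_cell_indic n (i j : 'I_(2 ^ n)) :
  \int[mu2]_(x in @Omega R) (\1_(cellset n i) x.1 * \1_(cellset n j) x.2) = 4 ^- n :> R.
Proof.
have int1 (l : 'I_(2 ^ n)) : (\int[mu]_x (\1_(`]0, 1[ `&` cellset n l) x)%:E = (2 ^- n)%:E)%E.
  rewrite integral_indic//; last exact: measurable_unit_cell.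
  by rewrite setIT; exact: mu_cellset.
have -> : 4 ^- n = 2 ^- n * 2 ^- n :> R.
  by rewrite -invfM -exprMn; congr (_ ^+ _)^-1; lra.
have <- : \int[mu2]_x (\1_(`]0, 1[ `&` cellset n i) x.1 * \1_(`]0, 1[ `&` cellset n j) x.2) =
   2 ^- n * 2 ^- n :> R.
  rewrite /Rintegral (ge0_integral_tensor (f := \1_(`]0, 1[ `&` cellset n i))
    (g := \1_(`]0, 1[ `&` cellset n j))) ?int1//.
  - by apply: measurable_indic; exact: measurable_unit_cell.
  - by apply: measurable_indic; exact: measurable_unit_cell.
rewrite Rintegral_mkcond; apply: eq_Rintegral => x _.
rewrite patchE /Omega in_setX !indicI /=.
rewrite !indicE; case: (_ \in _) => /=; rewrite ?mul0r ?mul1r//.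
by case: (_ \in _) => /=; rewrite ?mul0r ?mul1r ?mulr0.
Qed.

Lemma integrable_step n (a : int * int -> R) :
  mu2.-integrable (@Omega R) (EFin \o (fun x => a (cell n x))).
Proof.
have h : mu2.-integrable (@Omega R) (EFin \o (fun x : R * R =>
    \sum_(k : 'I_(2 ^ n) * 'I_(2 ^ n))
    a (cell_idx k) * (\1_(cellset n k.1) x.1 * \1_(cellset n k.2) x.2))).
  apply: integrableR_sum => [|k]; first exact: measurable_Omega.
  by apply: integrableRZ; [exact: measurable_Omega|exact: integrable_cell_indic].
have fg : forall x : R * R, Omega x -> \sum_(k : 'I_(2 ^ n) * 'I_(2 ^ n))
    a (cell_idx k) * (\1_(cellset n k.1) x.1 * \1_(cellset n k.2) x.2) = a (cell n x).
  by move=> x Ox; rewrite (step_sum n a Ox).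
exact: (eq_integrableR measurable_Omega fg h).
Qed.

Lemma integral_step n (a : int * int -> R) :
  \int[mu2]_(x in @Omega R) a (cell n x) =
  4 ^- n * \sum_(k : 'I_(2 ^ n) * 'I_(2 ^ n)) a (cell_idx k).
Proof.
transitivity (\int[mu2]_(x in @Omega R) \sum_(k : 'I_(2 ^ n) * 'I_(2 ^ n))
    a (cell_idx k) * (\1_(cellset n k.1) x.1 * \1_(cellset n k.2) x.2)).
  by apply: eq_Rintegral => x; rewrite inE => Ox; rewrite (step_sum n a Ox).
rewrite Rintegral_sum; last 2 first.
- exact: measurable_Omega.
- by move=> k; apply: integrableRZ; [exact: measurable_Omega|exact: integrable_cell_indic].
rewrite big_distrr; apply: eq_bigr => k _ /=.
rewrite RintegralZl; last 2 first.
- exact: measurable_Omega.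
- exact: integrable_cell_indic.
by rewrite integral_cell_indic mulrC.
Qed.

Lemma kern_sum n (d : nat * nat) j y :
  \sum_(k : 'I_(2 ^ n) * 'I_(2 ^ n)) kern n d (cell_idx k + j) y <= 4 ^+ n.
Proof.
rewrite /kern -big_distrr /= -[leRHS]mulr1 ler_wpM2l ?exprn_ge0//.
rewrite -(pair_bigA _ (fun k1 k2 : 'I_(2 ^ n) => B d.1 (2 ^+ n * y.1 - (k1%:Z + j.1)%:~R)
   * B d.2 (2 ^+ n * y.2 - (k2%:Z + j.2)%:~R)))/=.
rewrite -big_distrlr /=.
have h e (z : R) (l : int) : \sum_(k < 2 ^ n) B e (z - (k%:Z + l)%:~R) <= 1.
  apply: le_trans (spl_sum_le1 e (2 ^ n) (z - l%:~R)).
  rewrite le_eqVlt; apply/orP; left; apply/eqP; apply: eq_bigr => k _.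
  by rewrite intrD [k%:~R + _]addrC opprD addrA.
by rewrite mulr_ile1 ?h// sumr_ge0// => k _; exact: B_ge0.
Qed.

(** The integral of the step function is a sum over the cells, each of area 4^-n, and the kernels of
    all cells add up to at most 4^n. Hence averaging is a contraction uniformly in n. *)
Lemma avg_L1 n (d : nat * nat) w j : mu2.-integrable setT (EFin \o w) ->
  \int[mu2]_(x in @Omega R) `|avg n d w (cell n x + j)| <= \int[mu2]_x `|w x|.
Proof.
move=> hw; rewrite (integral_step n (fun k => `|avg n d w (k + j)|)).
have hwn := integrableR_norm measurableT hw.
rewrite ler_pdivrMl ?exprn_gt0//.
apply: (@le_trans _ _ (\sum_(k : 'I_(2 ^ n) * 'I_(2 ^ n))
   \int[mu2]_y (`|w y| * kern n d (cell_idx k + j) y))).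
  by apply: ler_sum => k _; exact: avg_norm.
rewrite -Rintegral_sum//; last by move=> k; exact: integrable_avg.
rewrite -RintegralZl//; apply: le_Rintegral => //.
- by apply: integrableR_sum => // k; exact: integrable_avg.
- exact: integrableRZ.
move=> y _; rewrite -big_distrr/= mulrC ler_wpM2r//.
exact: kern_sum.
Qed.

Lemma cell_avg_measurable n (d : nat * nat) w j :
  measurable_fun (@Omega R) (fun x => avg n d w (cell n x + j)).
Proof.
have /measurable_EFinP// := measurable_int _ (integrable_step n (fun k => avg n d w (k + j))).
Qed.

Definition defect n (d : nat * nat) j w : R :=
  \int[mu2]_(x in @Omega R) `|avg n d w (cell n x + j) - w x|.

Definition avg_converges (d : nat * nat) j w : Prop :=
  mu2.-integrable setT (EFin \o w) /\ defect n d j w @[n --> \oo] --> (0 : R).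

Lemma integrable_Omega w : mu2.-integrable setT (EFin \o w) ->
  mu2.-integrable (@Omega R) (EFin \o w).
Proof. by apply: integrableS => //; exact: measurable_Omega. Qed.

Lemma Rintegral_Omega_le w : mu2.-integrable setT (EFin \o w) -> (forall x, 0 <= w x) ->
  \int[mu2]_(x in @Omega R) w x <= \int[mu2]_x w x.
Proof.
move=> hw w0; rewrite /Rintegral; apply: fine_le.
- apply: integrable_fin_num; [exact: measurable_Omega|exact: integrable_Omega].
- exact: integrable_fin_num.
apply: ge0_subset_integral => //; first exact: measurable_Omega.
  exact: measurable_int hw.
by move=> x _; rewrite lee_fin.
Qed.

Lemma integrable_defect n (d : nat * nat) j w : mu2.-integrable setT (EFin \o w) ->
  mu2.-integrable (@Omega R) (EFin \o (fun x => avg n d w (cell n x + j) - w x)).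
Proof.
move=> hw; apply: integrableRB; [exact: measurable_Omega| |exact: integrable_Omega].
exact: (integrable_step n (fun k => avg n d w (k + j))).
Qed.

Lemma defect_ge0 n (d : nat * nat) j w : 0 <= defect n d j w.
Proof. by apply: Rintegral_ge0 => x _. Qed.

Lemma defectD n (d : nat * nat) j w w' : mu2.-integrable setT (EFin \o w) ->
  mu2.-integrable setT (EFin \o w') ->
  defect n d j (fun x => w x + w' x) <= defect n d j w + defect n d j w'.
Proof.
move=> hw hw'; rewrite /defect.
have hO := measurable_Omega.
have ww' := integrableRD measurableT hw hw'.
rewrite -RintegralD//; try by apply: integrableR_norm => //; exact: integrable_defect.
apply: le_Rintegral => //.
- by apply: integrableR_norm => //; exact: integrable_defect.
- by apply: integrableRD => //; apply: integrableR_norm => //; exact: integrable_defect.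
by move=> x _; rewrite avgD// opprD addrACA ler_normD.
Qed.

Lemma defectZ n (d : nat * nat) j w (c : R) : mu2.-integrable setT (EFin \o w) ->
  defect n d j (fun x => c * w x) = `|c| * defect n d j w.
Proof.
move=> hw; rewrite /defect -RintegralZl//; last 2 first.
- exact: measurable_Omega.
- by apply: integrableR_norm; [exact: measurable_Omega|exact: integrable_defect].
by apply: eq_Rintegral => x _; rewrite avgZ// -mulrBr normrM.
Qed.

Lemma defect_le2 n (d : nat * nat) j w : mu2.-integrable setT (EFin \o w) ->
  defect n d j w <= 2 * \int[mu2]_x `|w x|.
Proof.
move=> hw; have hO := measurable_Omega.
have hs := integrable_step n (fun k => `|avg n d w (k + j)|).
have hn := integrableR_norm hO (integrable_Omega hw).
apply: (@le_trans _ _ (\int[mu2]_(x in @Omega R) `|avg n d w (cell n x + j)| +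
    \int[mu2]_(x in @Omega R) `|w x|)).
  rewrite -RintegralD//; apply: le_Rintegral => //.
  - by apply: integrableR_norm => //; exact: integrable_defect.
  - exact: integrableRD.
  - by move=> x _; exact: ler_normB.
rewrite mulr2n mulrDl !mul1r lerD//; first exact: avg_L1.
by apply: Rintegral_Omega_le => //; exact: integrableR_norm.
Qed.

Lemma avg_convergesD (d : nat * nat) j w w' : avg_converges d j w -> avg_converges d j w' ->
  avg_converges d j (fun x => w x + w' x).
Proof.
move=> [iw cw] [iw' cw']; split; first exact: integrableRD.
apply: (@squeeze_cvgr _ _ _ _ (fun=> 0) (fun n => defect n d j w + defect n d j w')).
- by apply: nearW => n; rewrite defect_ge0/= defectD.
- exact: cvg_cst.
- by rewrite -[0 in X in _ --> X]addr0; exact: cvgD.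
Qed.

Lemma avg_convergesZ (d : nat * nat) j w (c : R) : avg_converges d j w ->
  avg_converges d j (fun x => c * w x).
Proof.
move=> [iw cw]; split; first exact: integrableRZ.
under eq_fun do rewrite defectZ//.
have -> : (0 : R) = `|c| * 0 by rewrite mulr0.
by apply: cvgM => //; exact: cvg_cst.
Qed.

(** Because of the contraction, a perturbation of w of L_1 norm at most e changes the defect by at
    most 2 e, whatever n is. *)
Lemma avg_converges_closed (d : nat * nat) j w : mu2.-integrable setT (EFin \o w) ->
  (forall e : R, 0 < e -> exists2 w', avg_converges d j w' & \int[mu2]_x `|w x - w' x| <= e) ->
  avg_converges d j w.
Proof.
move=> iw H; split => //; apply/cvgrPdist_le => e e0.
have e4 : 0 < e / 4 by lra.
have [w' [iw' cw'] ww'] := H _ e4.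
near=> n; rewrite sub0r normrN ger0_norm ?defect_ge0//.
have -> : w = (fun x => w' x + (w x - w' x)) by apply/funext => x; rewrite addrC subrK.
have iB := integrableRB measurableT iw iw'.
apply: (le_trans (defectD _ _ _ iw' iB)).
have := defect_le2 n d j iB.
have : defect n d j w' <= e / 2.
  rewrite -[leLHS]ger0_norm ?defect_ge0// -normrN -sub0r.
  near: n; move/cvgrPdist_le: cw'; apply; lra.
have := ww'; set I := Rintegral _ _ _; lra.
Unshelve. all: by end_near.
Qed.

Lemma cvg_avg_pt (d : nat * nat) j w x : mu2.-integrable setT (EFin \o w) ->
  (exists2 dl : R, 0 < dl & forall y, `|y.1 - x.1| < dl -> `|y.2 - x.2| < dl -> w y = w x) ->
  avg n d w (cell n x + j) @[n --> \oo] --> w x.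
Proof.
move=> iw [dl dl0 hdl]; apply: cvg_near_cst; near=> n.
apply/eqP; rewrite -subr_eq0 -normr_le0; apply: (avg_near (dl := dl)) => //.
  by move=> y h1 h2; rewrite hdl// subrr normr0.
have : (`|j.1|%N + `|j.2|%N + d.1 + d.2 + 2)%:R / dl < n%:R :> R.
  by near: n; exact: nbhs_infty_gtr.
rewrite ltr_pdivrMr// mulrC => /lt_le_trans; apply; rewrite ler_pM2l//.
by rewrite -natrX ler_nat ltnW// ltn_expl.
Unshelve. all: by end_near.
Qed.

Lemma ae_leb2_filter : Filter (nbhs (almost_everywhere mu2)).
Proof. exact: ae_filter_ringOfSetsType. Qed.
#[local] Existing Instance ae_leb2_filter.

(** Where w is locally constant the averages are eventually equal to its value; the bound |w| <= 1
    permits dominated convergence on the square. *)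
Lemma avg_converges_ae (d : nat * nat) j (w : R * R -> R) : mu2.-integrable setT (EFin \o w) ->
  (forall x, `|w x| <= 1) ->
  {ae mu2, forall x, Omega x -> exists2 dl : R, 0 < dl &
     forall y, `|y.1 - x.1| < dl -> `|y.2 - x.2| < dl -> w y = w x} ->
  avg_converges d j w.
Proof.
move=> iw w1 hw; split => //; have hO := measurable_Omega.
have -> : (0 : R) = \int[mu2]_(x in @Omega R) 0 by rewrite Rintegral_cst// mul0r.
have mw : measurable_fun (@Omega R) w.
  by have /measurable_EFinP := measurable_int _ (integrable_Omega iw).
apply: (Rdominated_cvg (g := fun=> 2)) => //.
- move=> n; apply: measurableT_comp => //; apply: measurable_funB => //.
  exact: cell_avg_measurable.
- apply: (filterS _ hw) => x h Ox; have := cvg_avg_pt d j iw (h Ox) => ch.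
  rewrite -(normr0 R); apply: cvg_norm; rewrite -(subrr (w x)).
  by apply: cvgB => //; exact: cvg_cst.
- apply: (@integrableR_bound _ _ _ _ _ _ 2) => //; first by rewrite [X in (X < _)%E]leb2_Omega ltry.
  by move=> x _; rewrite ger0_norm.
- move=> n x _; rewrite normr_id (le_trans (ler_normB _ _))//.
  have -> : (2 : R) = 1 + 1 by lra.
  apply: lerD => //; apply: (le_trans (avg_norm _ _ _ iw)).
  rewrite -(Rintegral_kern n d (cell n x + j)); apply: le_Rintegral => //.
  + by apply: integrable_avg; exact: integrableR_norm.
  + exact: integrable_kern.
  + by move=> y _; rewrite -[leRHS]mul1r ler_wpM2r ?kern_ge0.
Qed.

(** A generating family stable under intersection. A ray has a single boundary point, so the
    products of two of them are locally constant off two lines. *)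
Definition rays : set (set R) := [set A | A = setT \/ exists a, A = `]a, +oo[%classic].

Lemma rays_setI : setI_closed rays.
Proof.
move=> _ B' [->|[a ->]]; first by rewrite setTI.
case=> [->|[b ->]]; first by rewrite setIT; right; exists a.
right; exists (Num.max a b); apply/seteqP; split => x /=; rewrite !in_itv/= !andbT gt_max.
  by case=> -> ->.
by move=> /andP.
Qed.

Definition ray_rects : set (set (R * R)) := [set X | exists2 A, rays A & exists2 C, rays C & X = A `*` C].

Lemma ray_rects_setI : setI_closed ray_rects.
Proof.
move=> _ _ [A rA [C rC ->]] [A' rA' [C' rC' ->]].
exists (A `&` A'); first exact: rays_setI.
by exists (C `&` C'); [exact: rays_setI|rewrite setXI].
Qed.

Lemma measurable_ray_rects :
  (measurable : set (set (measurableTypeR R * measurableTypeR R))) = <<s ray_rects >>.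
Proof.
apply/seteqP; split.
  rewrite measurable_prod_measurableType.
  apply: smallest_sub; first exact: smallest_sigma_algebra.
  (* A coordinate projection is measurable for the generated sigma-algebra as soon as preimages of
     open rays are. *)
  have key (p : R * R -> R) :
      (forall a : R, <<s ray_rects >> (p @^-1` `]a, +oo[)) ->
      forall A : set (measurableTypeR R), measurable A -> <<s ray_rects >> (p @^-1` A).
    move=> hp A mA.
    have : measurable_fun setT (p : g_sigma_algebraType ray_rects -> R).
      apply: (measurability _ (RGenOInfty.measurableE R)) => //.
      by move=> _ [_ [a ->] <-]; rewrite setTI; exact: hp.
    by move=> /(_ measurableT A mA); rewrite setTI.
  move=> _ [A mA [C mC <-]].
  have -> : A `*` C = (fst @^-1` A) `&` (snd @^-1` C) :> set (R * R) by [].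
  have h := @measurableI _ (g_sigma_algebraType ray_rects) (fst @^-1` A) (snd @^-1` C).
  apply: h; apply: key => // a; apply: sub_sigma_algebra.
    exists `]a, +oo[%classic; first by right; exists a.
    exists setT; first by left.
    by apply/seteqP; split => -[x y] //= [].
  exists setT; first by left.
  exists `]a, +oo[%classic; first by right; exists a.
  by apply/seteqP; split => -[x y] //= [].
apply: smallest_sub; first exact: sigma_algebra_measurable.
have mr A : rays A -> measurable (A : set (measurableTypeR R)).
  by case=> [->//|[a ->]]; exact: measurable_itv.
by move=> _ [A /mr mA [C /mr mC ->]]; exact: measurableX.
Qed.

Definition loc_cst (A : set R) (x : R) :=
  exists2 dl : R, 0 < dl & forall y, `|y - x| < dl -> A y <-> A x.

Lemma rays_loc_cst A : rays A -> exists c : R, forall x, x != c -> loc_cst A x.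
Proof.
case=> [->|[a ->]]; first by exists 0 => x _; exists 1.
exists a => x xa; exists `|x - a|; first by rewrite normr_gt0 subr_eq0.
move=> y; rewrite /= !in_itv/= !andbT.
have [ax|xa'] := ltP a x.
  by rewrite (gtr0_norm (_ : 0 < x - a)) ?subr_gt0// ltr_norml => /andP[h _]; split => // _; lra.
have {}xa' : x < a by rewrite lt_neqAle xa.
rewrite (ltr0_norm (_ : x - a < 0)) ?subr_lt0// ltr_norml => /andP[_ h]; split; lra.
Qed.

Lemma unit_loc_cst (x : R) : 0 < x < 1 -> loc_cst `]0, 1[ x.
Proof.
move=> /andP[x0 x1]; exists (Num.min x (1 - x)); first by rewrite lt_min x0; lra.
move=> y; rewrite /= !in_itv/= x0 x1 lt_min => /andP[]; rewrite !ltr_norml.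
by move=> /andP[h1 h2] /andP[h3 h4]; split => // _; apply/andP; split; lra.
Qed.

Lemma indic_norm (T : Type) (A : set T) (x : T) : `|\1_A x : R| <= 1.
Proof. by rewrite indicE; case: (_ \in _); rewrite ?normr0 ?normr1. Qed.

Lemma integrable_indic_Omega (E : set (measurableTypeR R * measurableTypeR R)) : measurable E ->
  mu2.-integrable setT (EFin \o (\1_(E `&` @Omega R) : R * R -> R)).
Proof.
move=> mE; have mEO : measurable (E `&` @Omega R : set (measurableTypeR R * measurableTypeR R)).
  by apply: measurableI => //; exact: measurable_Omega.
apply/integrableP; split; first by apply/measurable_EFinP; exact: measurable_indic.
under eq_integral do rewrite /= ger0_norm ?indic_ge0//.
rewrite integral_indic// setIT; apply: (@le_lt_trans _ _ (mu2 (@Omega R))); last first.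
  by rewrite leb2_Omega ltry.
by apply: le_measure; rewrite ?inE//; exact: measurable_Omega.
Qed.

Lemma avg_converges_rect (d : nat * nat) j (A C : set R) : rays A -> rays C ->
  avg_converges d j (\1_(A `*` C `&` @Omega R) : R * R -> R).
Proof.
move=> rA rC; apply: avg_converges_ae.
- apply: integrable_indic_Omega; rewrite measurable_ray_rects; apply: sub_sigma_algebra.
  by exists A => //; exists C.
- by move=> x; exact: indic_norm.
have [a ha] := rays_loc_cst rA; have [c hc] := rays_loc_cst rC.
have hn := @negligibleS _ _ _ mu2 _ _ _ (leb2_lines a c); apply: hn => x /= hx.
apply: contrapT => /not_orP[/eqP xa /eqP xc]; apply: hx => -[] /=.
rewrite !in_itv/= => x1 x2.
have [d1 d10 h1] := ha _ xa; have [d2 d20 h2] := hc _ xc.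
have [d3 d30 h3] := unit_loc_cst x1; have [d4 d40 h4] := unit_loc_cst x2.
exists (Num.min (Num.min d1 d2) (Num.min d3 d4)); first by rewrite !lt_min d10 d20 d30 d40.
move=> y; rewrite !lt_min => /andP[/andP[y1 _] /andP[y3 _]] /andP[/andP[_ y2] /andP[_ y4]].
rewrite !indicE; congr (nat_of_bool _)%:R; apply/idP/idP; rewrite !inE /Omega /=.
  by move=> [[/(h1 _ y1) ? /(h2 _ y2) ?] [/(h3 _ y3) ? /(h4 _ y4) ?]].
by move=> [[/(h1 _ y1) ? /(h2 _ y2) ?] [/(h3 _ y3) ? /(h4 _ y4) ?]].
Qed.

(** Finite disjoint unions follow from additivity of indicator functions. Their indicators converge
    in L_1 to that of the countable union, dominated by the indicator of the square. *)
Lemma avg_converges_bigcup (d : nat * nat) j (F : nat -> set (measurableTypeR R * measurableTypeR R)) :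
  (forall n, measurable (F n)) -> trivIset setT F ->
  (forall n, avg_converges d j (\1_(F n `&` @Omega R) : R * R -> R)) ->
  avg_converges d j (\1_(\bigcup_k F k `&` @Omega R) : R * R -> R).
Proof.
move=> mF tF cF.
  have cT : avg_converges d j (\1_(setT `&` @Omega R) : R * R -> R).
    by rewrite -setXTT; apply: avg_converges_rect; left.
  have mU : measurable (\bigcup_k F k) by exact: bigcup_measurable.
  apply: avg_converges_closed; first exact: integrable_indic_Omega.
  move=> e e0.
  pose W N : set (measurableTypeR R * measurableTypeR R) := \big[setU/set0]_(i < N) F i.
  have WP N x : W N x <-> exists2 i, (i < N)%N & F i x.
    by rewrite /W -(bigcup_mkord N (fun i => F i)); split => -[i iN Fi]; exists i.
  have mW N : measurable (W N).
    elim: N => [|N IH]; first by rewrite /W big_ord0.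
    by rewrite /W big_ord_recr; exact: (measurableU _ _ IH (mF N)).
  have cW N : avg_converges d j (\1_(W N `&` @Omega R) : R * R -> R).
    elim: N => [|N IH].
      have := avg_convergesZ 0 cT; congr (avg_converges _ _ _); apply/funext => x.
      by rewrite mul0r /W big_ord0 set0I indic0.
    have := avg_convergesD IH (cF N); congr (avg_converges _ _ _); apply/funext => x.
    rewrite !indicI /= -mulrDl; congr (_ * _); rewrite !indicE.
    have [WNx|WNx] := boolP (x \in W N).
      rewrite [x \in F N]memNset ?addr0 ?mem_set//.
        by rewrite /W big_ord_recr; left; rewrite inE in WNx.
      move=> FNx; move: WNx; rewrite inE => /WP[i iN Fix].
      have := tF i N Logic.I Logic.I => h; have iEN : i = N by apply: h; exists x.
      by rewrite iEN ltnn in iN.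
    rewrite add0r; congr (nat_of_bool _)%:R; apply/idP/idP; rewrite !inE.
      by move=> FNx; rewrite /W big_ord_recr; right.
    rewrite /W big_ord_recr => -[] // h; move: WNx; rewrite notin_setE.
    by move=> /(_ h).
  have : \int[mu2]_x `|\1_(\bigcup_k F k `&` @Omega R) x - \1_(W N `&` @Omega R) x|
      @[N --> \oo] --> (\int[mu2]_x 0 : R).
    pose H N : R * R -> R := fun x =>
      `|\1_(\bigcup_k F k `&` @Omega R) x - \1_(W N `&` @Omega R) x|.
    apply: (@Rdominated_cvg _ _ _ mu2 setT H (fun=> 0) (\1_(setT `&` @Omega R))) => //.
    + move=> N; apply: measurableT_comp => //; apply: measurable_funB.
        by apply: measurable_indic; apply: measurableI => //; exact: measurable_Omega.
      by apply: measurable_indic; apply: measurableI => //; exact: measurable_Omega.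
    + apply: nearW => x _; apply: cvg_near_cst.
      have [[i _ Fix]|nU] := pselect ((\bigcup_k F k) x).
        near=> N; apply/eqP; rewrite normr_eq0 subr_eq0 !indicI /= !indicE.
        rewrite mem_set; last by exists i.
        rewrite [x \in W N]mem_set//.
        by apply/WP; exists i => //; near: N; exact: nbhs_infty_gt.
      near=> N; apply/eqP; rewrite normr_eq0 subr_eq0 !indicI /= !indicE.
      rewrite memNset// [x \in W N]memNset//.
      by move=> /WP[i _ Fix]; apply: nU; exists i.
    + by case: cT.
    + move=> N x _; rewrite /H normr_id !indicE setTI.
      have [Ox|Ox] := pselect (Omega x); last first.
        rewrite !memNset ?subrr ?normr0// => -[_ Ox'].
          exact: Ox Ox'.
        exact: Ox Ox'.
      rewrite [X in _ <= (nat_of_bool X)%:R]mem_set//.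
      by do 2 case: (_ \in _); rewrite ?subrr ?subr0 ?sub0r ?normrN ?normr1 ?normr0 ?ler01.
  rewrite Rintegral_cst// mul0r => /cvgrPdist_le/(_ _ e0)[N _ /(_ N (leqnn _))].
  rewrite sub0r normrN => h; exists (\1_(W N `&` @Omega R)) => //.
  by apply: le_trans h; rewrite ler_norm.
Unshelve. all: by end_near.
Qed.

(** Dynkin's theorem: the sets with this property contain the rectangles of rays and are stable
    under complements and countable disjoint unions. Intersecting with the square keeps every
    indicator integrable. *)
Lemma avg_converges_indic (d : nat * nat) j (E : set (measurableTypeR R * measurableTypeR R)) :
  measurable E -> avg_converges d j (\1_(E `&` @Omega R) : R * R -> R).
Proof.
move=> mE; move: (mE); rewrite measurable_ray_rects.
have cT : avg_converges d j (\1_(setT `&` @Omega R) : R * R -> R).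
  by rewrite -setXTT; apply: avg_converges_rect; left.
apply: (dynkin_induction (P := fun E => avg_converges d j (\1_(E `&` @Omega R) : R * R -> R))
  measurable_ray_rects ray_rects_setI) => //.
- by move=> _ [A rA [C rC ->]]; exact: avg_converges_rect.
- move=> S mS /(avg_convergesZ (-1)) cS.
  have := avg_convergesD cT cS; congr (avg_converges _ _ _); apply/funext => x.
  rewrite mulN1r !indicE !in_setI in_setT in_setC /=.
  by case: (x \in S); case: (x \in @Omega R); rewrite /= ?subrr ?subr0.
- by move=> F mF tF cF; exact: avg_converges_bigcup.
Qed.

Lemma avg_converges_sum (d : nat * nat) j (s : seq R) (F : R -> R * R -> R) :
  (forall r, avg_converges d j (F r)) -> avg_converges d j (fun x => \sum_(r <- s) F r x).
Proof.
move=> cF; elim: s => [|r s IH].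
  have := avg_convergesZ 0 (cF 0); congr (avg_converges _ _ _); apply/funext => x.
  by rewrite mul0r big_nil.
have := avg_convergesD (cF r) IH; congr (avg_converges _ _ _); apply/funext => x.
by rewrite big_cons.
Qed.

Import HBSimple.

(** Simple functions are dense in L_1. Cutting the approximant off to the square does not move it
    away from w, which vanishes outside. *)
Lemma avg_convergesP (d : nat * nat) j w : mu2.-integrable setT (EFin \o w) ->
  (forall x, ~ Omega x -> w x = 0) -> avg_converges d j w.
Proof.
move=> iw w0; apply: avg_converges_closed => // e e0.
have [g [ig _ cg]] := approximation_sfun_integrable measurableT iw.
have cgR : \int[mu2]_x `|w x - g n x| @[n --> \oo] --> (0 : R).
  exact: (fine_cvg cg).
have := cgR; move/cvgrPdist_le => /(_ _ e0)[N _ /(_ N (leqnn _))].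
rewrite sub0r normrN => h.
have cE : avg_converges d j (fun x => g N x * \1_(@Omega R) x).
  have -> : (fun x => g N x * \1_(@Omega R) x) = (fun x => \sum_(r <- fset_set (range (g N)))
      r * \1_(g N @^-1` [set r] `&` @Omega R) x).
    apply/funext => x; rewrite [in LHS](fimfunE (g N)) fsbig_finite//= big_distrl/=.
    by apply: eq_bigr => r _; rewrite indicI/= mulrA.
  apply: avg_converges_sum => r; apply: avg_convergesZ; apply: avg_converges_indic.
  exact: measurable_funPTI (measurable_set1 r).
exists (fun x => g N x * \1_(@Omega R) x) => //.
have igN : mu2.-integrable setT (EFin \o (fun x => w x - g N x)).
  by apply: integrableRB => //; exact: ig.
apply: le_trans (le_trans h (lexx _)); rewrite ger0_norm ?Rintegral_ge0//.
apply: le_Rintegral => //.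
- by apply: integrableR_norm => //; apply: integrableRB => //; case: cE.
- exact: integrableR_norm.
move=> x _; rewrite indicE; have [Ox|Ox] := pselect (Omega x).
  by rewrite mem_set// mulr1.
by rewrite memNset// mulr0 subr0 w0// normr0.
Qed.

End GridAverages.

(** * Tensor products of smooth functions as test functions *)

Section TestFunctions.
Context {R : realType}.
Implicit Types f g : R -> R.

Definition tens f g (x : R * R) : R := f x.1 * g x.2.

(** Along a coordinate direction the other factor is constant, and the difference quotient reduces
    to a one-dimensional one. *)
Lemma is_derive_tens1 f g (df : R) (x : R^o * R^o) : is_derive x.1 (1 : R) f df ->
  is_derive x ((1, 0) : R^o * R^o) (tens f g : R^o * R^o -> R^o) (df * g x.2).
Proof.
move=> [dv dE].
have hq : (fun h : R => h^-1 *: (((tens f g : R^o * R^o -> R^o) \o shift x) (h *: ((1, 0) : R^o * R^o)) - tens f g x))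
   = (fun h : R => (h^-1 *: ((f \o shift x.1) (h *: (1 : R)) - f x.1)) * g x.2).
  apply/funext => h; rewrite /tens /= /GRing.scale /= mulr0 add0r !mulr1.
  by rewrite -mulrBl mulrA.
have hc : h^-1 *: (((tens f g : R^o * R^o -> R^o) \o shift x) (h *: ((1, 0) : R^o * R^o)) - tens f g x)
    @[h --> (0 : R)^'] --> df * g x.2.
  rewrite hq; apply: cvgM; last exact: cvg_cst.
  by rewrite -dE; exact: dv.
apply: DeriveDef; first by apply/cvg_ex; exists (df * g x.2).
exact/cvg_lim.
Qed.

Lemma is_derive_tens2 f g (dg : R) (x : R^o * R^o) : is_derive x.2 (1 : R) g dg ->
  is_derive x ((0, 1) : R^o * R^o) (tens f g : R^o * R^o -> R^o) (f x.1 * dg).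
Proof.
move=> [dv dE].
have hq : (fun h : R => h^-1 *: (((tens f g : R^o * R^o -> R^o) \o shift x) (h *: ((0, 1) : R^o * R^o)) - tens f g x))
   = (fun h : R => f x.1 * (h^-1 *: ((g \o shift x.2) (h *: (1 : R)) - g x.2))).
  apply/funext => h; rewrite /tens /= /GRing.scale /= mulr0 add0r !mulr1.
  by rewrite -mulrBr mulrCA.
have hc : h^-1 *: (((tens f g : R^o * R^o -> R^o) \o shift x) (h *: ((0, 1) : R^o * R^o)) - tens f g x)
    @[h --> (0 : R)^'] --> f x.1 * dg.
  rewrite hq; apply: cvgM; first exact: cvg_cst.
  by rewrite -dE; exact: dv.
apply: DeriveDef; first by apply/cvg_ex; exists (f x.1 * dg).
exact/cvg_lim.
Qed.

Lemma pd1_tens f g : csmooth f -> pd1 (tens f g) = tens f^`()%classic g.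
Proof.
move=> /csmooth_derive[hf _]; apply/funext => x; rewrite /pd1.
by have := @is_derive_tens1 f g _ x (hf x.1) => ?; rewrite derive_val.
Qed.

Lemma pd2_tens f g : csmooth g -> pd2 (tens f g) = tens f g^`()%classic.
Proof.
move=> /csmooth_derive[hg _]; apply/funext => x; rewrite /pd2.
by have := @is_derive_tens2 f g _ x (hg x.2) => ?; rewrite derive_val.
Qed.

Lemma csmooth_derive1n a f : csmooth f -> csmooth (iter a (fun h => h^`()%classic) f).
Proof. by move=> sf; elim: a => [//|a IH]; case/csmooth_derive: IH. Qed.

Lemma pd_tens a f g : csmooth f -> csmooth g ->
  pd a (tens f g) = tens (iter a.1 (fun h => h^`()%classic) f) (iter a.2 (fun h => h^`()%classic) g).
Proof.
move=> sf sg; rewrite /pd.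
have -> : iter a.1 (@pd1 R) (tens f g) = tens (iter a.1 (fun h => h^`()%classic) f) g.
  by elim: a.1 => [//|n IH] /=; rewrite IH pd1_tens//; exact: csmooth_derive1n.
by elim: a.2 => [//|n IH] /=; rewrite IH pd2_tens//; exact: csmooth_derive1n.
Qed.

Lemma smooth_tens f g : csmooth f -> csmooth g -> smooth (tens f g).
Proof.
move=> sf sg w.
have [f' [g' [sf' sg' ->]]] : exists f' g', [/\ csmooth f', csmooth g' &
    foldr (fun b => if b then @pd1 R else @pd2 R) (tens f g) w = tens f' g'].
  elim: w => [|b w [f' [g' [sf' sg' IH]]]]; first by exists f, g.
  rewrite /= IH; case: b.
    exists f'^`()%classic, g'; rewrite pd1_tens//; split => //.
    by case: (csmooth_derive sf').
  exists f', g'^`()%classic; rewrite pd2_tens//; split => //.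
  by case: (csmooth_derive sg').
split.
- move=> x; apply: cvgM.
    apply: (continuous_comp (f := fst)); first exact: cvg_fst.
    exact: csmooth_continuous.
  apply: (continuous_comp (f := snd)); first exact: cvg_snd.
  exact: csmooth_continuous.
- move=> x; have [h _] := csmooth_derive sf'.
  by have := @is_derive_tens1 f' g' _ x (h x.1) => ?; exact: ex_derive.
- move=> x; have [h _] := csmooth_derive sg'.
  by have := @is_derive_tens2 f' g' _ x (h x.2) => ?; exact: ex_derive.
Qed.

Lemma closed_rect (a b a' b' : R) : closed (`[a, b] `*` `[a', b']).
Proof.
rewrite (_ : _ `*` _ = fst @^-1` `[a, b] `&` snd @^-1` `[a', b'])//.
apply: closedI.
  apply: (continuous_closedP fst).1; last exact: interval_closed.
  by move=> x; exact: cvg_fst.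
apply: (continuous_closedP snd).1; last exact: interval_closed.
by move=> x; exact: cvg_snd.
Qed.

Lemma supp_tens f g (a b a' b' : R) : (forall x, f x != 0 -> a <= x <= b) ->
  (forall x, g x != 0 -> a' <= x <= b') -> supp (tens f g) `<=` `[a, b] `*` `[a', b'].
Proof.
move=> hf hg; rewrite (_ : `[a, b] `*` `[a', b'] = closure (`[a, b] `*` `[a', b'])).
  apply: closure_subset => -[x y] /=; rewrite /tens mulf_eq0 negb_or /= => /andP[/hf hx /hg hy].
  by rewrite !in_itv.
exact/closure_id/closed_rect.
Qed.

Lemma test_function_tens (U : set (R * R)) f g (a b a' b' : R) : csmooth f -> csmooth g ->
  (forall x, f x != 0 -> a <= x <= b) -> (forall x, g x != 0 -> a' <= x <= b') ->
  `[a, b] `*` `[a', b'] `<=` U -> test_function U (tens f g).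
Proof.
move=> sf sg hf hg hU; have hs := supp_tens hf hg; split.
- exact: smooth_tens.
- apply: (subclosed_compact _ _ hs); first exact: closed_closure.
  by apply: compact_setX; exact: segment_compact.
- exact: subset_trans hs hU.
Qed.

End TestFunctions.

#[local] Existing Instance ae_leb2_filter.

(** * Spline combinations with polynomial coefficients; integration by parts *)

Section PolySplines.
Context {R : realType}.
Notation mu2 := (@leb2 R).
Notation ind := (\1_`[0, 1[ : R -> R).
Implicit Types (F : R -> R) (P : {poly R}).

(** When N is at least the size of P, this is P evaluated at the unit translation and applied to the
    spline. A fixed N lets polynomials of different sizes share one index set. *)
Definition pspl N F P (d : nat) (x : R) : R := \sum_(i < N) P`_i * spl F d (x - i%:R).

Lemma pspl_bound N F P d x : unit_fun F -> `|pspl N F P d x| <= \sum_(i < N) `|P`_i|.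
Proof.
move=> uF; apply: (le_trans (ler_norm_sum _ _ _)); apply: ler_sum => i _.
rewrite normrM -[leRHS]mulr1 ler_wpM2l//; apply: unit_fun_norm.
exact: unit_fun_spl.
Qed.

Lemma measurable_pspl N F P d (a c : R) : unit_fun F ->
  measurable_fun setT (fun x => pspl N F P d (a * x + c)).
Proof.
move=> uF; apply: measurable_sum => i; apply: measurable_funM; first exact: measurable_cst.
have [mS _] := unit_fun_spl d uF; apply: measurableT_comp => //.
apply: measurable_funB; last exact: measurable_cst.
by apply: measurable_funD => //; apply: measurable_funM => //; exact: measurable_cst.
Qed.

Lemma csmooth_sum (I : Type) (s : seq I) (h : I -> R -> R) :
  (forall i, csmooth (h i)) -> csmooth (fun x => \sum_(i <- s) h i x).
Proof.
move=> sh; elim: s => [|i s IH].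
  by under eq_fun do rewrite big_nil; exact: csmooth_cst.
by under eq_fun do rewrite big_cons; exact: csmoothD.
Qed.

Lemma csmooth_pspl N F P d : csmooth F -> csmooth (pspl N F P d).
Proof.
move=> sF; apply: csmooth_sum => i; apply: csmoothM; first exact: csmooth_cst.
have := csmooth_affine 1 (- (i%:R)) (csmooth_spl d sF).
by under eq_fun do rewrite mul1r.
Qed.

(** Abel summation: moving the difference from the sequence to the coefficients multiplies the
    polynomial by 1 - X, up to one boundary term, which vanishes below because P has no coefficient
    at N. *)
Lemma summation_by_parts N P (s : nat -> R) :
  \sum_(i < N.+1) P`_i * (s i - s i.+1) =
  \sum_(i < N.+1) ((1 - 'X) * P)`_i * s i - P`_N * s N.+1.
Proof.
have cE i : ((1 - 'X) * P)`_i = P`_i - (if i is i'.+1 then P`_i' else 0).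
  rewrite mulrBl mul1r coefB coefXM; by case: i.
elim: N => [|N IH]; first by rewrite !big_ord_recr !big_ord0/= cE; ring.
by rewrite big_ord_recr [in RHS]big_ord_recr/= IH cE; ring.
Qed.

Lemma is_derive_sum1 (I : Type) (s : seq I) (h h' : I -> R -> R) (x : R) :
  (forall i, is_derive x (1 : R) (h i) (h' i x)) ->
  is_derive x (1 : R) (fun x => \sum_(i <- s) h i x) (\sum_(i <- s) h' i x).
Proof.
move=> hh; elim: s => [|i s IH].
  under eq_fun do rewrite big_nil.
  by rewrite big_nil; exact: is_derive_cst.
under eq_fun do rewrite big_cons.
by rewrite big_cons; have := hh i => ?; exact: is_deriveD.
Qed.

Lemma is_derive_pspl N F P d (x : R) : csmooth F -> (size P <= N)%N ->
  is_derive x (1 : R) (pspl N.+1 F P d.+1) (pspl N.+1 F ((1 - 'X) * P) d x).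
Proof.
move=> sF sP.
have := summation_by_parts N P (fun i => spl F d (x - i%:R)).
rewrite [P`_N]nth_default// mul0r subr0 /pspl => <-.
apply: (@is_derive_sum1 _ _ (fun (i : 'I_N.+1) x => P`_i * spl F d.+1 (x - i%:R))
  (fun (i : 'I_N.+1) x => P`_i * (spl F d (x - i%:R) - spl F d (x - i.+1%:R)))) => i.
have h1 : is_derive x (1 : R) (fun x => spl F d.+1 (1 * x + (- i%:R)))
   (1 * (spl F d (1 * x + (- i%:R)) - spl F d (1 * x + (- i%:R) - 1))).
  apply: (@is_derive_affine R (spl F d.+1) (fun y => spl F d y - spl F d (y - 1))) => y.
  exact: is_derive_spl.
have -> : P`_i * (spl F d (x - i%:R) - spl F d (x - i.+1%:R)) =
   P`_i *: (1 * (spl F d (1 * x + (- i%:R)) - spl F d (1 * x + (- i%:R) - 1))).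
  by rewrite /GRing.scale /= !mul1r -natr1 opprD addrA.
have -> : (fun x0 : R => P`_i * spl F d.+1 (x0 - i%:R)) =
   (P`_i \*: (fun x => spl F d.+1 (1 * x + (- i%:R)))).
  by apply/funext => y; rewrite /GRing.scale /= mul1r.
exact: is_deriveZ.
Qed.

Lemma derive1n_scale a (c : R) f : csmooth f ->
  iter a (fun h : R -> R => h^`()%classic) (fun x => c * f x) =
  (fun x => c * iter a (fun h : R -> R => h^`()%classic) f x).
Proof.
move=> sf; elim: a => [//|a IH] /=; rewrite IH; apply/funext => x.
have [hd _] := csmooth_derive (csmooth_derive1n a sf).
by rewrite derive1E; have := hd x => hdx; have := is_deriveZ c hdx => ?; rewrite derive_val.
Qed.

(** P i is the quotient of P 0 by (1 - X)^i. The size condition removes the boundary term from each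
    differentiation and bounds the supports of the combinations. *)
Definition poly_chain N (P : nat -> {poly R}) (b : nat) : Prop :=
  (forall i, (i < b)%N -> (1 - 'X) * P i.+1 = P i) /\
  (forall i, (i <= b)%N -> (size (P i) + i <= N.+1)%N).

Lemma derive1n_pspl N F (P : nat -> {poly R}) d (a c : R) b : csmooth F ->
  poly_chain N P b ->
  iter b (fun h : R -> R => h^`()%classic) (fun x => pspl N.+1 F (P b) (d + b) (a * x + c)) =
  (fun x => a ^+ b * pspl N.+1 F (P 0%N) d (a * x + c)).
Proof.
move=> sF; elim: b => [|b IH] [hP sP].
  by apply/funext => x; rewrite expr0 mul1r addn0.
have chb : poly_chain N P b.
  by split=> i hi; [apply: hP; exact: ltnW|apply: sP; exact: leqW].
rewrite iterSr.
have -> : (fun x : R => pspl N.+1 F (P b.+1) (d + b.+1) (a * x + c))^`()%classic =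
   (fun x => a * pspl N.+1 F (P b) (d + b) (a * x + c)).
  apply/funext => x; rewrite derive1E.
  have sPb : (size (P b.+1) <= N)%N.
    by have := sP b.+1 (leqnn _); rewrite addnS ltnS; apply: leq_trans; rewrite leq_addr.
  have hd y : is_derive y (1 : R) (pspl N.+1 F (P b.+1) (d + b.+1)) (pspl N.+1 F (P b) (d + b) y).
    by rewrite addnS -(hP b (ltnSn b)); exact: is_derive_pspl.
  by have := is_derive_affine a c x hd => ?; rewrite derive_val.
rewrite derive1n_scale; last exact/csmooth_affine/csmooth_pspl.
by rewrite IH//; apply/funext => x; rewrite exprS mulrA.
Qed.

Lemma pspl_bump_supp N P d M j (x : R) : (size P + d <= M)%N ->
  pspl N (bump j) P d x != 0 -> j.+2%:R^-1 <= x <= M%:R - j.+2%:R^-1.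
Proof.
move=> hM; set r := _^-1; apply: contra_neqT => hx; apply: big1 => i _.
have [iP|Pi] := ltnP i (size P); last by rewrite nth_default// mul0r.
apply/eqP; rewrite mulf_eq0; apply/orP; right.
apply: contraNT hx => /spl_bump_supp; rewrite -/r => /andP[h1 h2].
have : (i + d.+1 <= M)%N by lia.
rewrite -(ler_nat R) natrD => h3; have i0 : 0 <= i%:R :> R by [].
by apply/andP; split; lra.
Qed.

Lemma pspl_ind_supp N P d M (x : R) : (size P + d <= M)%N ->
  pspl N ind P d x != 0 -> 0 <= x <= M%:R.
Proof.
move=> hM; apply: contra_neqT => hx; apply: big1 => i _.
have [iP|Pi] := ltnP i (size P); last by rewrite nth_default// mul0r.
apply/eqP; rewrite mulf_eq0; apply/orP; right.
apply: contraNT hx => /B_supp => /andP[h1 h2].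
have : (i + d.+1 <= M)%N by lia.
rewrite -(ler_nat R) natrD => h3; have i0 : 0 <= i%:R :> R by [].
by apply/andP; split; lra.
Qed.

(** At a natural number some translate is evaluated at 0, where the bumps need not converge to the
    indicator. *)
Lemma pspl_bump_cvg N P d (x : R) : (forall i : nat, x != i%:R) ->
  pspl N (bump j) P d x @[j --> \oo] --> pspl N ind P d x.
Proof.
move=> hx; rewrite /pspl; elim: N => [|N IH].
  by under eq_fun do rewrite big_ord0; rewrite big_ord0; exact: cvg_cst.
under eq_fun do rewrite big_ord_recr/=; rewrite big_ord_recr/=.
apply: cvgD => //; apply: cvgM; first exact: cvg_cst.
by apply: spl_bump_cvg; rewrite subr_eq0.
Qed.

Lemma Lp1_integrable (U : set (R * R)) (u : R * R -> R) : Lp 1 U u ->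
  mu2.-integrable setT (EFin \o (u \_ U)).
Proof. by move/Lfun1_integrable. Qed.

Lemma Rintegral_Omega_patch (u h : R * R -> R) :
  \int[mu2]_(x in @Omega R) (u x * h x) = \int[mu2]_x ((u \_ (@Omega R)) x * h x).
Proof.
rewrite Rintegral_mkcond; apply: eq_Rintegral => x _.
by rewrite !patchE; case: ifP => _; rewrite ?mul0r.
Qed.

Lemma ae_not_grid (a c1 c2 : R) : a != 0 ->
  {ae mu2, forall x : R * R, forall i : nat, a * x.1 + c1 != i%:R /\ a * x.2 + c2 != i%:R}.
Proof.
move=> a0; apply: ae_foralln => i.
have := leb2_lines ((i%:R - c1) / a) ((i%:R - c2) / a); apply: negligibleS => x /= hx.
apply: contrapT => /not_orP[/eqP h1 /eqP h2]; apply: hx; split.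
  by apply: contra h1 => /eqP <-; rewrite addrK mulrC mulKf.
by apply: contra h2 => /eqP <-; rewrite addrK mulrC mulKf.
Qed.

Definition pstens N F P Q d1 d2 (a c1 c2 : R) : R * R -> R :=
  tens (fun x => pspl N F P d1 (a * x + c1)) (fun x => pspl N F Q d2 (a * x + c2)).

Lemma measurable_pstens N F P Q d1 d2 a c1 c2 : unit_fun F ->
  measurable_fun setT (pstens N F P Q d1 d2 a c1 c2).
Proof.
move=> uF; apply: (measurable_tensor (f := fun x => pspl N F P d1 (a * x + c1))
  (g := fun x => pspl N F Q d2 (a * x + c2))); exact: measurable_pspl.
Qed.

Lemma pstens_bound N F P Q d1 d2 a c1 c2 x : unit_fun F ->
  `|pstens N F P Q d1 d2 a c1 c2 x| <= (\sum_(i < N) `|P`_i|) * (\sum_(i < N) `|Q`_i|).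
Proof. by move=> uF; rewrite /pstens /tens normrM ler_pM// pspl_bound. Qed.

Lemma integral_pstens_cvg N P Q d1 d2 (a c1 c2 : R) (u : R * R -> R) : a != 0 ->
  mu2.-integrable setT (EFin \o u) ->
  \int[mu2]_x (u x * pstens N (bump j) P Q d1 d2 a c1 c2 x) @[j --> \oo] -->
  \int[mu2]_x (u x * pstens N ind P Q d1 d2 a c1 c2 x).
Proof.
move=> a0 iu; have /measurable_EFinP mu_ := measurable_int _ iu.
pose C := (\sum_(i < N) `|P`_i|) * (\sum_(i < N) `|Q`_i|).
apply: (@Rdominated_cvg _ _ _ mu2 setT (fun j x => u x * pstens N (bump j) P Q d1 d2 a c1 c2 x)
  _ (fun x => C * `|u x|)) => //.
- by move=> j; apply: measurable_funM => //; apply: measurable_pstens; exact: unit_fun_bump.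
- by apply: measurable_funM => //; apply: measurable_pstens; exact: unit_fun_indic.
- apply: (filterS _ (ae_not_grid c1 c2 a0)) => x hx _; apply: cvgM; first exact: cvg_cst.
  by apply: cvgM; apply: pspl_bump_cvg => i; case: (hx i).
- by apply: integrableRZ => //; exact: integrableR_norm.
- move=> j x _; rewrite normrM mulrC ler_wpM2r//; apply: pstens_bound; exact: unit_fun_bump.
Qed.

(** For the bumps, the combination on the right is an admissible test function: the conditions on c1
    and c2 put its support into the closed square, and the margin r of the bumps moves it inside.
    Its derivative of order be is a^|be| times the combination on the left. For the indicator, whose
    combination may touch the boundary, the identity is a limit. *)
Lemma weak_derivative_pstens N (P Q : nat -> {poly R}) d0 M (a c1 c2 : R) (be : nat * nat)
    (u g : R * R -> R) : 0 < a ->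
  Lp 1 (@Omega R) u -> Lp 1 (@Omega R) g -> is_weak_derivative (@Omega R) be u g ->
  poly_chain N P be.1 -> poly_chain N Q be.2 ->
  (size (P be.1) + (d0 + be.1) <= M)%N -> (size (Q be.2) + (d0 + be.2) <= M)%N ->
  c1 <= 0 -> M%:R - c1 <= a -> c2 <= 0 -> M%:R - c2 <= a ->
  a ^+ mord be * \int[mu2]_(x in @Omega R) (u x * pstens N.+1 ind (P 0%N) (Q 0%N) d0 d0 a c1 c2 x) =
  (-1) ^+ mord be * \int[mu2]_(x in @Omega R)
     (g x * pstens N.+1 ind (P be.1) (Q be.2) (d0 + be.1) (d0 + be.2) a c1 c2 x).
Proof.
move=> a0 Lu Lg wd cP cQ sP sQ c10 c1M c20 c2M.
have an0 : a != 0 by rewrite gt_eqF.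
rewrite !Rintegral_Omega_patch.
have key j : a ^+ mord be * \int[mu2]_x ((u \_ (@Omega R)) x *
     pstens N.+1 (bump j) (P 0%N) (Q 0%N) d0 d0 a c1 c2 x) =
  (-1) ^+ mord be * \int[mu2]_x ((g \_ (@Omega R)) x *
     pstens N.+1 (bump j) (P be.1) (Q be.2) (d0 + be.1) (d0 + be.2) a c1 c2 x).
  have sm (T : {poly R}) d c : csmooth (fun x => pspl N.+1 (bump j) T d (a * x + c)).
    by apply: csmooth_affine; apply: csmooth_pspl; exact: csmooth_bump.
  have r0 : 0 < j.+2%:R^-1 :> R by rewrite invr_gt0.
  set r := j.+2%:R^-1 in r0 *.
  have sp (T : {poly R}) d c x : (size T + d <= M)%N ->
      pspl N.+1 (bump j) T d (a * x + c) != 0 -> (r - c) / a <= x <= (M%:R - r - c) / a.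
    move=> hM /(pspl_bump_supp hM); rewrite -/r => /andP[h1 h2].
    by rewrite ler_pdivrMr// ler_pdivlMr// mulrC; apply/andP; split; lra.
  have itv_sub c x : c <= 0 -> M%:R - c <= a -> (r - c) / a <= x <= (M%:R - r - c) / a -> 0 < x < 1.
    move=> cc0 ccM /andP[h1 h2]; apply/andP; split.
      by apply: lt_le_trans h1; rewrite divr_gt0//; lra.
    by apply: (le_lt_trans h2); rewrite ltr_pdivrMr//; lra.
  have tf : test_function (@Omega R) (pstens N.+1 (bump j) (P be.1) (Q be.2) (d0 + be.1) (d0 + be.2) a c1 c2).
    apply: (test_function_tens (a := (r - c1) / a) (b := (M%:R - r - c1) / a)
      (a' := (r - c2) / a) (b' := (M%:R - r - c2) / a)); try exact: sm.
    - by move=> x; exact: sp.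
    - by move=> x; exact: sp.
    - move=> x [] /=; rewrite !in_itv/= => /itv_sub h1 /itv_sub h2; split => /=; rewrite in_itv/=.
        exact: h1.
      exact: h2.
  have := wd _ tf; rewrite !Rintegral_Omega_patch => <-.
  rewrite pd_tens; try exact: sm.
  rewrite !derive1n_pspl//; try exact: csmooth_bump.
  rewrite -RintegralZl//; last first.
    apply: (@integrableRM_bound _ _ _ _ _ _ _ _ _ (Lp1_integrable Lu)) => //.
      by apply: measurable_pstens; exact: unit_fun_bump.
    by move=> x _; apply: pstens_bound; exact: unit_fun_bump.
  apply: eq_Rintegral => x _; rewrite /pstens /tens /mord exprD; ring.
have cL := @integral_pstens_cvg N.+1 (P 0%N) (Q 0%N) d0 d0 a c1 c2 _ an0 (Lp1_integrable Lu).
have cR := @integral_pstens_cvg N.+1 (P be.1) (Q be.2) (d0 + be.1) (d0 + be.2) a c1 c2 _ an0 (Lp1_integrable Lg).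
have cst_cvg (c : R) (X : nat -> R) (l : R) : X j @[j --> \oo] --> l -> c * X j @[j --> \oo] --> c * l.
  by move=> cX; apply: cvgM => //; exact: cvg_cst.
have {cL} := cst_cvg (a ^+ mord be) _ _ cL.
have {cR} := cst_cvg ((-1) ^+ mord be) _ _ cR.
under [in X in _ -> X -> _]eq_fun do rewrite key.
by move=> cR cL; exact: (cvg_unique _ cL cR).
Qed.

End PolySplines.

(** * Coefficients of the masks *)

Section Masks.
Context {R : realType}.

Lemma fsbig_int (V : zmodType) (f : int -> V) (N : nat) :
  (forall k : int, f k != 0 -> (`|k| <= N)%N) ->
  \sum_(k \in [set: int]) f k = \sum_(i < (2 * N).+1) f (i%:Z - N%:Z).
Proof.
move=> hf; pose s := [seq (i%:Z - N%:Z) | i <- iota 0 (2 * N).+1].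
have us : uniq s by rewrite map_inj_uniq ?iota_uniq// => i j /addIr[].
rewrite (fsbigE s f us)//; last first.
  move=> k _; apply: contraNeq => /hf hk; apply/mapP; exists (absz (k + N%:Z)).
    by rewrite mem_iota; lia.
  by lia.
under eq_bigl do rewrite in_setT.
by rewrite /s big_map -[iota _ _]/(index_iota 0 (2 * N).+1) big_mkord.
Qed.

Lemma cisD (a b : R) : cis (a + b) = cis a * cis b.
Proof. by apply/eqP; rewrite /cis cosD sinD eq_complex /=; apply/andP; split; apply/eqP; ring. Qed.

Lemma cis0 : cis (0 : R) = 1.
Proof. by rewrite /cis cos0 sin0. Qed.

Lemma cisX (a : R) n : cis a ^+ n = cis (a *+ n).
Proof. by elim: n => [|n IH]; rewrite ?mulr0n ?cis0// exprS IH mulrS cisD. Qed.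

(** The angles 1/(i+1) give distinct points since cos is injective on [0, pi], and as many of them
    as the size of p are roots. *)
Lemma poly_cis_eq0 (p : {poly R[i]}) : (forall xi : R, p.[cis (- xi)] = 0) -> p = 0.
Proof.
move=> hp; pose t (i : nat) : R := i.+1%:R^-1.
apply: (@roots_geq_poly_eq0 _ _ [seq cis (- t i) | i <- iota 0 (size p)]).
- by apply/allP => _ /mapP[i _ ->]; apply/eqP; exact: hp.
- rewrite map_inj_uniq ?iota_uniq// => i j [h _].
  have t01 k : t k \in `[0, pi].
    rewrite in_itv/= invr_ge0 ler0n/=; apply: (@le_trans _ _ 1).
      by rewrite invf_le1// ler1n.
    by have := pi_ge2 R; lra.
  have : t i = t j by move: h; rewrite !cosN; apply: cos_inj; exact: t01.
  by move=> /invr_inj/eqP; rewrite eqr_nat => /eqP[].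
- by rewrite size_map size_iota.
Qed.

(* Up to a monomial, [mask_poly m l 0 c] is the symbol of [q l]; the factors [1 - 'X] removed when
   [b] grows are the differences that become derivatives of B-splines. *)
Definition mask_poly (m l b : nat) (c : R) : {poly R} :=
  c *: ((1 - 'X) ^+ (l - b) * (1 + 'X) ^+ (m - l)).

(** The mask is centred: the coefficient of X^i is its value at i - m./2. The scalar c stays a
    parameter because the sign of a mask is not prescribed. *)
Definition mask_of (q : nat -> int -> R) m l c : Prop := forall k : int,
  q l k = if 0 <= k + (m./2)%:Z then (mask_poly m l 0 c)`_(absz (k + (m./2)%:Z)) else 0.

Lemma one_sub_cis (xi : R) :
  1 - cis (- xi) = 2 * (Complex 0 1 * (sin (xi / 2))%:C%C * cis (- (xi / 2))).
Proof.
transitivity (cis (xi / 2) * cis (- (xi / 2)) - cis (- (xi / 2)) * cis (- (xi / 2))).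
  by rewrite -!cisD subrr cis0; congr (1 - cis _); lra.
rewrite -mulrBl mulrA; congr (_ * _); apply/eqP; rewrite /cis cosN sinN eq_complex /=.
by apply/andP; split; apply/eqP; ring.
Qed.

Lemma one_add_cis (xi : R) :
  1 + cis (- xi) = 2 * ((cos (xi / 2))%:C%C * cis (- (xi / 2))).
Proof.
transitivity (cis (xi / 2) * cis (- (xi / 2)) + cis (- (xi / 2)) * cis (- (xi / 2))).
  by rewrite -!cisD subrr cis0; congr (1 + cis _); lra.
rewrite -mulrDl mulrA; congr (_ * _); apply/eqP; rewrite /cis cosN sinN eq_complex /=.
by apply/andP; split; apply/eqP; ring.
Qed.

(** Since m = odd m + 2 (m./2), the prescribed phase times cis (-xi)^(m./2) is cis (-m xi / 2),
    which is the product of the phases of the m half-angle factors. *)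
Lemma symbol_factor (m l : nat) (xi : R) : (l <= m)%N ->
  2 ^+ m * (Complex 0 1 ^+ l * cis (- ((odd m)%:R * xi / 2)) *
     (sin (xi / 2) ^+ l * cos (xi / 2) ^+ (m - l))%:C%C) * cis (- xi) ^+ m./2 =
  (1 - cis (- xi)) ^+ l * (1 + cis (- xi)) ^+ (m - l).
Proof.
move=> lm; rewrite one_sub_cis one_add_cis !exprMn.
have h : cis (- ((odd m)%:R * xi / 2)) * cis (- xi) ^+ m./2 =
    cis (- (xi / 2)) ^+ l * cis (- (xi / 2)) ^+ (m - l).
  rewrite -exprD subnKC// !cisX -cisD; congr cis.
  have mE : m%:R = (odd m)%:R + 2 * (m./2)%:R :> R.
    by rewrite -[in LHS](odd_double_half m) natrD -muln2 natrM mulrC.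
  by rewrite -[(- xi) *+ _]mulr_natr -[(- (xi / 2)) *+ _]mulr_natr mE; field.
have -> : (2 ^+ m : R[i]) = 2 ^+ l * 2 ^+ (m - l) by rewrite -exprD subnKC.
rewrite rmorphM !rmorphXn /=.
move: h; move: (cis (- ((odd m)%:R * xi / 2))) (cis (- xi) ^+ m./2) => E Z.
move: (cis (- (xi / 2)) ^+ l) (cis (- (xi / 2)) ^+ (m - l)) => W W' h.
transitivity (2 ^+ l * 2 ^+ (m - l) * ('i%C ^+ l * ((sin (xi / 2))%:C%C ^+ l * (cos (xi / 2))%:C%C ^+ (m - l))) * (E * Z)).
  by ring.
by rewrite h; ring.
Qed.

Lemma map_poly_complex_inj (P Q : {poly R}) :
  map_poly (real_complex R) P = map_poly (real_complex R) Q -> P = Q.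
Proof. by move/(map_inj_poly (@complexI R) (rmorph0 _)). Qed.

(** After multiplication by the N-th power of the variable, with N bounding the support, the symbol
    is a polynomial on the unit circle. It agrees there with a shift of the mask polynomial, hence
    coefficientwise. *)
Lemma mask_coef (m : nat) (q : nat -> int -> R) (l : nat) : bspline_masks m q -> (l <= m)%N ->
  exists2 c : R, c != 0 & mask_of q m l c.
Proof.
move=> [fq symq _] lm; have [eps heps] := symq l lm; have := fq l lm => fl.
have [N hN] : exists N : nat, (m./2 <= N)%N /\ forall k : int, q l k != 0 -> (`|k| <= N)%N.
  pose A := fset_set [set k | q l k != 0].
  exists (m./2 + \sum_(k <- A) `|k|)%N; split; first by rewrite leq_addr.
  move=> k qk; apply: leq_trans (leq_addl _ _).
  have kA : k \in A by rewrite in_fset_set// inE.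
  by rewrite (big_fsetD1 k)//= leq_addr.
(* The power 2^-m comes from sin and cos, each of the m factors contributing 1/2 in the half-angle
   formulas. *)
have [c [c0 cE]] : exists c : R, c != 0 /\ c = (-1) ^+ eps * Num.sqrt 'C(m, l)%:R / 2 ^+ m.
  eexists; split; last by [].
  rewrite !mulf_neq0 ?invr_eq0 ?expf_neq0//.
  by rewrite sqrtr_eq0 -ltNge ltr0n bin_gt0.
exists c => //.
pose Q : {poly R} := \poly_(i < (2 * N).+1) q l (i%:Z - N%:Z).
pose P := mask_poly m l 0 c.
have QP : Q = 'X ^+ (N - m./2) * P.
  apply: map_poly_complex_inj; apply/eqP; rewrite -subr_eq0; apply/eqP.
  apply: poly_cis_eq0 => xi; set z := cis (- xi).
  rewrite hornerD hornerN; apply/eqP; rewrite subr_eq0; apply/eqP.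
  have hz : z * cis xi = 1 by rewrite -cisD addNr cis0.
  have QE : (map_poly (real_complex R) Q).[z] = z ^+ N *
      \sum_(k \in [set: int]) (real_complex R (q l k) * cis (- (xi * k%:~R))).
    rewrite (@fsbig_int _ _ N); last first.
      move=> k; rewrite mulf_eq0 negb_or => /andP[h _]; apply: hN.2.
      by apply: contra h => /eqP ->; rewrite rmorph0.
    rewrite (@horner_coef_wide _ (2 * N).+1); last first.
      by rewrite size_map_poly size_poly.
    rewrite big_distrr; apply: eq_bigr => i _ /=.
    rewrite coef_map coef_poly ltn_ord /= mulrCA; congr (_ * _).
    rewrite /z !cisX -cisD; congr cis.
    by rewrite -[(- xi) *+ i]mulr_natr -[(- xi) *+ N]mulr_natr intrB; ring.
  have -> : map_poly (real_complex R) ('X^(N - m./2) * P) =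
      'X^(N - m./2) * map_poly (real_complex R) P by rewrite rmorphM /= map_polyXn.
  have -> : map_poly (real_complex R) P =
      (real_complex R c) *: ((1 - 'X) ^+ l * (1 + 'X) ^+ (m - l)).
    rewrite /P /mask_poly subn0 map_polyZ rmorphM !rmorphXn rmorphB rmorphD rmorph1 /=.
    by rewrite map_polyX.
  rewrite QE heps hornerM hornerXn.
  have -> : z ^+ N = z ^+ (N - m./2) * z ^+ m./2 by rewrite -exprD subnK//; case: hN.
  rewrite -mulrA; congr (_ * _).
  rewrite hornerZ hornerM !horner_exp !hornerE -/z.
  have SF := symbol_factor xi lm; rewrite -/z in SF.
  transitivity (real_complex R c * ((1 - z) ^+ l * (1 + z) ^+ (m - l))); last by rewrite mulrA.
  rewrite -SF cE.
  rewrite !rmorphM /= fmorphV !rmorphXn /= rmorphN1 rmorph_nat.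
  have two0 : (2 ^+ m : R[i]) != 0 by rewrite expf_neq0// pnatr_eq0.
  by field.
move=> k; have [k0|k0] := leP 0 (k + N%:Z); last first.
  have -> : (0 <= k + (m./2)%:Z) = false by apply/negbTE; rewrite -ltNge; lia.
  by apply/eqP; apply: contraTT k0 => /(hN.2); lia.
have : Q`_(absz (k + N%:Z)) = q l k.
  rewrite coef_poly; case: ifPn => [_|h]; first by congr (q l _); lia.
  apply/esym/eqP; apply: contraNT h => /(hN.2); lia.
rewrite QP coefXnM => <-.
have [h|h] := leP 0 (k + (m./2)%:Z).
  have -> : (absz (k + N%:Z)%R < N - m./2)%N = false by apply/negbTE; lia.
  by congr (_`_ _); have := hN.1; lia.
by have -> : (absz (k + N%:Z)%R < N - m./2)%N by have := hN.1; lia.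
Qed.

Lemma size_mask_poly m l b (c : R) : (l <= m)%N -> (b <= l)%N ->
  (size (mask_poly m l b c) + b <= m.+1)%N.
Proof.
move=> lm bl; apply: (@leq_trans ((l - b + (m - l)).+1 + b)); last by lia.
rewrite leq_add2r; apply: (leq_trans (size_scale_leq _ _)).
apply: (leq_trans (size_polyMleq _ _)).
have sz (p : {poly R}) n : (size p <= 2)%N -> (size (p ^+ n) <= n.+1)%N.
  by move=> hp; apply: (leq_trans (size_poly_exp_leq _ _)); rewrite ltnS; nia.
have s1 : (size (1 - 'X : {poly R})%R <= 2)%N.
  by rewrite -opprB size_polyN -[1]/(1%:P) size_XsubC.
have s2 : (size (1 + 'X : {poly R})%R <= 2)%N.
  by rewrite addrC -[1]/(1%:P) size_XaddC.
have h1 := sz _ (l - b)%N s1; have h2 := sz _ (m - l)%N s2.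
apply: (@leq_trans ((l - b).+1 + (m - l).+1).-1); last by lia.
by rewrite -!subn1 leq_sub2r// leq_add.
Qed.

Lemma mask_poly_chain m l (c : R) b : (l <= m)%N -> (b <= l)%N ->
  poly_chain m (fun b => mask_poly m l b c) b.
Proof.
move=> lm bl; split=> i ib; last by apply: size_mask_poly => //; exact: leq_trans bl.
rewrite /mask_poly -scalerAr mulrA -exprS; congr (_ *: (_ ^+ _ * _)).
by rewrite -subSn ?subSS//; exact: leq_trans bl.
Qed.

(** At 1 a remaining factor 1 - X vanishes, and there is none exactly when l <= b. *)
Lemma mask_poly_horner1 m l b (c : R) :
  (mask_poly m l b c).[1] = c * ((l <= b)%N%:R * 2 ^+ (m - l)).
Proof.
rewrite /mask_poly hornerZ hornerM !horner_exp !hornerE subrr expr0n subn_eq0.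
by [].
Qed.

Lemma sum_mask_poly m l b (c : R) : (l <= m)%N -> (b <= l)%N ->
  \sum_(i < m.+1) (mask_poly m l b c)`_i = c * ((l <= b)%N%:R * 2 ^+ (m - l)).
Proof.
move=> lm bl; rewrite -mask_poly_horner1 (@horner_coef_wide _ m.+1).
  by apply: eq_bigr => i _; rewrite expr1n mulr1.
by have := size_mask_poly c lm bl; lia.
Qed.

(** The extreme coefficients for l = 0 do not vanish, so this mask attains the full support; this is
    what makes [Kset] an explicit rectangle. *)
Lemma mask_poly00 m (c : R) : (mask_poly m 0 0 c)`_0 = c.
Proof.
by rewrite /mask_poly subn0 expr0 mul1r coefZ -horner_coef0 horner_exp !hornerE expr1n ?mulr1.
Qed.

Lemma mask_poly0m m (c : R) : (mask_poly m 0 0 c)`_m = c.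
Proof.
rewrite /mask_poly !subn0 expr0 mul1r coefZ.
have mon : (1 + 'X : {poly R}) \is monic by rewrite addrC -[1]/(1%:P) monicXaddC.
have sz : size ((1 + 'X : {poly R}) ^+ m) = m.+1.
  have := size_exp (1 + 'X : {poly R}) m; rewrite addrC -[1]/(1%:P) size_XaddC/= mul1n.
  move=> h; rewrite -[LHS]prednK ?h// lt0n size_poly_eq0 monic_neq0//.
  by rewrite monic_exp// monicXaddC.
have := monic_exp m mon; rewrite monicE lead_coefE sz /= => /eqP ->.
by rewrite mulr1.
Qed.

Lemma mask_sum (m l : nat) (q : nat -> int -> R) (c : R) (f : int -> R) : (l <= m)%N ->
  mask_of q m l c ->
  \sum_(k \in [set: int]) (q l k * f k) =
  \sum_(i < m.+1) (mask_poly m l 0 c)`_i * f (i%:Z - (m./2)%:Z).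
Proof.
move=> lm hq; pose s := [seq (i%:Z - (m./2)%:Z) | i <- iota 0 m.+1].
have us : uniq s by rewrite map_inj_uniq ?iota_uniq// => i j /addIr[].
rewrite (fsbigE s _ us)//; last first.
  move=> k _; apply: contraNeq; rewrite mulf_eq0 negb_or => /andP[+ _].
  rewrite hq; case: ifP => [k0|_]; last by rewrite eqxx.
  move=> h; apply/mapP; exists (absz (k + (m./2)%:Z)); last by lia.
  rewrite mem_iota /= add0n; rewrite ltnNge; apply: contra h => hm.
  rewrite nth_default//; apply: leq_trans hm.
  by have := size_mask_poly c lm (leq0n l); rewrite addn0.
under eq_bigl do rewrite in_setT.
rewrite /s big_map -[iota _ _]/(index_iota 0 m.+1) big_mkord; apply: eq_bigr => i _.
rewrite hq; have -> : 0 <= i%:Z - (m./2)%:Z + (m./2)%:Z by rewrite subrK.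
by rewrite subrK.
Qed.

End Masks.

(** * Moments of the framelets and the constants c_al *)

Section FrameletConstants.
Context {R : realType}.
Notation mu := (@lebesgue_measure R).
Notation mu2 := (@leb2 R).
Notation ind := (\1_`[0, 1[ : R -> R).
Notation iterd a := (iter a (fun h : R -> R => h^`()%classic)).

Lemma derive1n_horner a (p : {poly R}) : iterd a (horner p) = horner (p^`(a)).
Proof.
elim: a => [//|a IH] /=.
by rewrite IH -derivE.
Qed.

Lemma csmooth_horner (p : {poly R}) : csmooth (horner p).
Proof.
move=> n; elim: n p => [//|n IH] p; exists (horner p^`()); split => // x.
have /derivableP := @derivable_horner R p x.
by rewrite -derive1E -derivE.
Qed.

Lemma derive1n_near (a : nat) (f g : R -> R) (x y : R) : csmooth f -> csmooth g ->
  (forall z, x < z < y -> f z = g z) ->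
  forall z, x < z < y -> iterd a f z = iterd a g z.
Proof.
move=> sf sg fg; elim: a => [//|a IH] z /andP[xz zy] /=.
rewrite !derive1E; apply: near_eq_derive => //.
near=> t; apply: IH; apply/andP; split.
  by near: t; exact: lt_nbhsr.
by near: t; exact: lt_nbhsl.
Unshelve. all: by end_near.
Qed.

(** The function [bump 6] is 1 on [1/4, 3/4], the image of [-L/2, L/2] under this affine map. *)
Definition cutoff (L x : R) : R := bump 6 ((2 * L)^-1 * x + 2^-1).

Lemma csmooth_cutoff L : csmooth (cutoff L).
Proof. by apply: csmooth_affine; exact: csmooth_bump. Qed.

Lemma cutoff_eq1 L x : 0 < L -> - (L / 2) <= x <= L / 2 -> cutoff L x = 1.
Proof.
move=> L0 /andP[h1 h2]; apply: bump_eq1.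
have e : (2 * L)^-1 * L = 2^-1 by rewrite invfM mulfVK// gt_eqF.
have i0 : 0 < (2 * L)^-1 by rewrite invr_gt0; lra.
by apply/andP; split; nra.
Qed.

Lemma cutoff_supp L x : 0 < L -> cutoff L x != 0 -> - L <= x <= L.
Proof.
move=> L0 /bump_supp /andP[h1 h2].
have e : (2 * L)^-1 * L = 2^-1 by rewrite invfM mulfVK// gt_eqF.
have i0 : 0 < (2 * L)^-1 by rewrite invr_gt0; lra.
by apply/andP; split; nra.
Qed.

(** Normalised so that each derivative lowers l by one and the l-th one is 1. *)
Definition monom (l : nat) : {poly R} := (l`!%:R)^-1 *: 'X^l.

Lemma deriv_monom l : (monom l.+1)^`() = monom l.
Proof.
rewrite /monom derivZ derivXn /= -scalerMnr scalerMnl; congr (_ *: _).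
by rewrite -[LHS]mulr_natr factS natrM invfM mulrAC mulVf ?mul1r// pnatr_eq0.
Qed.

Lemma derivn_monom l : (monom l)^`(l) = 1.
Proof. by elim: l => [|l IH]; rewrite ?derivn0 /monom ?fact0 ?invr1 ?scale1r// derivSn deriv_monom. Qed.

Lemma ibp_monom (K K' : R -> R) (M : R) l : 0 < M -> csmooth K -> csmooth K' ->
  (forall x, is_derive x (1 : R) K (2 * K' x)) -> K (- M) = 0 -> K M = 0 ->
  \int[mu]_(x in `[- M, M]) (K' x * (monom l.+1).[x]) =
  (- 2^-1) * \int[mu]_(x in `[- M, M]) (K x * (monom l).[x]).
Proof.
move=> M0 sK sK' dK K0 K1; have MM : - M < M by lra.
have cc f : csmooth f -> {within `[- M, M], continuous f}.
  by move=> sf; apply: continuous_subspaceT; exact: csmooth_continuous.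
have dd f : csmooth f -> derivable_oo_LRcontinuous f (- M) M.
  move=> sf; have [hd _] := csmooth_derive sf; split.
  - by move=> x _; have := hd x => ?; exact: ex_derive.
  - by apply: cvg_at_right_filter; exact: csmooth_continuous.
  - by apply: cvg_at_left_filter; exact: csmooth_continuous.
have sm p := csmooth_horner p.
have s2K' : csmooth (fun x => 2 * K' x) by apply: csmoothM => //; exact: csmooth_cst.
have := @Rintegration_by_parts R (horner (monom l.+1)) K (horner (monom l)) (fun x => 2 * K' x)
  (- M) M MM (cc _ (sm _)) (dd _ (sm _)) _ (cc _ s2K') (dd _ sK) _.
rewrite K0 K1 !mulr0 subrr sub0r => h.
have {h} h := h _ _.
have -> : \int[mu]_(x in `[- M, M]) (K' x * (monom l.+1).[x]) =
   2^-1 * \int[mu]_(x in `[- M, M]) ((monom l.+1).[x] * (2 * K' x)).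
  rewrite -RintegralZl//; first by apply: eq_Rintegral => x _; field.
  apply: continuous_compact_integrable; first exact: segment_compact.
  by apply: cc; apply: csmoothM => //; exact: sm.
rewrite h.
- by rewrite mulrN mulNr; congr (- (_ * _)); apply: eq_Rintegral => x _; rewrite mulrC.
- by move=> x _; rewrite -derivE deriv_monom.
- by move=> x _; rewrite derive1E; have := dK x => ?; rewrite derive_val.
Qed.

Lemma cardinal_bspline_unit (m : nat) (x : R) :
  bspline m x = spl ind m.-1 (x + (m./2)%:R).
Proof. by rewrite /bspline cardinal_bsplineE. Qed.

(** For l = 0 this is the refinement equation, which gives phi the same form as the other psi. *)
Lemma psi1E (m : nat) (q : nat -> int -> R) l (c : R) x : bspline_masks m q -> (l <= m)%N ->
  mask_of q m l c ->
  psi1 m q l x = 2 * pspl m.+1 ind (mask_poly m l 0 c) m.-1 (2 * x + (m./2).*2%:R).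
Proof.
move=> hq lm hql.
have -> : psi1 m q l x = 2 * \sum_(k \in [set: int]) (q l k * bspline m (2 * x - k%:~R)).
  by case: l {lm hql} => // ; case: hq => _ _ h; exact: h.
rewrite (mask_sum _ lm hql); congr (2 * _); apply: eq_bigr => i _.
rewrite cardinal_bspline_unit; congr (_ * spl _ _ _).
by rewrite intrB -addnn natrD; ring.
Qed.

Lemma ae_leb_filter : Filter (nbhs (almost_everywhere mu)).
Proof. exact: ae_filter_ringOfSetsType. Qed.
#[local] Existing Instance ae_leb_filter.

Lemma ae_not_grid1 (a c : R) : a != 0 ->
  {ae mu, forall x : R, forall i : nat, a * x + c != i%:R}.
Proof.
move=> a0; apply: ae_foralln => i.
exists [set (i%:R - c) / a]; split => //; first exact: lebesgue_measure_set1.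
move=> x /= /negP; rewrite negbK => /eqP <-.
by rewrite addrK mulrC mulKf.
Qed.

(** For the bumps, l integrations by parts, each removing one factor 1 - X and one degree of the
    monomial; then the limit in j. *)
Lemma integral_pspl_monom (m l : nat) (c M : R) : (0 < m)%N -> (l <= m)%N -> m%:R + 1 <= M ->
  \int[mu]_(x in `[- M, M]) (pspl m.+1 ind (mask_poly m l 0 c) m.-1 (2 * x + (m./2).*2%:R)
     * (monom l).[x]) =
  (- 2^-1) ^+ l * \int[mu]_(x in `[- M, M]) pspl m.+1 ind (mask_poly m l l c) (m.-1 + l)%N (2 * x + (m./2).*2%:R).
Proof.
move=> m0 lm hM; set s : R := (m./2).*2%:R.
have M0 : 0 < M by apply: lt_le_trans hM; rewrite ltr_pwDr.
have s0 : 0 <= s by rewrite /s.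
have sm : s <= m%:R by rewrite ler_nat -addnn; lia.
pose K j b (x : R) : R := pspl m.+1 (bump j) (mask_poly m l b c) (m.-1 + b)%N (2 * x + s).
have sK j b : csmooth (K j b) by apply: csmooth_affine; apply: csmooth_pspl; exact: csmooth_bump.
have dK j b x : (b < l)%N -> is_derive x (1 : R) (K j b.+1) (2 * K j b x).
  move=> bl; apply: is_derive_affine => y; rewrite addnS.
  have [hP _] := mask_poly_chain c lm bl; rewrite -(hP b (ltnSn b)).
  apply: is_derive_pspl; first exact: csmooth_bump.
  have := size_mask_poly c lm bl; lia.
have K0 j b x : (b <= l)%N -> (2 * x + s < 0 \/ 2 * m%:R < 2 * x + s) -> K j b x = 0.
  move=> bl hx; apply/eqP; apply: contraPT hx => /(pspl_bump_supp (M := (2 * m)%N)).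
  have sz := size_mask_poly c lm bl.
  have r0 : 0 < j.+2%:R^-1 :> R by rewrite invr_gt0.
  move: (_^-1) r0 => r r0 /(_ _)/andP[|h1 h2]; first lia.
  by move: h2; rewrite natrM => h2 []; lra.
have step j b : (b <= l)%N -> \int[mu]_(x in `[- M, M]) (K j 0%N x * (monom l).[x]) =
    (- 2^-1) ^+ b * \int[mu]_(x in `[- M, M]) (K j b x * (monom (l - b)).[x]).
  elim: b => [|b IH] bl; first by rewrite expr0 mul1r subn0.
  rewrite (IH (ltnW bl)) exprSr -mulrA; congr (_ * _).
  have -> : (l - b = (l - b.+1).+1)%N by lia.
  apply: ibp_monom => //; first by move=> x; exact: dK.
    by apply: K0 => //; left; lra.
  by apply: K0 => //; right; lra.
have muM : (mu `[(- M)%R, M] < +oo)%E.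
  by rewrite [X in (X < _)%E](lebesgue_measure_itv `[(- M)%R, M])/=; case: ifP => _; rewrite -?EFinD ltry.
have dct b : (b <= l)%N -> \int[mu]_(x in `[- M, M]) (K j b x * (monom (l - b)).[x]) @[j --> \oo] -->
   \int[mu]_(x in `[- M, M]) (pspl m.+1 ind (mask_poly m l b c) (m.-1 + b)%N (2 * x + s) * (monom (l - b)).[x]).
  move=> bl.
  have sh := csmooth_continuous (csmooth_horner (monom (l - b))).
  have mh : measurable_fun setT (horner (monom (l - b))) by exact: continuous_measurable_fun.
  have ih : mu.-integrable `[(- M)%R, M] (EFin \o (fun x => `|(monom (l - b)).[x]|)).
    apply: integrableR_norm => //; apply: continuous_compact_integrable; first exact: segment_compact.
    exact: continuous_subspaceT.
  apply: (@Rdominated_cvg _ _ _ mu `[(- M)%R, M] (fun j x => K j b x * (monom (l - b)).[x]) _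
    (fun x => (\sum_(i < m.+1) `|(mask_poly m l b c)`_i|) * `|(monom (l - b)).[x]|)) => //.
  - move=> j; apply: measurable_funTS; apply: measurable_funM => //.
    by apply: continuous_measurable_fun; apply: csmooth_continuous; exact: sK.
  - apply: measurable_funTS; apply: measurable_funM => //.
    by apply: measurable_pspl; exact: unit_fun_indic.
  - have two0 : (2 : R) != 0 by rewrite pnatr_eq0.
    have hae := ae_not_grid1 s two0; apply: filterS hae => x hx _.
    by apply: cvgM; [apply: pspl_bump_cvg; exact: hx|exact: cvg_cst].
  - exact: integrableRZ.
  - by move=> j x _; rewrite normrM ler_wpM2r//; apply: pspl_bound; exact: unit_fun_bump.
have c0 := dct 0%N (leq0n l); rewrite subn0 addn0 in c0.
have cl := dct l (leqnn l); rewrite subnn in cl.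
have mon0 x : (monom 0).[x] = 1 :> R by rewrite /monom fact0 invr1 scale1r hornerXn expr0.
have {cl} cl : (- 2^-1) ^+ l * \int[mu]_(x in `[- M, M]) (K j l x * (monom 0).[x]) @[j --> \oo] -->
   (- 2^-1) ^+ l * \int[mu]_(x in `[- M, M]) pspl m.+1 ind (mask_poly m l l c) (m.-1 + l)%N (2 * x + s).
  apply: cvgM; first exact: cvg_cst.
  have -> : \int[mu]_(x in `[- M, M]) pspl m.+1 ind (mask_poly m l l c) (m.-1 + l)%N (2 * x + s) =
      \int[mu]_(x in `[- M, M]) (pspl m.+1 ind (mask_poly m l l c) (m.-1 + l)%N (2 * x + s) * (monom 0).[x]).
    by apply: eq_Rintegral => x _; rewrite mon0 mulr1.
  exact: cl.
move: cl c0; under [in X in _ -> X -> _]eq_fun do rewrite (step _ l (leqnn l)) subnn.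
by move=> cl c0; exact: (cvg_unique _ c0 cl).
Qed.

Lemma integrable_B_affine d (a b : R) : 0 < a ->
  mu.-integrable setT (EFin \o (fun x => spl ind d (a * x - b))).
Proof.
move=> a0; apply/integrableP; split.
  by apply/measurable_EFinP; exact: measurable_B_affine.
under eq_integral do rewrite /= ger0_norm ?B_ge0//.
by rewrite integral_spl_affine// ltry.
Qed.

Lemma Rintegral_supp (f : R -> R) (M : R) : (forall x, f x != 0 -> - M <= x <= M) ->
  \int[mu]_(x in `[- M, M]) f x = \int[mu]_x f x.
Proof.
move=> hf; rewrite Rintegral_mkcond; apply: eq_Rintegral => x _; rewrite patchE.
case: ifPn => //; rewrite notin_setE /= in_itv/= => h; apply/esym/eqP.
by apply: contra_notT h; exact: hf.
Qed.

Lemma pspl_mask_supp (m l b : nat) (c M x : R) : (0 < m)%N -> (l <= m)%N -> (b <= l)%N -> m%:R + 1 <= M ->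
  pspl m.+1 ind (mask_poly m l b c) (m.-1 + b)%N (2 * x + (m./2).*2%:R) != 0 -> - M <= x <= M.
Proof.
move=> m0 lm bl hM /(pspl_ind_supp (M := (2 * m)%N)).
have sz := size_mask_poly c lm bl.
have s0 : 0 <= (m./2).*2%:R :> R by [].
have sm : (m./2).*2%:R <= m%:R :> R by rewrite ler_nat -addnn; lia.
move: s0 sm; move: ((m./2).*2%:R) => s s0 sm.
move=> /(_ _)/andP[|h1]; first lia.
by rewrite natrM => h2; apply/andP; split; lra.
Qed.

Lemma integral_pspl_mask (m l : nat) (c M : R) : (0 < m)%N -> (l <= m)%N -> m%:R + 1 <= M ->
  \int[mu]_(x in `[- M, M]) pspl m.+1 ind (mask_poly m l l c) (m.-1 + l)%N (2 * x + (m./2).*2%:R) =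
  2^-1 * (c * 2 ^+ (m - l)).
Proof.
move=> m0 lm hM; rewrite Rintegral_supp; last by move=> x; exact: pspl_mask_supp.
have two0 : 0 < 2 :> R by [].
have ii (i : 'I_m.+1) : mu.-integrable setT (EFin \o (fun x => (mask_poly m l l c)`_i *
    spl ind (m.-1 + l)%N (2 * x - (i%:R - (m./2).*2%:R)))).
  by apply: integrableRZ => //; exact: integrable_B_affine.
transitivity (\int[mu]_x \sum_(i < m.+1) (mask_poly m l l c)`_i *
    spl ind (m.-1 + l)%N (2 * x - (i%:R - (m./2).*2%:R))).
  by apply: eq_Rintegral => x _; apply: eq_bigr => i _; congr (_ * spl _ _ _); ring.
rewrite Rintegral_sum//.
transitivity (\sum_(i < m.+1) (mask_poly m l l c)`_i * 2^-1).
  apply: eq_bigr => i _; rewrite RintegralZl//; last exact: integrable_B_affine.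
  by rewrite /Rintegral integral_spl_affine.
by rewrite -big_distrl/= sum_mask_poly// leqnn mul1r mulrC.
Qed.

(** The support of psi_l lies where the cutoff is 1, so the cutoff is invisible and the monomial
    moment can be computed by parts. *)
Lemma psi1_moment (m l : nat) (q : nat -> int -> R) (c M L : R) : bspline_masks m q ->
  mask_of q m l c ->
  (0 < m)%N -> (l <= m)%N -> m%:R + 1 <= M -> M <= L / 2 ->
  let t := fun x => psi1 m q l x * (cutoff L x * (monom l).[x]) in
  mu.-integrable setT (EFin \o t) /\
  \int[mu]_x t x = (- 2^-1) ^+ l * (c * 2 ^+ (m - l)).
Proof.
move=> hq hql m0 lm hM hL t.
have mR : 0 <= m%:R :> R by [].
have L0 : 0 < L by lra.
pose P := fun x => pspl m.+1 ind (mask_poly m l 0 c) m.-1 (2 * x + (m./2).*2%:R).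
have tE x : t x = 2 * (P x * (monom l).[x]).
  rewrite /t (psi1E x hq lm hql) -/(P x); have [->|Px] := eqVneq (P x) 0.
    by rewrite !(mulr0, mul0r).
  have xM : - M <= x <= M by apply: (@pspl_mask_supp m l 0 c) => //; rewrite addn0.
  rewrite cutoff_eq1// ?mul1r ?mulrA//.
  by case/andP: xM => h1 h2; apply/andP; split; lra.
have Pb x : `|P x| <= \sum_(i < m.+1) `|(mask_poly m l 0 c)`_i|.
  by apply: pspl_bound; exact: unit_fun_indic.
have mP : measurable_fun setT P by apply: measurable_pspl; exact: unit_fun_indic.
have muM : (mu `[(- M)%R, M] < +oo)%E.
  by rewrite [X in (X < _)%E](lebesgue_measure_itv `[(- M)%R, M])/=; case: ifP => _; rewrite -?EFinD ltry.
have iPM : mu.-integrable `[(- M)%R, M] (EFin \o (fun x => P x * (monom l).[x])).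
  have ih : mu.-integrable `[(- M)%R, M] (EFin \o (horner (monom l))).
    apply: continuous_compact_integrable; first exact: segment_compact.
    by apply: continuous_subspaceT; apply: csmooth_continuous; exact: csmooth_horner.
  have h : mu.-integrable `[(- M)%R, M] (EFin \o (fun x => (monom l).[x] * P x)).
    by apply: (@integrableRM_bound _ _ _ _ _ _ _ _ _ ih) => //; apply: measurable_funTS.
  by apply: eq_integrable h => // x _ /=; rewrite mulrC.
have zero x : ~ `[- M, M]%classic x -> P x * (monom l).[x] = 0.
  move=> h; have [->|Px] := eqVneq (P x) 0; first by rewrite mul0r.
  exfalso; apply: h; rewrite /= in_itv/=.
  by apply: (@pspl_mask_supp m l 0 c) => //; rewrite addn0.
have iP : mu.-integrable setT (EFin \o (fun x => P x * (monom l).[x])).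
  have := (integrable_mkcond (mu := mu) (EFin \o (fun x => P x * (monom l).[x])) (measurable_itv `[- M, M])).1 iPM.
  apply: eq_integrable => // x _; rewrite patchE; case: ifPn => //.
  by rewrite notin_setE => /zero h /=; rewrite h.
have tE' : t = (fun x => 2 * (P x * (monom l).[x])) by apply/funext.
rewrite tE'; split; first exact: integrableRZ.
rewrite RintegralZl// -(@Rintegral_supp _ M); last first.
  by move=> x; apply: contraNT => h; apply/eqP/zero; rewrite /= in_itv/=; apply/negP.
rewrite integral_pspl_monom// integral_pspl_mask//.
by rewrite mulrCA; congr (_ * _); rewrite mulrA mulfV ?mul1r// pnatr_eq0.
Qed.

(** Tested against the cut-off monomial of order al, whose derivative of order al is 1 on the
    support of [varphi], the weak derivative relation equates c_al with a product of two moments.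
    The sign (-1)^|al| of the relation cancels those of the moments. *)
Lemma framelet_constE (m : nat) (q : nat -> int -> R) (varphi : fidx m -> R * R -> R)
    (al : fidx m) (c1 c2 : R) : bspline_masks m q -> framelet_antiderivatives q varphi ->
  al \in framelet_idx m ->
  mask_of q m (val al.1) c1 ->
  mask_of q m (val al.2) c2 ->
  framelet_const varphi al =
  (2^-1 ^+ val al.1 * (c1 * 2 ^+ (m - val al.1))) * (2^-1 ^+ val al.2 * (c2 * 2 ^+ (m - val al.2))).
Proof.
move=> hq hv hal hq1 hq2.
have m0 : (0 < m)%N.
  case: m q varphi al hal hq hv hq1 hq2 => // q varphi al hal; exfalso; move: hal.
  by case: al => a b; rewrite !inE (ord1 a) (ord1 b) eqxx.
have lm1 : (val al.1 <= m)%N by exact: leq_ord.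
have lm2 : (val al.2 <= m)%N by exact: leq_ord.
have [Lv [K cK vK] wv] := hv al hal.
have [M [hM hKM]] : exists M : R, m%:R + 1 <= M /\ forall x, K x -> - M < x.1 < M /\ - M < x.2 < M.
  have [M0 [_ hM0]] : bounded_set (K : set (R^o * R^o)) by exact: compact_bounded.
  exists (Num.max (m%:R + 1) (M0 + 2)); split; first by rewrite le_max lexx.
  move=> x Kx; have : `|(x : R^o * R^o)| <= M0 + 1 by apply: (hM0 (M0 + 1)) => //; rewrite ltrDl.
  rewrite prod_normE ge_max /= => /andP[h1 h2].
  have hM : M0 + 1 < Num.max (m%:R + 1) (M0 + 2) by rewrite lt_max; apply/orP; right; lra.
  by rewrite -!ltr_norml (le_lt_trans h1)// (le_lt_trans h2).
have mR : 0 <= m%:R :> R by [].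
(* The cutoff is then 1 on [-M, M], which contains the coordinates of the points of K and the
   supports of the univariate psi. *)
pose L := 2 * M; have L0 : 0 < L by rewrite /L; lra.
pose tau l := fun x => cutoff L x * (monom l).[x].
have stau l : csmooth (tau l) by apply: csmoothM; [exact: csmooth_cutoff|exact: csmooth_horner].
have suptau l x : tau l x != 0 -> - L <= x <= L.
  by rewrite /tau mulf_eq0 negb_or => /andP[h _]; exact: cutoff_supp.
have tf : test_function setT (tens (tau (val al.1)) (tau (val al.2))).
  by apply: test_function_tens; [exact: stau|exact: stau|exact: suptau|exact: suptau|].
have dtau l x : - M < x < M -> iterd l (tau l) x = 1.
  move=> hx; rewrite (@derive1n_near l _ (horner (monom l)) (- M) M)//.
  - by rewrite derive1n_horner derivn_monom hornerC.
  - exact: csmooth_horner.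
  - move=> z /andP[z1 z2]; rewrite /tau cutoff_eq1 ?mul1r//.
    by apply/andP; split; rewrite /L; lra.
have := wv _ tf; rewrite pd_tens//.
have -> : \int[mu2]_x (varphi al x * tens (iterd (midx al).1 (tau (val al.1)))
    (iterd (midx al).2 (tau (val al.2))) x) = framelet_const varphi al.
  have mv : measurable_fun setT (varphi al).
    by move: Lv; rewrite /Lp patch_setT => /sub_Lfun_mfun; rewrite inE.
  apply: ae_eq_Rintegral => //.
  - apply: measurable_funM => //.
    by apply: measurable_tensor; apply: continuous_measurable_fun; apply: csmooth_continuous;
      apply: csmooth_derive1n; exact: stau.
  - apply: filterS vK => x hx _; have [Kx|nKx] := pselect (K x); last by rewrite hx// mul0r.
    by have [h1 h2] := hKM _ Kx; rewrite /tens !dtau// !mulr1.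
have ML : M <= L / 2 by rewrite /L; lra.
have [i1 e1] := psi1_moment hq hq1 m0 lm1 hM ML.
have [i2 e2] := psi1_moment hq hq2 m0 lm2 hM ML.
have -> : \int[mu2]_x (psi m q (midx al) x * tens (tau (val al.1)) (tau (val al.2)) x) =
   ((- 2^-1) ^+ val al.1 * (c1 * 2 ^+ (m - val al.1))) *
   ((- 2^-1) ^+ val al.2 * (c2 * 2 ^+ (m - val al.2))).
  rewrite -e1 -e2 -Rintegral_tensor//; apply: eq_Rintegral => x _.
  by rewrite /psi /tens /tau /=; ring.
move=> ->; rewrite /mord /= exprD !(exprNn (2^-1)).
have s1 n : (-1) ^+ n * (-1) ^+ n = 1 :> R by rewrite -exprD addnn -mul2n exprM sqrrN expr1n expr1n.
transitivity (((-1) ^+ al.1 * (-1) ^+ al.1) * ((-1) ^+ al.2 * (-1) ^+ al.2) *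
  ((2^-1 ^+ al.1 * (c1 * 2 ^+ (m - al.1))) * (2^-1 ^+ al.2 * (c2 * 2 ^+ (m - al.2)))) : R).
  by ring.
by rewrite !s1 !mul1r.
Qed.

End FrameletConstants.

(** * Splitting a function into its mean and a derivative *)

Section Boundedness.
Context {R : realType}.
Notation mu := (@lebesgue_measure R).

(** For x < 0 the interval is empty and the value is 0. The lemmas on derivatives therefore take f
    that vanishes up to some a > 0, so that no corner appears at 0. *)
Definition prim (f : R -> R) (x : R) : R := \int[mu]_(t in `[0, x]) f t.

Lemma prim0 (f : R -> R) (a x : R) : (forall y, y <= a -> f y = 0) -> x <= a -> prim f x = 0.
Proof.
move=> fa xa; rewrite /prim -[RHS](mul0r (fine (mu `[0%R, x]))) -Rintegral_cst//.
apply: eq_Rintegral => t; rewrite inE/= in_itv/= => /andP[_ tx].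
by rewrite fa// (le_trans tx).
Qed.

Lemma is_derive_prim (f : R -> R) (a x : R) : continuous f -> 0 < a -> (forall y, y <= a -> f y = 0) ->
  is_derive x (1 : R) (prim f) (f x).
Proof.
move=> cf a0 fa; have [x0|x0] := ltP 0 x; first exact: is_derive_primitive.
rewrite fa ?(le_trans x0)// ?ltW//.
apply: (near_eq_is_derive (f := fun=> 0 : R)).
  near=> z; apply/esym/(prim0 fa); apply: ltW; near: z; apply: lt_nbhsl.
  exact: le_lt_trans x0 a0.
Unshelve. all: by end_near.
Qed.

Lemma csmooth_prim (f : R -> R) (a : R) : csmooth f -> 0 < a -> (forall y, y <= a -> f y = 0) ->
  csmooth (prim f).
Proof.
move=> sf a0 fa n; apply: nderW; exists f; split; last exact: sf.
by move=> x; apply: (is_derive_prim _ (csmooth_continuous sf) a0 fa).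
Qed.

Lemma continuous_integrable (f : R -> R) (a b : R) : continuous f -> mu.-integrable `[a, b] (EFin \o f).
Proof.
move=> cf; apply: continuous_compact_integrable; first exact: segment_compact.
exact: continuous_subspaceT.
Qed.

Lemma prim_const (f : R -> R) (b x : R) : continuous f -> 0 <= b -> (forall y, b < y -> f y = 0) -> b <= x ->
  prim f x = prim f b.
Proof.
move=> cf b0 fb bx; apply/eqP; rewrite -subr_eq0; apply/eqP.
rewrite /prim Rintegral_itvB ?bnd_simp//; last exact: continuous_integrable.
rewrite -[RHS](mul0r (fine (mu `]b, x]))) -Rintegral_cst//.
apply: eq_Rintegral => t; rewrite inE/= in_itv/= => /andP[bt _].
by rewrite fb.
Qed.

Lemma prim_norm (f g : R -> R) (x : R) : continuous f -> continuous g -> (forall y, `|f y| <= g y) ->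
  x <= 1 -> `|prim f x| <= prim g 1.
Proof.
move=> cf cg fg x1; have g0 y : 0 <= g y by apply: le_trans (fg y).
apply: (le_trans (le_normr_Rintegral _ _)) => //; first exact: continuous_integrable.
apply: (@le_trans _ _ (prim g x)).
  apply: le_Rintegral => //; last exact: continuous_integrable.
  by apply: integrableR_norm => //; exact: continuous_integrable.
rewrite /prim /Rintegral; apply: fine_le.
- by apply: integrable_fin_num => //; exact: continuous_integrable.
- by apply: integrable_fin_num => //; exact: continuous_integrable.
apply: ge0_subset_integral => //.
- by apply/measurable_EFinP; apply: measurable_funTS; exact: continuous_measurable_fun.
- by move=> y _; rewrite lee_fin.
- by move=> y /=; rewrite !in_itv/= => /andP[-> /le_trans]; apply.
Qed.

Lemma primB (f g : R -> R) (c x : R) : continuous f -> continuous g ->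
  prim (fun y => f y - c * g y) x = prim f x - c * prim g x.
Proof.
move=> cf cg; have if_ := continuous_integrable 0 x cf; have ig := continuous_integrable 0 x cg.
rewrite /prim RintegralB//; last exact: integrableRZ.
by rewrite RintegralZl.
Qed.

Lemma bump_prim_gt0 : 0 < prim (@bump R 6) 1.
Proof.
apply: (@Rintegral_gt0 _ _ _ _ (4^-1) (3 / 4)); rewrite ?lexx//; try lra.
- by apply: continuous_integrable; apply: csmooth_continuous; exact: csmooth_bump.
- by move=> x; case/andP: (bump01 6 x).
- by move=> x /andP[h1 h2]; rewrite bump_eq1//; apply/andP; split; lra.
Qed.

Definition unit_bump (x : R) : R := (prim (@bump R 6) 1)^-1 * bump 6 x.

Lemma csmooth_unit_bump : csmooth unit_bump.
Proof. by apply: csmoothM; [exact: csmooth_cst|exact: csmooth_bump]. Qed.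

Lemma unit_bump_supp x : unit_bump x != 0 -> 8^-1 <= x <= 1 - 8^-1.
Proof. by rewrite /unit_bump mulf_eq0 negb_or => /andP[_ /bump_supp]. Qed.

Lemma prim_unit_bump : prim unit_bump 1 = 1.
Proof.
rewrite /prim /unit_bump RintegralZl//.
  by rewrite mulVf// gt_eqF// bump_prim_gt0.
by apply: continuous_integrable; apply: csmooth_continuous; exact: csmooth_bump.
Qed.

Lemma unit_bump_ge0 x : 0 <= unit_bump x.
Proof.
by rewrite /unit_bump mulr_ge0 ?invr_ge0 ?(ltW bump_prim_gt0)//; case/andP: (bump01 6 x).
Qed.

Lemma unit_bump_norm x : `|unit_bump x| <= (prim (@bump R 6) 1)^-1.
Proof.
rewrite ger0_norm ?unit_bump_ge0// /unit_bump -[leRHS]mulr1 ler_wpM2l//.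
  by rewrite invr_ge0 ltW// bump_prim_gt0.
by case/andP: (bump01 6 x).
Qed.

(** Subtracting from tau its mean times [unit_bump] leaves a function f of integral 0, whose
    primitive zeta vanishes again beyond the supports. As |f| <= tau + mean * [unit_bump], zeta is
    at most twice the mean. *)
Lemma mean_decomposition (tau : R -> R) (a b : R) : csmooth tau -> 0 < a -> b < 1 ->
  (forall x, tau x != 0 -> a <= x <= b) -> (forall x, 0 <= tau x) ->
  exists zeta : R -> R, exists a' b' : R, [/\ csmooth zeta, 0 < a' /\ b' < 1,
    (forall x, zeta x != 0 -> a' <= x <= b'),
    (forall x, zeta^`()%classic x = tau x - prim tau 1 * unit_bump x) &
    (forall x, `|zeta x| <= 2 * prim tau 1)].
Proof.
move=> stau a0 b1 ht t0; pose f x := tau x - prim tau 1 * unit_bump x.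
have cu := csmooth_continuous csmooth_unit_bump.
have ct := csmooth_continuous stau.
have sf : csmooth f.
  have -> : f = (fun x => tau x + (- prim tau 1) * unit_bump x).
    by apply/funext => x; rewrite mulNr.
  apply: csmoothD => //; apply: csmoothM; first exact: csmooth_cst.
  exact: csmooth_unit_bump.
have cf := csmooth_continuous sf.
(* The halving makes f vanish at a' itself, as [is_derive_prim] demands; on the right it only has to
   vanish beyond b'. *)
pose a' := Num.min a 8^-1 / 2; pose b' := Num.max b (1 - 8^-1).
have a'0 : 0 < a' by rewrite /a' divr_gt0// lt_min a0/= invr_gt0.
have b'1 : b' < 1 by rewrite /b' gt_max b1/=; lra.
have b'0 : 0 <= b' by rewrite /b' le_max; apply/orP; right; lra.
have m0 : 0 < Num.min a 8^-1 by rewrite lt_min a0/= invr_gt0.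
have ma : Num.min a 8^-1 <= a by rewrite ge_min lexx.
have m8 : Num.min a 8^-1 <= 8^-1 by rewrite ge_min lexx orbT.
have Mb : b <= b' by rewrite le_max lexx.
have M8 : 1 - 8^-1 <= b' by rewrite le_max lexx orbT.
have fa y : y <= a' -> f y = 0.
  rewrite /a' => ya.
  have -> : f y = tau y - prim tau 1 * unit_bump y by [].
  have -> : tau y = 0 by apply: contraTeq ya => /ht/andP[h _]; rewrite -ltNge; lra.
  have -> : unit_bump y = 0 by apply: contraTeq ya => /unit_bump_supp/andP[h _]; rewrite -ltNge; lra.
  by rewrite mulr0 subr0.
have fb y : b' < y -> f y = 0.
  move=> yb; have -> : f y = tau y - prim tau 1 * unit_bump y by [].
  have -> : tau y = 0 by apply: contraTeq yb => /ht/andP[_ h]; rewrite -leNgt; lra.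
  have -> : unit_bump y = 0 by apply: contraTeq yb => /unit_bump_supp/andP[_ h]; rewrite -leNgt; lra.
  by rewrite mulr0 subr0.
have f1 : prim f 1 = 0 by rewrite primB// prim_unit_bump mulr1 subrr.
have t1 : 0 <= prim tau 1 by apply: Rintegral_ge0 => x _.
have big x : 1 <= x -> prim f x = 0.
  move=> x1; rewrite (prim_const cf b'0 fb) ?(le_trans (ltW b'1))//.
  by rewrite -(prim_const cf b'0 fb (ltW b'1)).
exists (prim f), a', b'; split => //.
- exact: csmooth_prim sf a'0 fa.
- move=> x; apply: contraR; rewrite negb_and -!ltNge => /orP[h|h].
    by apply/eqP/(prim0 fa); exact: ltW.
  rewrite (prim_const cf b'0 fb (ltW h)) -(prim_const cf b'0 fb (ltW b'1)).
  by rewrite f1.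
- by move=> x; rewrite derive1E; have := is_derive_prim x cf a'0 fa => ?; rewrite derive_val.
- move=> x; have [x1|/ltW/big->] := leP x 1; last by rewrite normr0 mulr_ge0.
  have cg : continuous (fun y => tau y - (- prim tau 1) * unit_bump y).
    have sg : csmooth (fun y => tau y + prim tau 1 * unit_bump y).
      apply: csmoothD => //; apply: csmoothM; first exact: csmooth_cst.
      exact: csmooth_unit_bump.
    rewrite (_ : (fun y => _) = (fun y => tau y + prim tau 1 * unit_bump y)).
      exact: csmooth_continuous.
    by apply/funext => y; rewrite mulNr opprK.
  apply: (le_trans (prim_norm cf cg _ x1)); last first.
    by rewrite primB// prim_unit_bump mulr1 opprK; lra.
  move=> y; rewrite mulNr opprK (le_trans (ler_normB _ _))// ger0_norm//.
  by rewrite ger0_norm// mulr_ge0// unit_bump_ge0.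
Qed.

End Boundedness.

(** * Boundedness of functions with integrable mixed derivatives *)

Section BoundedSobolev.
Context {R : realType}.
Notation mu := (@lebesgue_measure R).
Notation mu2 := (@leb2 R).
Notation ind := (\1_`[0, 1[ : R -> R).
Notation iterd a := (iter a (fun h : R -> R => h^`()%classic)).
Implicit Types (u w : R * R -> R).

Lemma is_weak_derivative0 (U : set (R * R)) u : is_weak_derivative U (0%N, 0%N) u u.
Proof. by move=> t _; rewrite /pd /mord /= expr0 mul1r. Qed.

Lemma measurable_csmooth (f : R -> R) : csmooth f -> measurable_fun setT f.
Proof. by move=> sf; apply: continuous_measurable_fun; exact: csmooth_continuous. Qed.

Lemma weak_tens_bound (be : nat * nat) u g (f1 f2 : R -> R) (a1 b1 a2 b2 C1 C2 : R) :
  Lp 1 (@Omega R) g -> is_weak_derivative (@Omega R) be u g ->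
  csmooth f1 -> csmooth f2 -> 0 < a1 /\ b1 < 1 -> 0 < a2 /\ b2 < 1 ->
  (forall x, f1 x != 0 -> a1 <= x <= b1) -> (forall x, f2 x != 0 -> a2 <= x <= b2) ->
  (forall x, `|f1 x| <= C1) -> (forall x, `|f2 x| <= C2) ->
  `|\int[mu2]_x ((u \_ (@Omega R)) x * tens (iterd be.1 f1) (iterd be.2 f2) x)| <=
    C1 * C2 * \int[mu2]_x `|(g \_ (@Omega R)) x|.
Proof.
move=> Lg wd s1 s2 [a10 b11] [a20 b21] h1 h2 k1 k2.
have tf : test_function (@Omega R) (tens f1 f2).
  apply: (test_function_tens s1 s2 h1 h2) => -[x y] [] /=; rewrite !in_itv/= => /andP[p1 p2] /andP[p3 p4].
  split => /=; rewrite in_itv/=; apply/andP; split.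
  - exact: lt_le_trans p1.
  - exact: le_lt_trans b11.
  - exact: lt_le_trans p3.
  - exact: le_lt_trans b21.
have := wd _ tf; rewrite !Rintegral_Omega_patch pd_tens// => ->.
rewrite normrM normrX normrN1 expr1n mul1r.
apply: Rintegral_norm_bound => //; first exact: Lp1_integrable.
  by apply: measurable_tensor; exact: measurable_csmooth.
by move=> x _; rewrite /tens normrM ler_pM.
Qed.

(* Each factor is [tau = t * beta + zeta'] with [t] its integral, [beta] a fixed bump function and
   [|zeta| <= 2 * t]; integrating by parts the terms with [zeta'] leaves only factors [t]. *)
Lemma tensor_mean_bound u g01 g10 g11 :
  Lp 1 (@Omega R) u -> Lp 1 (@Omega R) g01 -> Lp 1 (@Omega R) g10 -> Lp 1 (@Omega R) g11 ->
  is_weak_derivative (@Omega R) (0%N, 1%N) u g01 ->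
  is_weak_derivative (@Omega R) (1%N, 0%N) u g10 ->
  is_weak_derivative (@Omega R) (1%N, 1%N) u g11 ->
  exists C : R, forall (tau1 tau2 : R -> R) (a1 b1 a2 b2 : R), csmooth tau1 -> csmooth tau2 ->
    0 < a1 /\ b1 < 1 -> 0 < a2 /\ b2 < 1 ->
    (forall x, tau1 x != 0 -> a1 <= x <= b1) -> (forall x, tau2 x != 0 -> a2 <= x <= b2) ->
    (forall x, 0 <= tau1 x) -> (forall x, 0 <= tau2 x) ->
    `|\int[mu2]_x ((u \_ (@Omega R)) x * tens tau1 tau2 x)| <= C * (prim tau1 1 * prim tau2 1).
Proof.
move=> Lu L01 L10 L11 w01 w10 w11; pose K := (prim (@bump R 6) 1)^-1.
pose N (g : R * R -> R) := \int[mu2]_x `|(g \_ (@Omega R)) x|.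
exists (K * K * N u + K * 2 * N g01 + 2 * K * N g10 + 2 * 2 * N g11).
move=> tau1 tau2 a1 b1 a2 b2 s1 s2 [a10 b11] [a20 b21] h1 h2 p1 p2.
have [z1 [c1 [d1 [sz1 cd1 hz1 z1' z1b]]]] := mean_decomposition s1 a10 b11 h1 p1.
have [z2 [c2 [d2 [sz2 cd2 hz2 z2' z2b]]]] := mean_decomposition s2 a20 b21 h2 p2.
set t1 := prim tau1 1 in z1' z1b *; set t2 := prim tau2 1 in z2' z2b *.
have t10 : 0 <= t1 by apply: Rintegral_ge0 => x _.
have t20 : 0 <= t2 by apply: Rintegral_ge0 => x _.
have sb := @csmooth_unit_bump R.
have Kb x : `|unit_bump x| <= K by exact: unit_bump_norm.
have b8 : 0 < 8^-1 :> R /\ 1 - 8^-1 < 1 :> R by split; lra.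
have hb := @unit_bump_supp R.
have e00 := weak_tens_bound Lu (@is_weak_derivative0 (@Omega R) u) sb sb b8 b8 hb hb Kb Kb.
have e01 := weak_tens_bound L01 w01 sb sz2 b8 cd2 hb hz2 Kb z2b.
have e10 := weak_tens_bound L10 w10 sz1 sb cd1 b8 hz1 hb z1b Kb.
have e11 := weak_tens_bound L11 w11 sz1 sz2 cd1 cd2 hz1 hz2 z1b z2b.
move: e00 e01 e10 e11 => /=; rewrite -!/(N _).
set w := u \_ (@Omega R).
have iw : mu2.-integrable setT (EFin \o w) by exact: Lp1_integrable.
have cpt (f : R -> R) (a b : R) : csmooth f -> (forall x, f x != 0 -> a <= x <= b) ->
    exists M : R, forall x, `|f x| <= M.
  move=> sf hf; have cf := csmooth_continuous sf.
  have cK : compact (f @` `[a, b]).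
    by apply: continuous_compact; [exact: continuous_subspaceT|exact: segment_compact].
  have [M [_ hM]] := compact_bounded cK.
  exists (Num.max (M + 1) 0) => x.
  have [->|/hf hx] := eqVneq (f x) 0; first by rewrite normr0 le_max lexx orbT.
  by rewrite le_max; apply/orP; left; apply: hM; [lra|exists x => //=; rewrite in_itv].
have supp' (f : R -> R) (a b : R) : csmooth f -> (forall x, f x != 0 -> a <= x <= b) ->
    forall x, f^`()%classic x != 0 -> a <= x <= b.
  move=> sf hf x; apply: contraR => hx; apply/eqP; rewrite derive1E.
  have near0 : \forall z \near x, f z = 0.
    have : open (~` `[a, b]) by apply: closed_openC; exact: interval_closed.
    move=> op; have : (~` `[a, b]) x by move=> /=; rewrite in_itv/=; exact/negP.
    move=> hx'; have := open_nbhs_nbhs (conj op hx'); apply: filterS => z /= hz.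
    by apply: contra_notP hz => /eqP/hf; rewrite in_itv.
  have : is_derive x (1 : R) f 0.
    apply: (near_eq_is_derive (f := fun=> 0 : R)).
    by apply: filterS near0.
  by move=> ?; rewrite derive_val.
have ib (f1 f2 : R -> R) (p q r s : R) : csmooth f1 -> csmooth f2 ->
   (forall x, f1 x != 0 -> p <= x <= q) -> (forall x, f2 x != 0 -> r <= x <= s) ->
   mu2.-integrable setT (EFin \o (fun x => w x * tens f1 f2 x)).
  move=> sf1 sf2 hf1 hf2; have [M1 hM1] := cpt _ _ _ sf1 hf1; have [M2 hM2] := cpt _ _ _ sf2 hf2.
  apply: (@integrableRM_bound _ _ _ _ _ _ _ (M1 * M2)) => //.
    by apply: measurable_tensor; exact: measurable_csmooth.
  by move=> x _; rewrite /tens normrM ler_pM.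
have sz1' : csmooth z1^`()%classic by case: (csmooth_derive sz1).
have sz2' : csmooth z2^`()%classic by case: (csmooth_derive sz2).
have i00 := ib _ _ _ _ _ _ sb sb hb hb.
have i01 := ib _ _ _ _ _ _ sb sz2' hb (supp' _ _ _ sz2 hz2).
have i10 := ib _ _ _ _ _ _ sz1' sb (supp' _ _ _ sz1 hz1) hb.
have i11 := ib _ _ _ _ _ _ sz1' sz2' (supp' _ _ _ sz1 hz1) (supp' _ _ _ sz2 hz2).
have -> : \int[mu2]_x (w x * tens tau1 tau2 x) =
   t1 * t2 * \int[mu2]_x (w x * tens unit_bump unit_bump x) +
   t1 * \int[mu2]_x (w x * tens unit_bump z2^`()%classic x) +
   t2 * \int[mu2]_x (w x * tens z1^`()%classic unit_bump x) +
   \int[mu2]_x (w x * tens z1^`()%classic z2^`()%classic x).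
  have j00 := integrableRZ (t1 * t2) measurableT i00.
  have j01 := integrableRZ t1 measurableT i01.
  have j10 := integrableRZ t2 measurableT i10.
  have k1 := integrableRD measurableT j00 j01.
  have k2 := integrableRD measurableT k1 j10.
  rewrite -(RintegralZl (t1 * t2) measurableT i00) -(RintegralZl t1 measurableT i01).
  rewrite -(RintegralZl t2 measurableT i10) -(RintegralD measurableT j00 j01).
  rewrite -(RintegralD measurableT k1 j10) -(RintegralD measurableT k2 i11).
  by apply: eq_Rintegral => x _; rewrite /tens z1' z2'; ring.
set A := \int[mu2]_x _; set B := \int[mu2]_x _; set C := \int[mu2]_x _; set D := \int[mu2]_x _.
move=> e00 e01 e10 e11.
have n0 : `|t1 * t2 * A| <= t1 * t2 * (K * K * N u).
  by rewrite normrM ger0_norm ?mulr_ge0// ler_wpM2l// mulr_ge0.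
have n1 : `|t1 * B| <= t1 * (K * (2 * t2) * N g01).
  by rewrite normrM ger0_norm// ler_wpM2l.
have n2 : `|t2 * C| <= t2 * ((2 * t1) * K * N g10).
  by rewrite normrM ger0_norm// ler_wpM2l.
have n3 := ler_normD (t1 * t2 * A + t1 * B + t2 * C) D.
have n4 := ler_normD (t1 * t2 * A + t1 * B) (t2 * C).
have n5 := ler_normD (t1 * t2 * A) (t1 * B).
apply: (@le_trans _ _ (t1 * t2 * (K * K * N u) + t1 * (K * (2 * t2) * N g01) +
  t2 * ((2 * t1) * K * N g10) + 2 * t1 * (2 * t2) * N g11)); first lra.
by rewrite le_eqVlt; apply/orP; left; apply/eqP; ring.
Qed.

(** The bump is at most the indicator of the unit interval, so after dilation its mass is at most
    the length of a cell. *)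
Lemma prim_bump_cell n j (k : int) : prim (fun x => @bump R j (2 ^+ n * x + - k%:~R)) 1 <= 2 ^- n.
Proof.
have p0 : 0 < 2 ^+ n :> R by rewrite exprn_gt0.
have cb : continuous (fun x : R => @bump R j (2 ^+ n * x + - k%:~R)).
  by apply: csmooth_continuous; apply: csmooth_affine; exact: csmooth_bump.
have iB := @integrable_B_affine R 0 (2 ^+ n) k%:~R p0.
have mB : measurable_fun setT (fun x : R => spl ind 0 (2 ^+ n * x - k%:~R)).
  by have /measurable_EFinP := measurable_int _ iB.
have iI := @integral_spl_affine R 0 (2 ^+ n) k%:~R p0.
have le1 : (\int[mu]_(x in `[0%R, 1%R]) (bump j (2 ^+ n * x + - k%:~R))%:E <= (2 ^- n)%:E)%E.
  rewrite -iI; apply: (@le_trans _ _ (\int[mu]_x (bump j (2 ^+ n * x + - k%:~R))%:E)%E).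
    apply: ge0_subset_integral => //.
      by apply/measurable_EFinP; exact: continuous_measurable_fun.
    by move=> x _; rewrite lee_fin; case/andP: (bump01 j (2 ^+ n * x + - k%:~R)).
  apply: ge0_le_integral => //.
  - by move=> x _; rewrite lee_fin; case/andP: (bump01 j (2 ^+ n * x + - k%:~R)).
  - by apply/measurable_EFinP; exact: continuous_measurable_fun.
  - exact/measurable_EFinP.
  move=> x _; rewrite lee_fin /=; set y := _ - _.
  have /andP[b0 b1] := bump01 j y.
  have [->|/bump_supp hy] := eqVneq (bump j y) 0; first by rewrite indicE.
  have r0 : 0 < j.+2%:R^-1 :> R by rewrite invr_gt0.
  rewrite /= indicE mem_set//= in_itv/=; move: hy => /andP[h1 h2].
  by move: r0 h1 h2; set r := _^-1 => r0 h1 h2; apply/andP; split; lra.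
rewrite /prim /Rintegral -lee_fin fineK//.
by apply: integrable_fin_num => //; exact: continuous_integrable.
Qed.

(** Bidegree (0, 0) gives the mean over a cell. The bumps of a cell have mass at most 2^-n each, so
    [tensor_mean_bound] yields C 4^-n, which cancels the normalisation 4^n. *)
Lemma avg_bounded u : W1 2 (@Omega R) u ->
  exists C : R, forall n (k : 'I_(2 ^ n) * 'I_(2 ^ n)),
    `|avg n (0%N, 0%N) (u \_ (@Omega R)) (cell_idx k)| <= C.
Proof.
move=> [Lu hw].
have [g01 [L01 w01]] := hw (0%N, 1%N) isT.
have [g10 [L10 w10]] := hw (1%N, 0%N) isT.
have [g11 [L11 w11]] := hw (1%N, 1%N) isT.
have [C hC] := tensor_mean_bound Lu L01 L10 L11 w01 w10 w11.
(* Nothing is known about the sign of C, and the bound has to be monotone in the masses. *)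
exists `|C| => n k; have p0 : 0 < 2 ^+ n :> R by rewrite exprn_gt0.
have pn0 : 2 ^+ n != 0 :> R by rewrite gt_eqF.
set w := u \_ (@Omega R).
have iw : mu2.-integrable setT (EFin \o w) by exact: Lp1_integrable.
have bnd j (i : 'I_(2 ^ n)) : exists a b : R, (0 < a /\ b < 1) /\
    forall x, bump j (2 ^+ n * x + - (i%:Z)%:~R) != 0 -> a <= x <= b.
  have r0 : 0 < j.+2%:R^-1 :> R by rewrite invr_gt0.
  set r := j.+2%:R^-1 in r0.
  exists ((i%:R + r) / 2 ^+ n), ((i.+1%:R - r) / 2 ^+ n); split; first split.
  - by rewrite divr_gt0// ltr_wpDl.
  - rewrite ltr_pdivrMr// mul1r; have : i.+1%:R <= 2 ^+ n :> R by rewrite -natrX ler_nat.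
    lra.
  - move=> x /bump_supp; rewrite -/r => /andP[h1 h2].
    rewrite ler_pdivrMr// ler_pdivlMr// mulrC -[i.+1]addn1 natrD.
    by move: h1 h2; rewrite pmulrn => h1 h2; apply/andP; split; lra.
have key j : `|\int[mu2]_x (w x * pstens 1 (bump j) 1 1 0 0 (2 ^+ n)
     (- (k.1%:Z)%:~R) (- (k.2%:Z)%:~R) x)| <= `|C| * 4 ^- n.
  have [a1 [b1 [ab1 h1]]] := bnd j k.1; have [a2 [b2 [ab2 h2]]] := bnd j k.2.
  pose tau (i : int) x := @bump R j (2 ^+ n * x + - i%:~R).
  have st i : csmooth (tau i) by apply: csmooth_affine; exact: csmooth_bump.
  have t0 i x : 0 <= tau i x by case/andP: (bump01 j (2 ^+ n * x + - i%:~R)).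
  have -> : pstens 1 (bump j) 1 1 0 0 (2 ^+ n) (- (k.1%:Z)%:~R) (- (k.2%:Z)%:~R) =
      tens (tau k.1) (tau k.2).
    apply/funext => x; rewrite /pstens /tens /pspl !big_ord1 /tau /= !coef1/= !mul1r.
    by rewrite !subr0.
  apply: (le_trans (hC _ _ _ _ _ _ (st _) (st _) ab1 ab2 h1 h2 (t0 _) (t0 _))).
  have q i : 0 <= prim (tau i) 1 by apply: Rintegral_ge0 => x _.
  apply: (@le_trans _ _ (`|C| * (prim (tau k.1) 1 * prim (tau k.2) 1))).
    by rewrite ler_wpM2r ?mulr_ge0// ler_norm.
  rewrite ler_wpM2l// (_ : 4 ^- n = 2 ^- n * 2 ^- n :> R).
    by apply: ler_pM => //; exact: prim_bump_cell.
  by rewrite -invfM -exprMn; congr (_ ^+ _)^-1; ring.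
have cv := @integral_pstens_cvg R 1 1 1 0 0 (2 ^+ n) (- (k.1%:Z)%:~R) (- (k.2%:Z)%:~R) _ pn0 iw.
have nv : `|\int[mu2]_x (w x * pstens 1 ind 1 1 0 0 (2 ^+ n) (- (k.1%:Z)%:~R) (- (k.2%:Z)%:~R) x)|
    <= `|C| * 4 ^- n.
  by apply: (cvgr_to_le (cvg_norm cv)); exact: nearW.
have p4 : 0 < 4 ^+ n :> R by rewrite exprn_gt0.
have -> : avg n (0%N, 0%N) w (cell_idx k) =
   4 ^+ n * \int[mu2]_x (w x * pstens 1 ind 1 1 0 0 (2 ^+ n) (- (k.1%:Z)%:~R) (- (k.2%:Z)%:~R) x).
  rewrite -RintegralZl//.
    apply: eq_Rintegral => x _; rewrite /kern /pstens /tens /pspl !big_ord1 !coef1/= !mul1r !subr0.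
    ring.
  apply: (@integrableRM_bound _ _ _ _ _ _ _ ((\sum_(i < 1) `|(1 : {poly R})`_i|) * (\sum_(i < 1) `|(1 : {poly R})`_i|))) => //.
    by apply: measurable_pstens; exact: unit_fun_indic.
  by move=> x _; apply: pstens_bound; exact: unit_fun_indic.
by rewrite normrM ger0_norm ?(ltW p4)// mulrC -ler_pdivlMr.
Qed.

Lemma Rintegral0_ae (T : set (R * R)) w : measurable (T : set (measurableTypeR R * measurableTypeR R)) ->
  mu2.-integrable T (EFin \o w) ->
  (forall x, T x -> 0 <= w x) -> \int[mu2]_(x in T) w x = 0 ->
  {ae mu2, forall x, T x -> w x = 0}.
Proof.
move=> mT iw w0 e; have mw := measurable_int _ iw.
have := (ae_eq_integral_abs mu2 mT mw).1; rewrite /ae_eq.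
have -> : (\int[mu2]_(x in T) `|(EFin \o w) x| = 0)%E.
  transitivity (\int[mu2]_(x in T) (EFin \o w) x)%E.
    by apply: eq_integral => x; rewrite inE => /w0 h /=; rewrite ger0_norm.
  by have := fineK (integrable_fin_num mT iw); rewrite -/(Rintegral _ _ _) e => <-.
move=> /(_ erefl); apply: filterS => x /= h Tx.
by have [] := h Tx.
Qed.

(** The cell means are bounded by C and converge to u in L_1. The excess of |u| over C is at most
    the distance from u to its mean, so its integral is 0. *)
Lemma W1_ae_bounded u : W1 2 (@Omega R) u ->
  exists C : R, {ae mu2, forall x, `|(u \_ (@Omega R)) x| <= C}.
Proof.
move=> Wu; have [C hC] := avg_bounded Wu; set w := u \_ (@Omega R) in hC *.
have iw : mu2.-integrable setT (EFin \o w) by exact: Lp1_integrable Wu.1.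
have w0 x : ~ Omega x -> w x = 0 by move=> h; rewrite /w patchE memNset.
have [_ cv] := @avg_convergesP R (0%N, 0%N) 0 w iw w0.
have C0 : 0 <= C.
  (* The single cell of level 0 provides an average that shows C to be nonnegative. *)
  pose k0 : 'I_(2 ^ 0) := @Ordinal 1 0 isT.
  by apply: le_trans (hC 0%N (k0, k0)).
pose h x := Num.max (`|w x| - C) 0.
have mO := @measurable_Omega R.
have ih : mu2.-integrable (@Omega R) (EFin \o h).
  apply: (@integrableR_le _ _ _ mu2 (@Omega R) h (fun x => `|w x|)) => //.
  - have /measurable_EFinP mw := measurable_int _ (integrable_Omega iw).
    apply: measurable_maxr; last exact: measurable_cst.
    by apply: measurable_funB; [exact: measurableT_comp|exact: measurable_cst].
  - move=> x _; rewrite ger0_norm ?le_max ?lexx ?orbT// ge_max normr_ge0 andbT.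
    by rewrite gerBl.
  - by apply: integrableR_norm => //; exact: integrable_Omega.
have hd n : \int[mu2]_(x in @Omega R) h x <= defect n (0%N, 0%N) 0 w.
  apply: le_Rintegral => //.
    by apply: integrableR_norm => //; exact: integrable_defect.
  move=> x [] /=; rewrite !in_itv/= => /(floor_unit n)[i1 e1] /(floor_unit n)[i2 e2].
  rewrite ge_max normr_ge0 andbT.
  have -> : cell n x + 0 = cell_idx (i1, i2) by rewrite addr0 /cell e1 e2.
  have := hC n (i1, i2); set y := avg _ _ _ _ => hy.
  have := ler_normD (w x - y) y; rewrite subrK distrC; lra.
have h0 : \int[mu2]_(x in @Omega R) h x = 0.
  apply/eqP; rewrite eq_le; apply/andP; split.
    by apply: (cvgr_to_ge cv); exact: nearW.
  by apply: Rintegral_ge0 => x _; rewrite le_max lexx orbT.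
exists C; have h0' x : Omega x -> 0 <= h x by move=> _; rewrite le_max lexx orbT.
have := Rintegral0_ae mO ih h0' h0; apply: filterS => x hx.
have [Ox|/w0->] := pselect (Omega x); last by rewrite normr0.
have := hx Ox; rewrite /h => /eqP e; rewrite -subr_le0 -(eqP e).
by rewrite le_max lexx.
Qed.

Lemma Lnorm2E w : ('N[mu2]_2%:E[EFin \o w] = (\int[mu2]_x ((w x) ^+ 2)%:E) `^ 2^-1)%E.
Proof.
rewrite unlock; congr (_ `^ _)%E; apply: eq_integral => x _ /=.
by rewrite powR_mulrn// real_normK// num_real.
Qed.

Lemma Lp2P u : Lp 2 (@Omega R) u <-> measurable_fun setT (u \_ (@Omega R)) /\
  mu2.-integrable setT (EFin \o (fun x => (u \_ (@Omega R)) x ^+ 2)).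
Proof.
split=> [Lu|[mw iw]].
  split; last exact: Lfun2_integrable_sqr Lu.
  by move: Lu; rewrite /Lp inE => /andP[]; rewrite inE.
rewrite /Lp inE; apply/andP; split; rewrite inE//= /finite_norm Lnorm2E.
have /integrable_fin_num fin := iw; rewrite -(fineK (fin measurableT)).
by rewrite poweR_EFin ltry.
Qed.

Lemma L2norm_sqr u : Lp 2 (@Omega R) u ->
  L2norm (@Omega R) u ^+ 2 = \int[mu2]_x ((u \_ (@Omega R)) x ^+ 2).
Proof.
move=> /Lp2P[_ iw]; rewrite /L2norm Lnorm2E.
have /integrable_fin_num fin := iw; rewrite -(fineK (fin measurableT)).
rewrite poweR_EFin /= -/(Rintegral _ _ _) -powR_mulrn ?powR_ge0// -powRrM.
by rewrite mulVf ?powRr1//; apply: Rintegral_ge0 => x _; exact: sqr_ge0.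
Qed.

Lemma Lp2_Lp1 u : Lp 2 (@Omega R) u -> mu2.-integrable setT (EFin \o (u \_ (@Omega R))).
Proof.
move=> /Lp2P[mw iw]; set w := u \_ _ in mw iw *.
pose o : R * R -> R := \1_(@Omega R).
have io : mu2.-integrable setT (EFin \o o).
  have := @integrable_indic_Omega R setT measurableT; rewrite setTI; exact.
apply: (@integrableR_le _ _ _ mu2 setT w (fun x => o x + w x ^+ 2)) => //.
  move=> x _; rewrite /o indicE /w patchE; case: ifP => _; last by rewrite normr0 expr0n addr0.
  rewrite -[u x ^+ 2]real_normK ?num_real//; set y := `|u x|.
  by have := sqr_ge0 (y - 1); rewrite /=; nra.
exact: integrableRD.
Qed.

Lemma W1_Lp2 u : W1 2 (@Omega R) u -> Lp 2 (@Omega R) u.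
Proof.
move=> Wu; have [C hC] := W1_ae_bounded Wu; apply/Lp2P; set w := u \_ _ in hC *.
have iw : mu2.-integrable setT (EFin \o w) by exact: Lp1_integrable Wu.1.
have /measurable_EFinP mw := measurable_int _ iw; split => //.
apply/integrableP; split; first by apply/measurable_EFinP; exact: measurable_funX.
have iCw := integrableRZ C measurableT (integrableR_norm measurableT iw).
case/integrableP: iCw => _; apply: le_lt_trans.
apply: ae_ge0_le_integral => //.
- by apply/measurableT_comp => //; apply/measurable_EFinP; exact: measurable_funX.
- apply/measurableT_comp => //; apply/measurable_EFinP; apply: measurable_funM => //.
  exact: measurableT_comp.
apply: filterS hC => x hx _ /=; rewrite lee_fin normrX normrM normr_id expr2 ler_wpM2r//.
exact: le_trans (ler_norm _).
Qed.

End BoundedSobolev.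

(** * Calculus of L_1 convergence on the square *)

Section L1Convergence.
Context {R : realType}.
Notation mu2 := (@leb2 R).
Notation intO F := (\int[mu2]_(y in @Omega R) F y).
Notation iO F := (mu2.-integrable (@Omega R) (EFin \o F)).
Implicit Types (X Z : nat -> R * R -> R) (x z : R * R -> R).

Definition L1cvg X x : Prop :=
  [/\ forall n, iO (X n), iO x & intO (fun y => `|X n y - x y|) @[n --> \oo] --> (0 : R)].

Lemma squeeze0 (a b : nat -> R) : (forall n, 0 <= a n <= b n) -> b n @[n --> \oo] --> (0 : R) ->
  a n @[n --> \oo] --> (0 : R).
Proof.
move=> ab cb; apply: (@squeeze_cvgr _ _ _ _ (fun=> 0) b) => //; last exact: cvg_cst.
exact: nearW.
Qed.

Lemma cvg0D (a b : nat -> R) : a n @[n --> \oo] --> (0 : R) -> b n @[n --> \oo] --> (0 : R) ->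
  a n + b n @[n --> \oo] --> (0 : R).
Proof. by move=> ca cb; rewrite -[X in _ --> X]addr0; exact: cvgD. Qed.

Lemma cvg0Z (c : R) (a : nat -> R) : a n @[n --> \oo] --> (0 : R) ->
  c * a n @[n --> \oo] --> (0 : R).
Proof. by move=> ca; rewrite -(mulr0 c); apply: cvgM => //; exact: cvg_cst. Qed.

(** The pattern of the truncation arguments below: the level k is fixed first to make t small, then
    n goes to infinity. *)
Lemma cvg0_double (a : nat -> R) (b : nat -> nat -> R) (t : nat -> R) :
  (forall n, 0 <= a n) -> (forall k n, a n <= b k n + t k) ->
  (forall k, b k n @[n --> \oo] --> (0 : R)) -> t k @[k --> \oo] --> (0 : R) ->
  a n @[n --> \oo] --> (0 : R).
Proof.
move=> a0 abt cb ct; apply/cvgrPdist_le => e e0.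
have e2 : 0 < e / 2 by lra.
have /cvgrPdist_le /(_ _ e2) [k _ hk] := ct.
have /cvgrPdist_le /(_ _ e2) := cb k; apply: filterS => n.
rewrite !sub0r !normrN (ger0_norm (a0 n)) => hb.
have := hk k (leqnn k); rewrite sub0r normrN => ht.
have := abt k n; have := ler_norm (b k n); have := ler_norm (t k); lra.
Qed.

Lemma iO_measurable x : iO x -> measurable_fun (@Omega R) x.
Proof. by move=> ix; have /measurable_EFinP := measurable_int _ ix. Qed.

Lemma iO_norm x : iO x -> iO (fun y => `|x y|).
Proof. by move=> ix; apply: integrableR_norm => //; exact: measurable_Omega. Qed.

Lemma iOB x z : iO x -> iO z -> iO (fun y => x y - z y).
Proof. by move=> ix iz; apply: integrableRB => //; exact: measurable_Omega. Qed.

Lemma iOD x z : iO x -> iO z -> iO (fun y => x y + z y).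
Proof. by move=> ix iz; apply: integrableRD => //; exact: measurable_Omega. Qed.

Lemma iOZ (c : R) x : iO x -> iO (fun y => c * x y).
Proof. by move=> ix; apply: integrableRZ => //; exact: measurable_Omega. Qed.

Lemma iO_le x z : measurable_fun (@Omega R) x -> iO z ->
  (forall y, Omega y -> `|x y| <= z y) -> iO x.
Proof.
move=> mx iz h; apply: (@integrableR_le _ _ _ mu2 _ x z) => //; exact: measurable_Omega.
Qed.

Lemma intOD x z : iO x -> iO z -> intO (fun y => x y + z y) = intO x + intO z.
Proof. by move=> ix iz; rewrite RintegralD//; exact: measurable_Omega. Qed.

Lemma intOZ (c : R) x : iO x -> intO (fun y => c * x y) = c * intO x.
Proof. by move=> ix; rewrite RintegralZl//; exact: measurable_Omega. Qed.

Lemma intO_le x z : iO x -> iO z -> (forall y, Omega y -> x y <= z y) -> intO x <= intO z.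
Proof. by move=> ix iz h; apply: le_Rintegral => //; exact: measurable_Omega. Qed.

Lemma intO_ge0 x : (forall y, Omega y -> 0 <= x y) -> 0 <= intO x.
Proof. by move=> h; apply: Rintegral_ge0. Qed.

Lemma intO0 : intO (fun=> 0) = 0.
Proof. by rewrite Rintegral_cst ?mul0r//; exact: measurable_Omega. Qed.

Lemma L1cvg_le X x Z : (forall n, iO (X n)) -> iO x -> (forall n, iO (Z n)) ->
  (forall n y, Omega y -> `|X n y - x y| <= Z n y) -> intO (Z n) @[n --> \oo] --> (0 : R) ->
  L1cvg X x.
Proof.
move=> iX ix iZ h cZ; split => //; apply: squeeze0 cZ => n; apply/andP; split.
  exact: intO_ge0.
by apply: intO_le => //; [apply/iO_norm/iOB|exact: h].
Qed.

Lemma L1cvg_lim X x : L1cvg X x -> intO (X n) @[n --> \oo] --> intO x.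
Proof.
move=> [iX ix cX]; apply/cvgrPdist_lt => e e0.
have /cvgrPdist_lt /(_ _ e0) := cX; apply: filterS => n.
rewrite sub0r normrN ger0_norm ?intO_ge0// distrC; apply: le_lt_trans.
have -> : intO (X n) - intO x = intO (fun y => X n y - x y).
  by rewrite RintegralB//; exact: measurable_Omega.
by apply: le_normr_Rintegral => //; [exact: measurable_Omega|exact: iOB].
Qed.

Lemma L1cvgD X x Z z : L1cvg X x -> L1cvg Z z ->
  L1cvg (fun n y => X n y + Z n y) (fun y => x y + z y).
Proof.
move=> [iX ix cX] [iZ iz cZ].
apply: (@L1cvg_le _ _ (fun n y => `|X n y - x y| + `|Z n y - z y|)).
- by move=> n; exact: iOD.
- exact: iOD.
- by move=> n; apply: iOD; apply/iO_norm/iOB.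
- by move=> n y _; rewrite opprD addrACA ler_normD.
- under eq_fun do (rewrite intOD; [|exact/iO_norm/iOB|exact/iO_norm/iOB]).
  exact: cvg0D.
Qed.

Lemma L1cvgZ X x (c : R) : L1cvg X x -> L1cvg (fun n y => c * X n y) (fun y => c * x y).
Proof.
move=> [iX ix cX]; apply: (@L1cvg_le _ _ (fun n y => `|c| * `|X n y - x y|)).
- by move=> n; exact: iOZ.
- exact: iOZ.
- by move=> n; apply/iOZ/iO_norm/iOB.
- by move=> n y _; rewrite -mulrBr normrM.
- under eq_fun do (rewrite intOZ; [|exact/iO_norm/iOB]).
  exact: cvg0Z.
Qed.

Lemma iO_cst (c : R) : iO (fun=> c).
Proof.
apply: (@integrableR_bound _ _ _ mu2 _ _ `|c|) => //; first exact: measurable_Omega.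
by have := ltry (1 : R); rewrite -[1%:E](@leb2_Omega R).
Qed.

Lemma L1cvg_sum (I : Type) (s : seq I) (X : I -> nat -> R * R -> R) (x : I -> R * R -> R) :
  (forall i, L1cvg (X i) (x i)) ->
  L1cvg (fun n y => \sum_(i <- s) X i n y) (fun y => \sum_(i <- s) x i y).
Proof.
move=> h; elim: s => [|i s IH].
  rewrite (_ : (fun n y => _) = (fun _ _ => 0)); last by do 2 apply/funext => ?; rewrite big_nil.
  rewrite (_ : (fun y => _) = (fun _ => 0)); last by apply/funext => ?; rewrite big_nil.
  apply: (@L1cvg_le _ _ (fun _ _ => 0)); try by move=> *; exact: iO_cst.
    by move=> *; rewrite subrr normr0.
  by rewrite intO0; exact: cvg_cst.
rewrite (_ : (fun n y => _) = (fun n y => X i n y + \sum_(i <- s) X i n y)); last first.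
  by do 2 apply/funext => ?; rewrite big_cons.
rewrite (_ : (fun y => _) = (fun y => x i y + \sum_(i <- s) x i y)); last first.
  by apply/funext => ?; rewrite big_cons.
exact: L1cvgD.
Qed.

Lemma L1cvg_norm X x : L1cvg X x -> L1cvg (fun n y => `|X n y|) (fun y => `|x y|).
Proof.
move=> [iX ix cX]; apply: (L1cvg_le _ _ _ _ cX).
- by move=> n; exact: iO_norm.
- exact: iO_norm.
- by move=> n; apply/iO_norm/iOB.
- by move=> n y _; exact: ler_dist_dist.
Qed.

Lemma L1cvg0_scale X (c : nat -> R) (C : R) : (\forall n \near \oo, `|c n| <= C) ->
  L1cvg X (fun=> 0) -> L1cvg (fun n y => c n * X n y) (fun=> 0).
Proof.
move=> cC [iX i0 cX]; split; [by move=> n; exact: iOZ|by []|].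
under eq_fun => n do under eq_Rintegral do rewrite subr0 normrM.
under eq_fun do (rewrite intOZ; [|exact/iO_norm]).
move: cX; under eq_fun => n do under eq_Rintegral do rewrite subr0.
move=> cX; apply: (@squeeze_cvgr _ _ _ _ (fun=> 0) (fun n => C * intO (fun y => `|X n y|))).
- apply: filterS cC => n h; apply/andP; split; first by rewrite mulr_ge0// intO_ge0.
  by rewrite ler_wpM2r// intO_ge0.
- exact: cvg_cst.
- exact: cvg0Z.
Qed.

(** The part of x that is cut off is dominated by |x| and eventually 0 at every point. Applied to
    the cells of the interior grids, which exhaust the square. *)
Lemma L1cvg_mask X x (K : nat -> R * R -> bool) :
  (forall n, measurable_fun (@Omega R) (fun y => (K n y)%:R : R)) ->
  (forall y, Omega y -> \forall n \near \oo, K n y) -> L1cvg X x ->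
  L1cvg (fun n y => (K n y)%:R * X n y) x.
Proof.
move=> mK hK [iX ix cX]; have mO := @measurable_Omega R.
have iK n z : iO z -> iO (fun y => (K n y)%:R * z y).
  move=> iz; apply: (iO_le _ (iO_norm iz)); first by apply: measurable_funM => //; exact: iO_measurable.
  by move=> y _; case: (K n y); rewrite ?mul1r ?mul0r ?normr0.
apply: (@L1cvg_le _ _ (fun n y => `|X n y - x y| + `|x y - (K n y)%:R * x y|)) => //.
- by move=> n; exact: iK.
- by move=> n; apply: iOD; apply/iO_norm/iOB => //; exact: iK.
- move=> n y _; case: (K n y); rewrite ?mul1r ?mul0r; first by rewrite subrr normr0 addr0.
  by rewrite subr0 sub0r normrN lerDr.
under eq_fun => n do (rewrite intOD; [|exact/iO_norm/iOB|by apply/iO_norm/iOB => //; exact: iK]).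
apply: cvg0D => //.
rewrite -[X in _ --> X]intO0.
apply: (@Rdominated_cvg _ _ _ mu2 _ (fun n y => `|x y - (K n y)%:R * x y|) _ (fun y => `|x y|)) => //.
- by move=> n; apply: iO_measurable; apply/iO_norm/iOB => //; exact: iK.
- apply: aeW => y Oy; apply: cvg_near_cst; apply: filterS (hK y Oy) => n ->.
  by rewrite mul1r subrr normr0.
- exact: iO_norm.
- move=> n y _; rewrite normr_id; case: (K n y); rewrite ?mul1r ?mul0r ?subr0//.
  by rewrite subrr normr0.
Qed.

Lemma sqrt_sum_dist (I : finType) (a b : I -> R) :
  `|Num.sqrt (\sum_i a i ^+ 2) - Num.sqrt (\sum_i b i ^+ 2)| <= \sum_i `|a i - b i|.
Proof.
(* A triangle inequality with the l^1 norm D of d on the right: the squares are compared termwise,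
   using |c i| <= A and |d i| <= D. It is then applied in both directions. *)
have tri (c d : I -> R) : Num.sqrt (\sum_i (c i + d i) ^+ 2) <=
    Num.sqrt (\sum_i c i ^+ 2) + \sum_i `|d i|.
  set A := Num.sqrt (\sum_i c i ^+ 2); set D := \sum_i `|d i|.
  have A0 : 0 <= A by exact: sqrtr_ge0.
  have D0 : 0 <= D by apply: sumr_ge0.
  have AD0 : 0 <= A + D by exact: addr_ge0.
  rewrite -[leRHS]ger0_norm// -sqrtr_sqr; apply: ler_wsqrtr.
  have cA i : `|c i| <= A.
    rewrite -sqrtr_sqr; apply: ler_wsqrtr; rewrite (bigD1 i)//= lerDl.
    by apply: sumr_ge0 => j _; exact: sqr_ge0.
  have dD i : `|d i| <= D by rewrite /D (bigD1 i)//= lerDl sumr_ge0.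
  have AA : A ^+ 2 = \sum_i c i ^+ 2.
    by rewrite sqr_sqrtr// sumr_ge0// => i _; exact: sqr_ge0.
  apply: (@le_trans _ _ (\sum_i (c i ^+ 2 + 2 * A * `|d i| + D * `|d i|))).
    apply: ler_sum => i _; rewrite sqrrD.
    have h1 : c i * d i <= A * `|d i|.
      by apply: le_trans (ler_norm _) _; rewrite normrM ler_wpM2r.
    have h2 : d i ^+ 2 <= D * `|d i|.
      by rewrite -[d i ^+ 2]ger0_norm ?sqr_ge0// normrX expr2 ler_wpM2r.
    by rewrite mulr2n; lra.
  rewrite !big_split/= -AA -!mulr_sumr -/D; nra.
rewrite ler_norml; apply/andP; split.
  rewrite lerBrDr -lerBrDl opprK addrC.
  have := tri a (fun i => b i - a i).
  rewrite (eq_bigr (fun i => b i ^+ 2)); last by move=> i _; rewrite addrC subrK.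
  by under [X in _ <= _ + X]eq_bigr do rewrite distrC; rewrite addrC.
have := tri b (fun i => a i - b i).
rewrite (eq_bigr (fun i => a i ^+ 2)); last by move=> i _; rewrite addrC subrK.
by rewrite lerBlDl.
Qed.

Lemma measurable_sqrt_sum (I : finType) (x : I -> R * R -> R) :
  (forall i, iO (x i)) -> measurable_fun (@Omega R) (fun y => Num.sqrt (\sum_i x i y ^+ 2)).
Proof.
move=> ix; apply: measurableT_comp; first exact: (continuous_measurable_fun (@sqrt_continuous R)).
by apply: measurable_sum => i; apply: measurable_funX; exact: iO_measurable.
Qed.

Lemma iO_sqrt_sum (I : finType) (x : I -> R * R -> R) :
  (forall i, iO (x i)) -> iO (fun y => Num.sqrt (\sum_i x i y ^+ 2)).
Proof.
move=> ix; apply: (@iO_le _ (fun y => \sum_i `|x i y|)).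
- exact: measurable_sqrt_sum.
- by apply: integrableR_sum; [exact: measurable_Omega|move=> i; exact: iO_norm].
- move=> y _; have := sqrt_sum_dist (fun i => x i y) (fun=> 0).
  rewrite [\sum_i 0 ^+ 2]big1; last by move=> i _; rewrite expr0n.
  by rewrite sqrtr0 subr0; under [X in _ <= X]eq_bigr do rewrite subr0.
Qed.

Lemma L1cvg_sqrt_sum (I : finType) (X : I -> nat -> R * R -> R) (x : I -> R * R -> R) :
  (forall i, L1cvg (X i) (x i)) ->
  L1cvg (fun n y => Num.sqrt (\sum_i X i n y ^+ 2)) (fun y => Num.sqrt (\sum_i x i y ^+ 2)).
Proof.
move=> h; apply: (@L1cvg_le _ _ (fun n y => \sum_i `|X i n y - x i y|)).
- by move=> n; apply: iO_sqrt_sum => i; case: (h i).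
- by apply: iO_sqrt_sum => i; case: (h i).
- move=> n; apply: integrableR_sum; first exact: measurable_Omega.
  by move=> i; apply/iO_norm/iOB; case: (h i).
- by move=> n y _; exact: sqrt_sum_dist.
under eq_fun do (rewrite Rintegral_sum;
  [|exact: measurable_Omega|by move=> i; apply/iO_norm/iOB; case: (h i)]).
have h' i : intO (fun y => `|X i n y - x i y|) @[n --> \oo] --> (0 : R) by case: (h i).
elim: (index_enum I) => [|i s IH].
  by under eq_fun do rewrite big_nil; exact: cvg_cst.
by under eq_fun do rewrite big_cons; exact: cvg0D.
Qed.

Lemma iO_tail x (c : R) : iO x -> iO (fun y => Num.max (`|x y| - c) 0).
Proof.
move=> ix; have h : iO (fun y => `|x y| + `|c|) by apply: iOD; [exact: iO_norm|exact: iO_cst].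
apply: iO_le h _.
  apply: measurable_maxr; last exact: measurable_cst.
  by apply: measurable_funB; [apply: iO_measurable; exact: iO_norm|exact: measurable_cst].
move=> y _; rewrite ger0_norm ?le_max ?lexx ?orbT// ge_max addr_ge0// andbT.
by rewrite lerD2l -normrN ler_norm.
Qed.

Lemma tail_cvg x : iO x -> intO (fun y => Num.max (`|x y| - k%:R) 0) @[k --> \oo] --> (0 : R).
Proof.
move=> ix; have mO := @measurable_Omega R.
rewrite -[X in _ --> X]intO0.
apply: (@Rdominated_cvg _ _ _ mu2 _ (fun k y => Num.max (`|x y| - k%:R) 0) _ (fun y => `|x y|)) => //.
- by move=> k; apply: iO_measurable; exact: iO_tail.
- apply: aeW => y Oy; apply: cvg_near_cst.
  near=> k; apply/max_idPr; rewrite subr_le0; apply: ltW; near: k.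
  exact: nbhs_infty_gtr.
- exact: iO_norm.
- move=> k y _; rewrite ger0_norm ?le_max ?lexx ?orbT// ge_max normr_ge0 andbT.
  by rewrite gerBl.
Unshelve. all: by end_near.
Qed.

Lemma L1cvg_mul X x Z z : (forall n y, Omega y -> `|Z n y| <= 1) ->
  (forall y, Omega y -> `|z y| <= 1) -> L1cvg Z z -> L1cvg X x ->
  L1cvg (fun n y => Z n y * X n y) (fun y => z y * x y).
Proof.
move=> bZ bz [iZ iz cZ] [iX ix cX].
have iM z' x' : iO z' -> (forall y, Omega y -> `|z' y| <= 1) -> iO x' -> iO (fun y => z' y * x' y).
  move=> iz' bz' ix'; apply: iO_le (iO_norm ix') _.
    by apply: measurable_funM; exact: iO_measurable.
  by move=> y Oy; rewrite normrM -[leRHS]mul1r ler_wpM2r// bz'.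
split; [by move=> n; exact: iM (bZ n) (iX n)|exact: iM|].
(* Z X - z x = Z (X - x) + (Z - z) x, and in the last term |x| is at most k plus its excess over k,
   the latter multiplied by |Z - z| <= 2. *)
apply: (@cvg0_double _ (fun k n => intO (fun y => `|X n y - x y|) + k%:R * intO (fun y => `|Z n y - z y|))
  (fun k => 2 * intO (fun y => Num.max (`|x y| - k%:R) 0))).
- by move=> n; exact: intO_ge0.
- move=> k n; rewrite -intOZ; last by apply/iO_norm/iOB.
  rewrite -intOZ; last exact: iO_tail.
  have i1 := iO_norm (iOB (iX n) ix); have i2 := iOZ k%:R (iO_norm (iOB (iZ n) iz)).
  have i3 := iOZ 2 (iO_tail k%:R ix).
  rewrite -(intOD i1 i2) -(intOD (iOD i1 i2) i3); apply: intO_le.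
  + by apply/iO_norm/iOB; [exact: iM (bZ n) (iX n)|exact: iM].
  + by apply: iOD => //; exact: iOD.
  move=> y Oy.
  have -> : Z n y * X n y - z y * x y = Z n y * (X n y - x y) + (Z n y - z y) * x y by ring.
  apply: (le_trans (ler_normD _ _)); rewrite -addrA lerD//.
    by rewrite normrM -[leRHS]mul1r ler_wpM2r// bZ.
  rewrite normrM; have h2 : `|Z n y - z y| <= 2.
    by apply: (le_trans (ler_normB _ _)); rewrite -[2]/(1 + 1) lerD ?bZ ?bz.
  have := normr_ge0 (Z n y - z y); set A := `|_ - _| in h2 * => A0.
  have m1 : `|x y| - k%:R <= Num.max (`|x y| - k%:R) 0 by rewrite le_max lexx.
  have m0 : 0 <= Num.max (`|x y| - k%:R) 0 by rewrite le_max lexx orbT.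
  set B := Num.max _ _ in m1 m0 *; nra.
- move=> k; by apply: cvg0D => //; exact: cvg0Z.
- exact/cvg0Z/tail_cvg.
Qed.

(** If a^2 is the larger square, a^2 - b^2 <= Z - b^2. Otherwise the part of b^2 - a^2 below the
    level |b| = c is at most 2 c |a - b|, and the part above it is at most b^2 - c^2 <= b^2 - c <=
    B. *)
Lemma sqr_dist_trunc (a b Z c B : R) : 0 <= c -> c <= c ^+ 2 -> a ^+ 2 <= Z -> b ^+ 2 - c <= B ->
  0 <= B -> `|a ^+ 2 - b ^+ 2| <= 2 * c * `|a - b| + `|Z - b ^+ 2| + 2 * B.
Proof.
move=> c0 cc aZ bB B0; have D0 := normr_ge0 (a - b); have E0 := normr_ge0 (Z - b ^+ 2).
have cD0 : 0 <= c * `|a - b| by rewrite mulr_ge0.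
have [ab|ab] := leP (b ^+ 2) (a ^+ 2).
  rewrite ger0_norm ?subr_ge0//; have := ler_norm (Z - b ^+ 2); lra.
rewrite ltr0_norm ?subr_lt0// opprB.
have ha : a ^+ 2 = `|a| ^+ 2 by rewrite real_normK// num_real.
have hb : b ^+ 2 = `|b| ^+ 2 by rewrite real_normK// num_real.
have p0 := normr_ge0 a; have q0 := normr_ge0 b.
have pq : `|b| - `|a| <= `|a - b| by rewrite distrC lerB_dist.
rewrite ha hb in ab bB aZ E0 *; set E := `|Z - _| in E0 *; set D := `|a - b| in D0 cD0 pq *.
set p := `|a| in p0 pq ab aZ *; set q := `|b| in q0 pq ab bB *.
have plq : p < q by rewrite -(ltr_pXn2r (n := 2)).
have [qc|qc] := leP q c.
  have : q ^+ 2 - p ^+ 2 <= 2 * c * D by rewrite subr_sqr; nra.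
  lra.
have [pc|pc] := leP c p.
  have : c ^+ 2 <= p ^+ 2 by rewrite ler_pXn2r.
  lra.
have : c ^+ 2 - p ^+ 2 <= 2 * c * D by rewrite subr_sqr; nra.
lra.
Qed.

(* Truncating the squares at level [k^2] makes them [2k]-Lipschitz functions of [X n]; the
   truncated part is controlled by [Z n], hence by the tail of [x ^ 2]. *)
Lemma L1cvg_sqr X x Z : (forall n y, Omega y -> X n y ^+ 2 <= Z n y) ->
  L1cvg X x -> L1cvg Z (fun y => x y ^+ 2) ->
  L1cvg (fun n y => X n y ^+ 2) (fun y => x y ^+ 2).
Proof.
move=> XZ [iX ix cX] [iZ ix2 cZ].
have iX2 n : iO (fun y => X n y ^+ 2).
  apply: iO_le (iZ n) _; first by apply: measurable_funX; exact: iO_measurable.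
  by move=> y Oy; rewrite ger0_norm ?sqr_ge0// XZ.
split => //.
apply: (@cvg0_double _ (fun k n => (2 * k%:R) * intO (fun y => `|X n y - x y|) + intO (fun y => `|Z n y - x y ^+ 2|))
  (fun k => 2 * intO (fun y => Num.max (`|x y ^+ 2| - k%:R) 0))).
- by move=> n; exact: intO_ge0.
- move=> k n; rewrite -intOZ; last by apply/iO_norm/iOB.
  rewrite -intOZ; last exact: iO_tail.
  have i1 := iOZ (2 * k%:R) (iO_norm (iOB (iX n) ix)); have i2 := iO_norm (iOB (iZ n) ix2).
  have i3 := iOZ 2 (iO_tail k%:R ix2).
  rewrite -(intOD i1 i2) -(intOD (iOD i1 i2) i3); apply: intO_le.
  + by apply/iO_norm/iOB.
  + by apply: iOD => //; exact: iOD.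
  move=> y Oy; have := XZ n y Oy.
  rewrite (ger0_norm (sqr_ge0 (x y))).
  have m1 : x y ^+ 2 - k%:R <= Num.max (x y ^+ 2 - k%:R) 0 by rewrite le_max lexx.
  have m0 : 0 <= Num.max (x y ^+ 2 - k%:R) 0 by rewrite le_max lexx orbT.
  have kk : k%:R <= k%:R ^+ 2 :> R by rewrite -natrX ler_nat; case: (k) => // l; exact: leq_pmulr.
  by move=> aZ; exact: sqr_dist_trunc.
- move=> k; by apply: cvg0D => //; exact: cvg0Z.
- exact/cvg0Z/tail_cvg.
Qed.

End L1Convergence.

(** * The grids M_n and K_n as rectangles of indices *)

Section Grids.
Context {R : realType}.
Notation mu2 := (@leb2 R).
Notation intO F := (\int[mu2]_(y in @Omega R) F y).

Lemma closure_Omega : closure (@Omega R) = `[0, 1] `*` `[0, 1].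
Proof.
apply/seteqP; split.
  rewrite (_ : _ `*` _ = closure (`[(0 : R), 1] `*` `[(0 : R), 1])).
    apply: closure_subset => -[x y] [] /=; rewrite !in_itv/= => /andP[/ltW x0 /ltW x1] /andP[/ltW y0 /ltW y1].
    by rewrite x0 x1 y0 y1.
  exact/closure_id/closed_rect.
move=> [x y] [] /=; rewrite !in_itv/= => /andP[x0 x1] /andP[y0 y1] B nB.
(* The segment from the given point to the centre of the square; it is in the open square for 0 < t
   < 1. *)
pose g (t : R) : R * R := (x + t * (2^-1 - x), y + t * (2^-1 - y)).
have cg : g t @[t --> 0^'+] --> (x, y).
  have c1 (z : R) : z + t * (2^-1 - z) @[t --> 0^'+] --> z.
    rewrite -[X in _ --> X]addr0; apply: cvgD; first exact: cvg_cst.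
    rewrite -[X in _ --> X](mul0r (2^-1 - z)); apply: cvgM; last exact: cvg_cst.
    by apply: cvg_at_right_filter; exact: cvg_id.
  exact: (cvg_pair (c1 x) (c1 y)).
have hB : \forall t \near (0 : R)^'+, B (g t) by exact: cg.
have [t [[t0 t1] Bt]] : exists t : R, (0 < t /\ t < 1) /\ B (g t).
  near (0 : R)^'+ => t; exists t; split; first split.
  - by near: t; exact: nbhs_right_gt.
  - by near: t; exact: nbhs_right_lt.
  - by near: t.
exists (g t); split => //; split; rewrite /= in_itv/=; apply/andP; split; nra.
Unshelve. all: by end_near.
Qed.

Definition grid_range (a b n : nat) (z : int * int) : bool :=
  [&& a%:Z <= z.1, z.1 + b%:Z <= (2 ^ n)%N%:Z, a%:Z <= z.2 & z.2 + b%:Z <= (2 ^ n)%N%:Z].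

Lemma phi_nk_neq0 m n (k : int * int) (x : R * R) : (0 < m)%N ->
  0 < 2 ^+ n * x.1 - k.1%:~R + (m./2)%:R < m%:R ->
  0 < 2 ^+ n * x.2 - k.2%:~R + (m./2)%:R < m%:R -> phi_nk m n k x != 0.
Proof.
move=> m0 h1 h2; rewrite /phi_nk /phi !cardinal_bspline_unit /= !mulf_neq0 ?expf_neq0//.
  by rewrite gt_eqF// spl_gt0// prednK.
by rewrite gt_eqF// spl_gt0// prednK.
Qed.

Lemma phi_nk_supp m n (k : int * int) (x : R * R) : (0 < m)%N -> phi_nk m n k x != 0 ->
  0 <= 2 ^+ n * x.1 - k.1%:~R + (m./2)%:R <= m%:R /\
  0 <= 2 ^+ n * x.2 - k.2%:~R + (m./2)%:R <= m%:R.
Proof.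
move=> m0; rewrite /phi_nk /phi !cardinal_bspline_unit /= !mulf_eq0 !negb_or => /and3P[_].
by move=> /B_supp; rewrite prednK// => -> /B_supp; rewrite prednK.
Qed.

Lemma le_intR (a b : int) : a%:~R < b%:~R + 1 :> R -> a <= b.
Proof. by rewrite -[1]/(1%:~R) -intrD ltr_int ltzD1. Qed.

Lemma half_le m : (m./2 <= m)%N. Proof. lia. Qed.

(** The support of the dilated spline is the square of m meshes from z - m./2 to z + m - m./2, and
    the spline does not vanish inside it. *)
Lemma in_MsetE m n (z : int * int) : (0 < m)%N ->
  (z \in Mset R m n) = grid_range m./2 (m - m./2) n z.
Proof.
move=> m0; have p0 : 0 < 2 ^+ n :> R by rewrite exprn_gt0.
have m1 : 1 <= m%:R :> R by rewrite ler1n.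
have mE : m%:R = (m./2)%:R + (m - m./2)%N%:R :> R by rewrite -natrD subnKC// half_le.
apply/idP/idP => [/(in_Mset R m n z)[_ hs]|/and4P[a1 b1 a2 b2]].
  have box (t : R) : 0 < t < m%:R -> forall i, i \in [:: z.1; z.2] ->
      0 <= (t + i%:~R - (m./2)%:R) / 2 ^+ n <= 1.
    move=> t0; have : closure (@Omega R) ((t + z.1%:~R - (m./2)%:R) / 2 ^+ n, (t + z.2%:~R - (m./2)%:R) / 2 ^+ n).
      apply: hs; apply: subset_closure; apply: phi_nk_neq0 => //=.
        by rewrite mulrC divfK ?gt_eqF//; case/andP: t0 => *; apply/andP; split; lra.
      by rewrite mulrC divfK ?gt_eqF//; case/andP: t0 => *; apply/andP; split; lra.
    rewrite closure_Omega => -[/=]; rewrite !in_itv/= => h1 h2 i.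
    by rewrite !inE => /orP[/eqP->|/eqP->].
  (* The inclusion is tested at points half a mesh away from the ends of the support, where the
     spline is nonzero. As i is an integer, the half is rounded away. *)
  have key i : i \in [:: z.1; z.2] -> (m./2)%:Z <= i /\ i + (m - m./2)%N%:Z <= (2 ^ n)%N%:Z.
    move=> hi; split; apply: le_intR.
      have /box /(_ i hi) : (0 < (2^-1 : R) < m%:R) by apply/andP; split; lra.
      by rewrite pmulr_lge0 ?invr_gt0// => /andP[h _]; move: h; rewrite -pmulrn; lra.
    have /box /(_ i hi) : (0 < (m%:R - 2^-1 : R) < m%:R) by apply/andP; split; lra.
    rewrite ler_pdivrMr// mul1r => /andP[_ h]; rewrite intrD -!pmulrn natrX.
    by move: h mE; lra.
  have [h1 h2] := key z.1 (mem_head _ _); have [h3 h4] := key z.2 (mem_last _ [:: _]).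
  by rewrite /grid_range h1 h2 h3 h4.
have cvt (i : int) : (m./2)%:Z <= i -> i + (m - m./2)%N%:Z <= (2 ^ n)%N%:Z ->
   (m./2)%:R <= i%:~R :> R /\ i%:~R + (m - m./2)%N%:R <= 2 ^+ n :> R.
  by rewrite -!(ler_int R) intrD -!pmulrn natrX.
have [{}a1 {}b1] := cvt _ a1 b1; have [{}a2 {}b2] := cvt _ a2 b2.
have s0 : 0 <= (m./2)%:R :> R by []; have t0 : 0 <= (m - m./2)%N%:R :> R by [].
apply/(in_Mset R m n z); split.
  rewrite /Oset /= closure_Omega; split; rewrite /= in_itv/= mulrC; apply/andP; split.
  - by rewrite divr_ge0 ?(ltW p0)//; lra.
  - by rewrite ler_pdivrMr// mul1r; lra.
  - by rewrite divr_ge0 ?(ltW p0)//; lra.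
  - by rewrite ler_pdivrMr// mul1r; lra.
have hsub : [set x : R * R | phi_nk m n z x != 0] `<=` closure (@Omega R).
  move=> x /(phi_nk_supp m0)[/andP[c1 d1] /andP[c2 d2]]; rewrite closure_Omega.
  split; rewrite /= in_itv/=; apply/andP; split.
  - by rewrite -(pmulr_rge0 _ p0); lra.
  - by rewrite -(ler_pM2l p0); lra.
  - by rewrite -(pmulr_rge0 _ p0); lra.
  - by rewrite -(ler_pM2l p0); lra.
have := closure_subset hsub; rewrite -[X in _ `<=` X](closure_id _).1//; exact: closed_closure.
Qed.

(** The margins a and b are at least those of [Mset], so the sum meets every index of the rectangle;
    each index stands for the cell of which it is the lower left corner. *)
Lemma grid_sum m n (a b : nat) (F : int * int -> R) : (0 < m)%N ->
  (m./2 <= a)%N -> (m - m./2 <= b)%N ->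
  (2 ^- n) ^+ 2 * (\sum_(k : Mset R m n | grid_range a b n (val k)) F (val k)) =
  intO (fun y => (grid_range a b n (cell n y))%:R * F (cell n y)).
Proof.
move=> m0 ma mb; rewrite (integral_step n (fun z => (grid_range a b n z)%:R * F z)).
rewrite (_ : (2 ^- n) ^+ 2 = 4 ^- n :> R); last first.
  by rewrite expr2 -invfM -exprMn; congr (_ ^+ _)^-1; ring.
congr (_ * _).
(* Here b >= 1 because m > 0, which excludes the indices equal to 2^n. *)
have range_cell z : grid_range a b n z -> exists p : 'I_(2 ^ n) * 'I_(2 ^ n), cell_idx p = z.
  case: z => [] [z1|z1] [z2|z2] /and4P[/= h1 h2 h3 h4]; try lia.
  have l1 : (z1 < 2 ^ n)%N by lia.
  have l2 : (z2 < 2 ^ n)%N by lia.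
  by exists (Ordinal l1, Ordinal l2).
have cinj : injective (@cell_idx n).
  by move=> [p1 p2] [q1 q2] [/ord_inj-> /ord_inj->].
transitivity (\sum_(k : Mset R m n | grid_range a b n (val k))
    \sum_(p : 'I_(2 ^ n) * 'I_(2 ^ n)) (val k == cell_idx p)%:R * F (cell_idx p)).
  apply: eq_bigr => k /range_cell[p pk]; rewrite (bigD1 p)//= pk eqxx mul1r big1 ?addr0// => i ip.
  by rewrite -pk (inj_eq cinj) eq_sym (negPf ip) mul0r.
rewrite exchange_big/=; apply: eq_bigr => p _; rewrite -mulr_suml; congr (_ * _).
have [hr|hr] := boolP (grid_range a b n (cell_idx p)); last first.
  by rewrite big1// => k hk; case: eqP => // e; move: hk; rewrite e (negPf hr).
have pM : cell_idx p \in Mset R m n.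
  by rewrite in_MsetE//; case/and4P: hr => *; apply/and4P; split; lia.
rewrite (bigD1 (FSetSub pM))//= eqxx big1 ?addr0// => k /andP[_ kp].
by case: eqP => // e; case/eqP: kp; apply: val_inj.
Qed.

Lemma cell_range_near a b (y : R * R) : Omega y ->
  \forall n \near \oo, grid_range a b n (cell n y).
Proof.
have key (t : R) : 0 < t < 1 -> \forall n \near \oo,
    a%:Z <= Num.floor (2 ^+ n * t) /\ Num.floor (2 ^+ n * t) + b%:Z <= (2 ^ n)%N%:Z.
  move=> /andP[t0 t1]; near=> n.
  have h : (Num.max (a%:R / t) (b%:R / (1 - t))) <= 2 ^+ n :> R.
    apply: (@le_trans _ _ n%:R); first by near: n; exact: nbhs_infty_ger.
    by rewrite -natrX ler_nat ltnW// ltn_expl.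
  move: h; rewrite ge_max ler_pdivrMr// ler_pdivrMr ?subr_gt0// => /andP[h1 h2]; split.
    by apply: le_intR; rewrite -pmulrn; have /andP[_] := floor_itv (2 ^+ n * t); rewrite intrD; lra.
  rewrite -(ler_int R) intrD -!pmulrn natrX.
  by have /andP[+ _] := floor_itv (2 ^+ n * t); lra.
move=> [/=]; rewrite !in_itv/= => /key h1 /key h2; near=> n; rewrite /grid_range /cell /=.
have [-> ->] : a%:Z <= Num.floor (2 ^+ n * y.1) /\ Num.floor (2 ^+ n * y.1) + b%:Z <= (2 ^ n)%N%:Z by near: n.
have [-> ->] // : a%:Z <= Num.floor (2 ^+ n * y.2) /\ Num.floor (2 ^+ n * y.2) + b%:Z <= (2 ^ n)%N%:Z by near: n.
Unshelve. all: by end_near.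
Qed.

End Grids.

(** * Framelet coefficients as combinations of averages *)

Section Operators.
Context {R : realType}.
Notation mu2 := (@leb2 R).
Notation ind := (\1_`[0, 1[ : R -> R).
Implicit Types (P Q : {poly R}) (w : R * R -> R) (z : int * int).

Definition pshift (i j : nat) : int * int := (i%:Z, j%:Z).

Definition mavg N P Q n d w z : R :=
  \sum_(p : 'I_N * 'I_N) P`_p.1 * Q`_p.2 * avg n d w (z + pshift p.1 p.2).

Lemma mavg_integral N P Q n (d : nat * nat) w z : mu2.-integrable setT (EFin \o w) ->
  mavg N P Q n d w z =
  4 ^+ n * \int[mu2]_x (w x * pstens N ind P Q d.1 d.2 (2 ^+ n) (- z.1%:~R) (- z.2%:~R) x).
Proof.
move=> iw; rewrite -RintegralZl//; last first.
  apply: (@integrableRM_bound _ _ _ mu2 _ _ _ ((\sum_(i < N) `|P`_i|) * (\sum_(i < N) `|Q`_i|))) => //.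
    by apply: measurable_pstens; exact: unit_fun_indic.
  by move=> x _; apply: pstens_bound; exact: unit_fun_indic.
rewrite /mavg; under eq_bigr do rewrite -(RintegralZl _ measurableT (integrable_avg _ _ _ iw)).
rewrite -(@Rintegral_sum _ _ R mu2 setT _ _ _
  (fun p : 'I_N * 'I_N => fun x => P`_p.1 * Q`_p.2 * (w x * kern n d (z + pshift p.1 p.2) x)))//; last first.
  by move=> p; apply: integrableRZ => //; exact: integrable_avg.
apply: eq_Rintegral => x _; rewrite /pstens /tens /pspl.
rewrite [X in _ * (_ * X)]big_distrlr/= pair_big/= mulrCA !mulr_sumr; apply: eq_bigr => -[i j] _ /=.
rewrite /kern /=; rewrite !intrD -!pmulrn.
have e (u v c : R) : u - (v + c) = u - v - c by rewrite opprD addrA.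
by rewrite !e; ring.
Qed.

(** The combination is supported in the square of 2 m meshes with lower left corner z: at most m + 1
    - be coefficients, and splines of degree m - 1 + be in each variable. The range condition on z
    puts this square into the closed unit square. *)
Lemma mavg_derivative (m n : nat) (P Q : nat -> {poly R}) (be : nat * nat) u g z : (0 < m)%N ->
  Lp 1 (@Omega R) u -> Lp 1 (@Omega R) g -> is_weak_derivative (@Omega R) be u g ->
  poly_chain m P be.1 -> poly_chain m Q be.2 ->
  grid_range 0 m.*2 n z ->
  mavg m.+1 (P 0%N) (Q 0%N) n (m.-1, m.-1) (u \_ (@Omega R)) z =
  (- 2 ^- n) ^+ mord be *
    mavg m.+1 (P be.1) (Q be.2) n ((m.-1 + be.1)%N, (m.-1 + be.2)%N) (g \_ (@Omega R)) z.
Proof.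
move=> m0 Lu Lg wd cP cQ /and4P[a1 b1 a2 b2]; have p0 : 0 < 2 ^+ n :> R by rewrite exprn_gt0.
have cvt (i : int) : 0%:Z <= i -> i + m.*2%:Z <= (2 ^ n)%N%:Z ->
   - i%:~R <= 0 :> R /\ m.*2%:R - - i%:~R <= 2 ^+ n :> R.
  by rewrite -!(ler_int R) intrD -!pmulrn natrX opprK oppr_le0 addrC.
have [{}a1 {}b1] := cvt _ a1 b1; have [{}a2 {}b2] := cvt _ a2 b2.
have sP : (size (P be.1) + (m.-1 + be.1) <= m.*2)%N by have := cP.2 be.1 (leqnn _); lia.
have sQ : (size (Q be.2) + (m.-1 + be.2) <= m.*2)%N by have := cQ.2 be.2 (leqnn _); lia.
have := weak_derivative_pstens p0 Lu Lg wd cP cQ sP sQ a1 b1 a2 b2.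
rewrite !Rintegral_Omega_patch mavg_integral ?mavg_integral/=; try exact: Lp1_integrable.
set A := \int[mu2]_x _; set B := \int[mu2]_x _ => h.
have -> : A = (2 ^+ n) ^- mord be * ((-1) ^+ mord be * B).
  by rewrite -h mulKf// expf_neq0// gt_eqF.
by rewrite -[- 2 ^- n]mulN1r exprMn exprVn; ring.
Qed.

Lemma L1cvg_avg (d : nat * nat) j g : Lp 1 (@Omega R) g ->
  L1cvg (fun n y => avg n d (g \_ (@Omega R)) (cell n y + j)) (g \_ (@Omega R)).
Proof.
move=> Lg; have ig := Lp1_integrable Lg.
have g0 x : ~ Omega x -> (g \_ (@Omega R)) x = 0 by move=> h; rewrite patchE memNset.
have [_ cv] := @avg_convergesP R d j _ ig g0; split.
- by move=> n; exact: (integrable_step n (fun z => avg n d _ (z + j))).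
- exact: integrable_Omega.
- exact: cv.
Qed.

Lemma L1cvg_mavg N P Q (d : nat * nat) j g : Lp 1 (@Omega R) g ->
  L1cvg (fun n y => mavg N P Q n d (g \_ (@Omega R)) (cell n y + j))
    (fun y => (\sum_(i < N) P`_i) * (\sum_(i < N) Q`_i) * (g \_ (@Omega R)) y).
Proof.
move=> Lg; rewrite big_distrlr/= pair_big/=.
rewrite [X in L1cvg _ X](_ : _ = (fun y => \sum_(p : 'I_N * 'I_N) P`_p.1 * Q`_p.2 * (g \_ (@Omega R)) y)); last first.
  by apply/funext => y; rewrite mulr_suml.
apply: L1cvg_sum => p; apply: L1cvgZ.
rewrite [X in L1cvg X _](_ : _ = (fun n y => avg n d (g \_ (@Omega R)) (cell n y + (j + pshift p.1 p.2)))).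
  exact: L1cvg_avg.
by do 2 apply/funext => ?; rewrite addrA.
Qed.

(** As a combination of Kronecker deltas the mask can be exchanged with a sum over the grid, which
    it collapses to m + 1 terms in each variable. *)
Lemma mask_ofE (q : nat -> int -> R) m l c (k : int) : (l <= m)%N -> mask_of q m l c ->
  q l k = \sum_(i < m.+1) (mask_poly m l 0 c)`_i * (k == i%:Z - (m./2)%:Z)%:R.
Proof.
move=> lm /(_ k) ->.
have [k0|k0] := leP 0 (k + (m./2)%:Z); last first.
  rewrite big1// => i _; case: eqP => [e|_]; last by rewrite mulr0.
  by move: k0; rewrite e; lia.
have [im|mi] := ltnP (absz (k + (m./2)%:Z)) m.+1.
  rewrite (bigD1 (Ordinal im))//= big1 ?addr0 => [|i /eqP hi].
    by rewrite (_ : k == _) ?mulr1//; apply/eqP; lia.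
  by case: eqP => [e|_]; [case: hi; apply: val_inj => /=; lia|rewrite mulr0].
rewrite nth_default; last first.
  by have := @size_mask_poly R m l 0 c lm (leq0n _); rewrite addn0 => /leq_trans; apply.
by rewrite big1// => i _; case: eqP => [e|_]; [have := ltn_ord i; lia|rewrite mulr0].
Qed.

Lemma mask_of_supp (q : nat -> int -> R) m l c (k : int) : (l <= m)%N -> mask_of q m l c -> q l k != 0 ->
  - (m./2)%:Z <= k <= (m - m./2)%N%:Z.
Proof.
move=> lm hq; rewrite (mask_ofE _ lm hq); apply: contra_neqT => hk.
rewrite big1// => i _; case: eqP => [e|_]; last by rewrite mulr0.
by case/negP: hk; have := ltn_ord i; have := half_le m; lia.
Qed.

Lemma mask2E (q : nat -> int -> R) m (a : nat * nat) c1 c2 (z : int * int) : (a.1 <= m)%N -> (a.2 <= m)%N ->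
  mask_of q m a.1 c1 -> mask_of q m a.2 c2 ->
  mask2 q a z = \sum_(p : 'I_m.+1 * 'I_m.+1)
    (mask_poly m a.1 0 c1)`_p.1 * (mask_poly m a.2 0 c2)`_p.2 * (z == pshift p.1 p.2 - pshift m./2 m./2)%:R.
Proof.
move=> m1 m2 h1 h2; rewrite /mask2 (mask_ofE _ m1 h1) (mask_ofE _ m2 h2) big_distrlr/= pair_big/=.
apply: eq_bigr => -[i j] _ /=; case: z => z1 z2 /=.
by rewrite -[(z1, z2) == _]/((z1 == _) && (z2 == _))/= -mulnb natrM; ring.
Qed.

(** All masks are supported between -m./2 and m - m./2, and the one with l = 0 attains both ends, so
    testing its two extreme corners already forces the doubled margins. *)
Lemma in_KsetE m n (q : nat -> int -> R) (c : nat -> R) (k : Mset R m n) : (0 < m)%N ->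
  (forall l, (l <= m)%N -> c l != 0 /\ mask_of q m l (c l)) ->
  (k \in Kset m n q) = grid_range (m./2).*2 (m - m./2).*2 n (val k).
Proof.
move=> m0 hc; have [c0 h0] := hc 0%N isT; rewrite inE; apply/asboolP/idP.
  move=> h; have hm := half_le m.
  have n1 : mask2 q (midx ((ord0, ord0) : fidx m)) (- (m./2)%:Z, - (m./2)%:Z) != 0.
    rewrite /mask2 /= !h0 addNr /=.
    by rewrite mask_poly00 mulf_neq0.
  have n2 : mask2 q (midx ((ord0, ord0) : fidx m)) ((m - m./2)%N%:Z, (m - m./2)%N%:Z) != 0.
    rewrite /mask2 /= !h0 -PoszD subnK//=.
    by rewrite mask_poly0m mulf_neq0.
  have := h _ _ n1; have := h _ _ n2; rewrite !in_MsetE// => /and4P[/= a1 b1 a2 b2] /and4P[/= a1' b1' a2' b2'].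
  by apply/and4P; split; lia.
move=> /and4P[a1 b1 a2 b2] al j; rewrite /mask2 mulf_eq0 negb_or => /andP[hj1 hj2].
have l1 : (al.1 <= m)%N by rewrite -ltnS ltn_ord.
have l2 : (al.2 <= m)%N by rewrite -ltnS ltn_ord.
have [_ /(mask_of_supp l1)/(_ hj1) /andP[s1 t1]] := hc _ l1.
have [_ /(mask_of_supp l2)/(_ hj2) /andP[s2 t2]] := hc _ l2.
have hm := half_le m; rewrite in_MsetE//.
by move: (val k) a1 b1 a2 b2 => v /= a1 b1 a2 b2; apply/and4P; split => /=; lia.
Qed.

(** The shift by m./2 is there because phi is centred while [kern] starts at its index. The factor
    2^n of T_n times that of phi_nk is the normalisation 4^n. *)
Lemma TnE m n u (k : Mset R m n) : Lp 1 (@Omega R) u ->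
  Tn m n u k = avg n (m.-1, m.-1) (u \_ (@Omega R)) (val k - pshift m./2 m./2).
Proof.
move=> Lu; rewrite /Tn ffunE Rintegral_Omega_patch; have iw := integrable_avg n (m.-1, m.-1) (val k - pshift m./2 m./2) (Lp1_integrable Lu).
have p0 : 2 ^+ n != 0 :> R by rewrite expf_neq0.
rewrite (_ : avg _ _ _ _ = 2 ^+ n * (2 ^- n * avg n (m.-1, m.-1) (u \_ (@Omega R)) (val k - pshift m./2 m./2))); last first.
  by rewrite mulVKf.
congr (_ * _); rewrite -(RintegralZl _ measurableT iw); apply: eq_Rintegral => x _.
rewrite /phi_nk /phi !cardinal_bspline_unit /kern /= !intrB -!pmulrn.
have e (a b : R) : a - (b - (m./2)%:R) = a - b + (m./2)%:R by ring.
rewrite !e.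
rewrite (_ : 4 ^+ n = 2 ^+ n * 2 ^+ n :> R); last by rewrite -exprMn; congr (_ ^+ _); ring.
by set a := 2 ^+ n in p0 *; field.
Qed.

Lemma sum_mask m n (q : nat -> int -> R) (a : nat * nat) c1 c2 (k : Mset R m n) (f : int * int -> R) : (0 < m)%N ->
  (a.1 <= m)%N -> (a.2 <= m)%N ->
  mask_of q m a.1 c1 -> mask_of q m a.2 c2 ->
  grid_range (m./2).*2 (m - m./2).*2 n (val k) ->
  \sum_(j : Mset R m n) mask2 q a (val j - val k) * f (val j) =
  \sum_(p : 'I_m.+1 * 'I_m.+1) (mask_poly m a.1 0 c1)`_p.1 * (mask_poly m a.2 0 c2)`_p.2 *
    f (val k + (pshift p.1 p.2 - pshift m./2 m./2)).
Proof.
move=> m0 m1 m2 h1 h2 /and4P[a1 b1 a2 b2].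
under eq_bigr do rewrite (mask2E _ m1 m2 h1 h2) mulr_suml.
rewrite exchange_big/=; apply: eq_bigr => -[i1 i2] _ /=.
under eq_bigr do rewrite -[_ * f _]mulrA.
rewrite -mulr_sumr; congr (_ * _).
set z := pshift _ _ - _; have zM : val k + z \in Mset R m n.
  have hm := half_le m; have := ltn_ord i1; have := ltn_ord i2.
  move=> l2 l1; rewrite in_MsetE//; move: (val k) a1 b1 a2 b2 => v /= a1 b1 a2 b2.
  by apply/and4P; split => /=; lia.
rewrite (bigD1 (FSetSub zM))//= big1 ?addr0 => [|j /eqP jz].
  by rewrite addrC addKr eqxx mul1r.
case: eqP => [e|_]; last by rewrite mul0r.
by case: jz; apply: val_inj; rewrite /= -e addrC subrK.
Qed.

(** The shift is doubled: one m./2 comes from the centring of the mask, the other from that of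
    phi. *)
Lemma WopE m n (q : nat -> int -> R) (a : nat * nat) c1 c2 u (k : Mset R m n) : (0 < m)%N -> Lp 1 (@Omega R) u ->
  (a.1 <= m)%N -> (a.2 <= m)%N ->
  mask_of q m a.1 c1 -> mask_of q m a.2 c2 ->
  grid_range (m./2).*2 (m - m./2).*2 n (val k) ->
  Wop q a (Tn m n u) k =
  mavg m.+1 (mask_poly m a.1 0 c1) (mask_poly m a.2 0 c2) n (m.-1, m.-1) (u \_ (@Omega R))
    (val k - pshift (m./2).*2 (m./2).*2).
Proof.
move=> m0 Lu m1 m2 h1 h2 hk; rewrite /Wop; under eq_bigr do rewrite TnE//.
rewrite (sum_mask (fun z => avg n (m.-1, m.-1) (u \_ (@Omega R)) (z - pshift m./2 m./2)) m0 m1 m2 h1 h2 hk).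
apply: eq_bigr => p _; congr (_ * avg _ _ _ _).
by rewrite /pshift; congr (_, _) => /=; lia.
Qed.

End Operators.

(** * Convergence of the weighted gradient terms *)

Section Functionals.
Context {R : realType}.
Notation mu2 := (@leb2 R).
Notation intO F := (\int[mu2]_(y in @Omega R) F y).
Notation iO F := (mu2.-integrable (@Omega R) (EFin \o F)).

Lemma weakD_spec s u (a : nat * nat) : W1 s (@Omega R) u -> (mord a <= s)%N ->
  Lp 1 (@Omega R) (weakD (@Omega R) a u) /\ is_weak_derivative (@Omega R) a u (weakD (@Omega R) a u).
Proof.
by move=> [_ hu] /hu[g hg]; apply: (xgetPex (cst 0) (P := [set g | Lp 1 (@Omega R) g /\ is_weak_derivative (@Omega R) a u g])); exists g.
Qed.

Lemma dyadicE d n : @dyadic R d n = (2 ^+ n / 2) ^+ d.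
Proof.
rewrite /dyadic mulrC -exprz_exp -exprnP; congr (_ ^+ d).
by rewrite expfzDr ?pnatr_eq0.
Qed.

(** The exponent n - 1 in place of n leaves 2^-d, the ratio between c_al and the total weight of the
    combination when d = |al|. *)
Lemma dyadic_scale d n : @dyadic R d n * (2 ^- n) ^+ d = 2^-1 ^+ d.
Proof.
rewrite dyadicE -exprMn; congr (_ ^+ d).
by rewrite mulrAC mulfV ?mul1r// expf_neq0.
Qed.

Lemma L1cvg_ext (X X' : nat -> R * R -> R) (x x' : R * R -> R) :
  (forall n y, Omega y -> X n y = X' n y) -> (forall y, Omega y -> x y = x' y) ->
  L1cvg X x -> L1cvg X' x'.
Proof.
move=> XX' xx' [iX ix cX]; have mO := @measurable_Omega R.
have iX' n : iO (X' n) by apply: eq_integrableR (iX n) => //; exact: XX'.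
have ix' : iO x' by apply: eq_integrableR ix.
apply: L1cvg_le cX => // [n|n y Oy]; first by apply/iO_norm/iOB.
by rewrite XX'// xx'.
Qed.

Lemma grid_range_shift m n z : grid_range (m./2).*2 (m - m./2).*2 n z ->
  grid_range 0 m.*2 n (z - pshift (m./2).*2 (m./2).*2).
Proof.
have hm := half_le m; case: z => z1 z2 /and4P[/= *]; apply/and4P; split => /=; lia.
Qed.

Lemma measurable_grid_mask a b n :
  measurable_fun (@Omega R) (fun y => (grid_range a b n (cell n y))%:R : R).
Proof. exact: iO_measurable (integrable_step n (fun z => (grid_range a b n z)%:R)). Qed.

Section FixedMasks.
Context (m : nat) (q : nat -> int -> R) (c : nat -> R) (m0 : (0 < m)%N)
  (hc : forall l, (l <= m)%N -> c l != 0 /\ mask_of q m l (c l)).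
Notation shift2 := (pshift (m./2).*2 (m./2).*2).
Notation inK := (grid_range (m./2).*2 (m - m./2).*2).
(** The al-th framelet combination with be of its differences taken off and the spline degrees
    raised by be: for be = 0 the coefficient W_al of T_n w, otherwise what integration by parts
    leaves to be applied to the derivative of order be. *)
Notation coef al be w n z := (mavg m.+1 (mask_poly m al.1 be.1 (c al.1)) (mask_poly m al.2 be.2 (c al.2))
  n ((m.-1 + be.1)%N, (m.-1 + be.2)%N) (w \_ (@Omega R)) (z - shift2)).

Lemma fidx_le (al : fidx m) : ((midx al).1 <= m)%N /\ ((midx al).2 <= m)%N.
Proof. by split; rewrite -ltnS ltn_ord. Qed.

Lemma coef_derivative s u (al be : nat * nat) n z : (al.1 <= m)%N -> (al.2 <= m)%N -> mle be al ->
  W1 s (@Omega R) u -> (mord be <= s)%N -> inK n z ->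
  coef al (0%N, 0%N) u n z = (- 2 ^- n) ^+ mord be * coef al be (weakD (@Omega R) be u) n z.
Proof.
move=> l1 l2 /andP[b1 b2] Wu bs hz; have [Lg wd] := weakD_spec Wu bs.
have := mavg_derivative m0 Wu.1 Lg wd (mask_poly_chain (c al.1) l1 b1) (mask_poly_chain (c al.2) l2 b2)
  (grid_range_shift hz).
by rewrite /= !addn0.
Qed.

Lemma coef_cvg (al be : nat * nat) g : (al.1 <= m)%N -> (al.2 <= m)%N -> mle be al ->
  Lp 1 (@Omega R) g ->
  L1cvg (fun n y => coef al be g n (cell n y))
    (fun y => c al.1 * ((al.1 <= be.1)%N%:R * 2 ^+ (m - al.1)) *
              (c al.2 * ((al.2 <= be.2)%N%:R * 2 ^+ (m - al.2))) * g y).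
Proof.
move=> l1 l2 /andP[b1 b2] Lg.
have := L1cvg_mavg m.+1 (mask_poly m al.1 be.1 (c al.1)) (mask_poly m al.2 be.2 (c al.2))
  ((m.-1 + be.1)%N, (m.-1 + be.2)%N) (- shift2) Lg.
rewrite !sum_mask_poly//; apply: L1cvg_ext => // y Oy.
by rewrite patchE mem_set.
Qed.

(** Transfers convergence from coefficients of the derivative of order be to those of u, for
    arbitrary weights r. Integration by parts is available only on K_n, hence the mask. *)
Lemma weight_cvg s u (al be : fidx m) (r : nat -> R) :
  mle (midx be) (midx al) -> W1 s (@Omega R) u -> (mord (midx be) <= s)%N ->
  forall x, L1cvg (fun n y => r n * (2 ^- n) ^+ mord (midx be) *
    `|coef (midx al) (midx be) (weakD (@Omega R) (midx be) u) n (cell n y)|) x ->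
  L1cvg (fun n y => (inK n (cell n y))%:R * (r n * `|coef (midx al) (0%N, 0%N) u n (cell n y)|)) x.
Proof.
move=> ba Wu bs x /L1cvg_mask-/(_ (fun n y => inK n (cell n y)) (measurable_grid_mask _ _) (cell_range_near _ _)).
apply: L1cvg_ext => // n y Oy; have [l1 l2] := fidx_le al.
have [hK|_] := boolP (inK n (cell n y)); last by rewrite !mul0r.
rewrite (coef_derivative l1 l2 ba Wu bs hK) normrM normrX normrN (@ger0_norm _ (2 ^- n)); last first.
  by rewrite invr_ge0 exprn_ge0.
by rewrite !mul1r mulrA.
Qed.

Context (varphi : fidx m -> R * R -> R) (hq : bspline_masks m q)
  (hv : framelet_antiderivatives q varphi).

Lemma weight_cvg_in s u (al : fidx m) (lam : nat -> R) : al \in framelet_idx m ->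
  W1 s (@Omega R) u -> (mord (midx al) <= s)%N ->
  (forall n, lam n = ((framelet_const varphi al)^-1 * @dyadic R (mord (midx al)) n) ^+ 2) ->
  L1cvg (fun n y => (inK n (cell n y))%:R *
      (Num.sqrt (lam n) * `|coef (midx al) (0%N, 0%N) u n (cell n y)|))
    (fun y => `|weakD (@Omega R) (midx al) u y|).
Proof.
move=> hal Wu als hlam; have [l1 l2] := fidx_le al.
have aa : mle (midx al) (midx al) by rewrite /mle !leqnn.
have [Lg wd] := weakD_spec Wu als.
apply: (weight_cvg aa Wu als).
have := L1cvgZ (`|framelet_const varphi al|^-1 * 2^-1 ^+ mord (midx al)) (L1cvg_norm (coef_cvg l1 l2 aa Lg)).
apply: L1cvg_ext => [n y _|y _].
  rewrite hlam sqrtr_sqr normrM normfV (@ger0_norm _ (dyadic R _ _)).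
    by rewrite -(dyadic_scale _ n); ring.
  by rewrite dyadicE exprn_ge0// divr_ge0.
have [c1 h1] := hc l1; have [c2 h2] := hc l2.
rewrite (framelet_constE hq hv hal h1 h2) !leqnn !mul1r [X in _ * X]normrM /mord exprD mulrA.
(* S is the total weight of the combination for be = al, and the framelet constant is e S; the
   factor e = 2^-|al| cancels against the one left by [dyadic_scale]. *)
set S := c _ * _ * _; pose e : R := 2^-1 ^+ (midx al).1 * 2^-1 ^+ (midx al).2.
have e0 : 0 < e by rewrite mulr_gt0// exprn_gt0// invr_gt0.
have S0 : S != 0 by rewrite !mulf_neq0// expf_neq0.
set D := (X in `|X|^-1); rewrite (_ : D = e * S); last by rewrite /D /e /S /=; ring.
rewrite -[_ * 2^-1 ^+ _ * _]mulrA -/e.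
have nS : `|S| != 0 by rewrite normr_eq0.
by rewrite normrM (gtr0_norm e0); field; rewrite nS gt_eqF.
Qed.

Lemma weight_cvg_out s u (al be : fidx m) (lam : nat -> R) :
  mlt (midx be) (midx al) -> W1 s (@Omega R) u -> (mord (midx be) <= s)%N ->
  (forall n, 0 <= lam n) ->
  ((lam : nat -> R^o) =O_\oo ((fun n => @dyadic R (2 * mord (midx be))%N n) : nat -> R^o)) ->
  L1cvg (fun n y => (inK n (cell n y))%:R *
      (Num.sqrt (lam n) * `|coef (midx al) (0%N, 0%N) u n (cell n y)|))
    (fun=> 0).
Proof.
move=> /andP[ba nba] Wu bs lam0 /eqO_exP[C C0 hC]; have [l1 l2] := fidx_le al.
have [Lg wd] := weakD_spec Wu bs.
apply: (weight_cvg ba Wu bs).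
(* The square of the scaled weight is at most C by the growth condition, so the weight itself is at
   most C + 1. *)
apply: (@L1cvg0_scale _ (fun n y => `|coef (midx al) (midx be) (weakD (@Omega R) (midx be) u) n (cell n y)|)
  (fun n => Num.sqrt (lam n) * (2 ^- n) ^+ mord (midx be)) (C + 1)).
  apply: filterS hC => n; rewrite /= ger0_norm// ger0_norm; last first.
    by rewrite dyadicE exprn_ge0// divr_ge0.
  move=> hn; have p0 : 0 <= 2 ^- n :> R by rewrite invr_ge0 exprn_ge0.
  rewrite ger0_norm ?mulr_ge0 ?sqrtr_ge0 ?exprn_ge0//.
  set t := _ * _; have t0 : 0 <= t by rewrite mulr_ge0 ?sqrtr_ge0 ?exprn_ge0.
  have : t ^+ 2 <= C.
    rewrite /t exprMn sqr_sqrtr// -exprM mulnC.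
    apply: (@le_trans _ _ (C * (@dyadic R (2 * mord (midx be)) n * (2 ^- n) ^+ (2 * mord (midx be))))).
      by rewrite mulrA ler_wpM2r// exprn_ge0.
    rewrite dyadic_scale -[leRHS]mulr1 ler_wpM2l ?(ltW C0)//.
    by rewrite exprn_ile1// ?invr_ge0// invf_le1 ?ler1n.
  nra.
have := L1cvg_norm (coef_cvg l1 l2 ba Lg); apply: L1cvg_ext => // y _.
have [h1 h2] := andP ba.
(* As be < al, a factor 1 - X remains in at least one variable, and the total weight is 0. *)
have : ~~ (((midx al).1 <= (midx be).1)%N && ((midx al).2 <= (midx be).2)%N).
  apply: contra nba => /andP[h3 h4]; apply/eqP; apply/pair_equal_spec; split.
    by apply/eqP; rewrite eqn_leq h1.
  by apply/eqP; rewrite eqn_leq h2.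
by rewrite negb_and => /orP[/negPf->|/negPf->]; rewrite !(mul0r, mulr0) normr0.
Qed.

(** The norm [Wnorm] at an arbitrary index, with the roots of the weights moved inside the squares
    and the sum completed by zeros to the whole index type, as [L1cvg_sqrt_sum] expects. *)
Definition Wstep (lam : fidx m -> R) u n (z : int * int) : R :=
  Num.sqrt (\sum_(al : fidx m) (if al \in framelet_idx m
    then Num.sqrt (lam al) * `|coef (midx al) (0%N, 0%N) u n z| else 0) ^+ 2).

Lemma WnormE (lam : fidx m -> R) u n (k : Mset R m n) : Lp 1 (@Omega R) u ->
  (forall al, al \in framelet_idx m -> 0 <= lam al) -> k \in Kset m n q ->
  Wnorm q lam (Tn m n u) k = Wstep lam u n (val k).
Proof.
move=> Lu lam0; rewrite (in_KsetE _ m0 hc) => hk; rewrite /Wnorm /Wstep; congr Num.sqrt.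
rewrite big_mkcond; apply: eq_bigr => al _; case: ifPn => hal; last by rewrite expr0n.
rewrite exprMn sqr_sqrtr ?lam0//; congr (_ * `|_| ^+ 2).
have [l1 l2] := fidx_le al.
by rewrite (WopE m0 Lu l1 l2 (hc l1).2 (hc l2).2 hk)/= !addn0.
Qed.

Lemma A2_ge0 (J : {set fidx m}) s (lam : nat -> fidx m -> R) n al :
  assumption_A2 varphi J s lam -> al \in framelet_idx m -> 0 <= lam n al.
Proof.
move=> [hin hout] hal; have [aJ|aJ] := boolP (al \in J); first by rewrite hin// sqr_ge0.
by have [|+ _] := hout al; [rewrite inE aJ|exact].
Qed.

Lemma Wstep_cvg (J : {set fidx m}) s (lam : nat -> fidx m -> R) u : J \subset framelet_idx m ->
  (forall al, al \in J -> (mord (midx al) <= s)%N) ->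
  assumption_A2 varphi J s lam -> W1 s (@Omega R) u ->
  L1cvg (fun n y => (inK n (cell n y))%:R * Wstep (lam n) u n (cell n y)) (gradnorm J u).
Proof.
move=> JB Js [hin hout] Wu.
pose X (al : fidx m) n (y : R * R) := (inK n (cell n y))%:R * (if al \in framelet_idx m
    then Num.sqrt (lam n al) * `|coef (midx al) (0%N, 0%N) u n (cell n y)| else 0).
pose x (al : fidx m) y := if al \in J then `|weakD (@Omega R) (midx al) u y| else 0.
have cX al : L1cvg (X al) (x al).
  rewrite /X /x; have [aJ|aJ] := boolP (al \in J).
    have aB := fintype.subsetP JB _ aJ; rewrite aB.
    by apply: (weight_cvg_in aB Wu (Js _ aJ)) => n; exact: hin.
  have [aB|aB] := boolP (al \in framelet_idx m); last first.
    split; [|exact: iO_cst|].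
      by move=> n; apply: eq_integrableR (iO_cst 0); [exact: measurable_Omega|move=> y _; rewrite mulr0].
    under eq_fun do under eq_Rintegral do rewrite mulr0 subr0 normr0.
    by rewrite intO0; exact: cvg_cst.
  have [|lam0 [be [h1 h2 h3]]] := hout al; first by rewrite inE aJ.
  exact: (weight_cvg_out h1 Wu h2 lam0 h3).
have := L1cvg_sqrt_sum cX; apply: L1cvg_ext => [n y _|y _].
  rewrite /X /Wstep; under eq_bigr do rewrite exprMn.
  by rewrite -mulr_sumr sqrtrM ?sqr_ge0// sqrtr_sqr ger0_norm.
rewrite /gradnorm [in RHS]big_mkcond; congr Num.sqrt; apply: eq_bigr => al _.
by rewrite /x; case: ifP => // _; rewrite expr0n.
Qed.

Lemma Kset_sum n (F : int * int -> R) :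
  (2 ^- n) ^+ 2 * (\sum_(k in Kset m n q) F (val k)) =
  intO (fun y => (inK n (cell n y))%:R * F (cell n y)).
Proof.
rewrite -(@grid_sum R m n (m./2).*2 (m - m./2).*2 F m0); [|lia|lia].
by congr (_ * _); apply: eq_bigl => k; exact: in_KsetE hc.
Qed.

Lemma gradient_term_cvg (J : {set fidx m}) s (lam : nat -> fidx m -> R) u : J \subset framelet_idx m ->
  (forall al, al \in J -> (mord (midx al) <= s)%N) ->
  assumption_A2 varphi J s lam -> W1 s (@Omega R) u ->
  (2 ^- n) ^+ 2 * (\sum_(k in Kset m n q) Wnorm q (lam n) (Tn m n u) k) @[n --> \oo] -->
  intO (fun y => gradnorm J u y).
Proof.
move=> JB Js A2 Wu; have e n : (2 ^- n) ^+ 2 * (\sum_(k in Kset m n q) Wnorm q (lam n) (Tn m n u) k) =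
    intO (fun y => (inK n (cell n y))%:R * Wstep (lam n) u n (cell n y)).
  rewrite -(Kset_sum n (Wstep (lam n) u n)); congr (_ * _).
  by apply: eq_bigr => k hk; rewrite (WnormE Wu.1 (fun al => A2_ge0 n A2) hk).
by under eq_fun do rewrite e; exact: L1cvg_lim (Wstep_cvg JB Js A2 Wu).
Qed.

Lemma weighted_gradient_term_cvg (J : {set fidx m}) s (lam : nat -> fidx m -> R) u
    (Z : nat -> int * int -> R) z : J \subset framelet_idx m ->
  (forall al, al \in J -> (mord (midx al) <= s)%N) ->
  assumption_A2 varphi J s lam -> W1 s (@Omega R) u ->
  (forall n (y : R * R), Omega y -> `|Z n (cell n y)| <= 1) -> (forall y, Omega y -> `|z y| <= 1) ->
  L1cvg (fun n y => Z n (cell n y)) z ->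
  (2 ^- n) ^+ 2 * (\sum_(k in Kset m n q) Z n (val k) * Wnorm q (lam n) (Tn m n u) k) @[n --> \oo] -->
  intO (fun y => z y * gradnorm J u y).
Proof.
move=> JB Js A2 Wu Z1 z1 cZ.
have e n : (2 ^- n) ^+ 2 * (\sum_(k in Kset m n q) Z n (val k) * Wnorm q (lam n) (Tn m n u) k) =
    intO (fun y => Z n (cell n y) * ((inK n (cell n y))%:R * Wstep (lam n) u n (cell n y))).
  transitivity (intO (fun y => (inK n (cell n y))%:R * (Z n (cell n y) * Wstep (lam n) u n (cell n y)))).
    rewrite -(Kset_sum n (fun z => Z n z * Wstep (lam n) u n z)); congr (_ * _).
    by apply: eq_bigr => k hk; rewrite (WnormE Wu.1 (fun al => A2_ge0 n A2) hk).
  by apply: eq_Rintegral => y _; rewrite mulrCA.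
by under eq_fun do rewrite e; exact: L1cvg_lim (L1cvg_mul Z1 z1 cZ (Wstep_cvg JB Js A2 Wu)).
Qed.

End FixedMasks.
End Functionals.

(** * Convergence of the fidelity term *)

Section Fidelity.
Context {R : realType}.
Notation mu2 := (@leb2 R).
Notation intO F := (\int[mu2]_(y in @Omega R) F y).

Lemma patch_fun (f : R -> R) (w : R * R -> R) : f 0 = 0 ->
  (fun y => f (w y)) \_ (@Omega R) = (fun y => f ((w \_ (@Omega R)) y)).
Proof. by move=> f0; apply/funext => y; rewrite !patchE; case: ifP. Qed.

Lemma Rintegral_patch (w : R * R -> R) : \int[mu2]_y ((w \_ (@Omega R)) y) = intO w.
Proof. by rewrite [RHS]Rintegral_mkcond. Qed.

Lemma avg_ae n (d : nat * nat) (w w' : R * R -> R) z : mu2.-integrable setT (EFin \o w) ->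
  mu2.-integrable setT (EFin \o w') -> {ae mu2, forall y, w y = w' y} -> avg n d w z = avg n d w' z.
Proof.
move=> iw iw' ww'.
have /measurable_EFinP m1 := measurable_int _ (integrable_avg n d z iw).
have /measurable_EFinP m2 := measurable_int _ (integrable_avg n d z iw').
apply: ae_eq_Rintegral => //; apply: filterS ww' => y -> //.
Qed.

Lemma avg_unit n (d : nat * nat) (w : R * R -> R) z : mu2.-integrable setT (EFin \o w) ->
  (forall y, 0 <= w y <= 1) -> 0 <= avg n d w z <= 1.
Proof.
move=> iw w01; apply/andP; split.
  by apply: Rintegral_ge0 => y _; rewrite mulr_ge0 ?kern_ge0//; case/andP: (w01 y).
rewrite -(@Rintegral_kern R n d z); apply: le_Rintegral => //.
- exact: integrable_avg.
- exact: integrable_kern.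
- by move=> y _; rewrite -[leRHS]mul1r ler_wpM2r ?kern_ge0//; case/andP: (w01 y).
Qed.

(* The variance of [w] with respect to the probability density [kern n d z] is nonnegative. *)
Lemma avg_sqr_le n (d : nat * nat) (w : R * R -> R) z : mu2.-integrable setT (EFin \o w) ->
  mu2.-integrable setT (EFin \o (fun y => w y ^+ 2)) ->
  avg n d w z ^+ 2 <= avg n d (fun y => w y ^+ 2) z.
Proof.
move=> iw iw2; set a := avg n d w z.
have i1 := integrable_avg n d z iw2; have i2 := integrableRZ (- (2 * a)) measurableT (integrable_avg n d z iw).
have i3 := integrableRZ (a ^+ 2) measurableT (@integrable_kern R n d z).
have : 0 <= \int[mu2]_y (w y ^+ 2 * kern n d z y + - (2 * a) * (w y * kern n d z y) + a ^+ 2 * kern n d z y).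
  apply: Rintegral_ge0 => y _.
  rewrite (_ : _ + _ = (w y - a) ^+ 2 * kern n d z y); last by ring.
  by rewrite mulr_ge0 ?sqr_ge0 ?kern_ge0.
rewrite (RintegralD measurableT (integrableRD measurableT i1 i2) i3) (RintegralD measurableT i1 i2).
rewrite (RintegralZl _ measurableT (integrable_avg n d z iw)).
rewrite (RintegralZl _ measurableT (@integrable_kern R n d z)) Rintegral_kern.
rewrite -/(avg n d w z) -/a -/(avg n d (fun y => w y ^+ 2) z); nra.
Qed.

Lemma Lp1_of_Lp2 (w : R * R -> R) : Lp 2 (@Omega R) w -> Lp 1 (@Omega R) w.
Proof. by move=> /Lp2_Lp1 iw; apply/Lfun1_integrable. Qed.

Lemma Lp2B (w w' : R * R -> R) : Lp 2 (@Omega R) w -> Lp 2 (@Omega R) w' ->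
  Lp 2 (@Omega R) (w \- w').
Proof.
move=> /Lp2P[mw iw] /Lp2P[mw' iw']; apply/Lp2P.
have -> : (w \- w') \_ (@Omega R) = (fun y => (w \_ (@Omega R)) y - (w' \_ (@Omega R)) y).
  by apply/funext => y; rewrite !patchE; case: ifP => //; rewrite subr0.
have mB : measurable_fun setT (fun y => (w \_ (@Omega R)) y - (w' \_ (@Omega R)) y).
  exact: measurable_funB.
split => //.
have i2 := integrableRD measurableT (integrableRZ 2 measurableT iw) (integrableRZ 2 measurableT iw').
apply: (integrableR_le _ _ _ i2) => //; first exact: measurable_funX.
move=> y _; rewrite ger0_norm ?sqr_ge0//; set a := (w \_ _) y; set b := (w' \_ _) y.
by have := sqr_ge0 (a + b); nra.
Qed.

Lemma grid_norm2_sqr m n (w : grid_fun R m n) :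
  grid_norm2 w ^+ 2 = (2 ^- n) ^+ 2 * \sum_(k : Mset R m n) w k ^+ 2.
Proof.
rewrite /grid_norm2 sqr_sqrtr; last first.
  by rewrite mulr_ge0 ?sqr_ge0// sumr_ge0// => k _; exact: exprn_ge0.
by congr (_ * _); apply: eq_bigr => k _; rewrite real_normK// num_real.
Qed.

Lemma grid_norm2_Tn_cvg m (w : R * R -> R) : (0 < m)%N -> Lp 2 (@Omega R) w ->
  grid_norm2 (Tn m n w) ^+ 2 @[n --> \oo] --> L2norm (@Omega R) w ^+ 2.
Proof.
move=> m0 L2w; have L1w := Lp1_of_Lp2 L2w; have [_ iw2] := (Lp2P w).1 L2w.
have iw := Lp1_integrable L1w.
have sqE : (fun y => w y ^+ 2) \_ (@Omega R) = (fun y => (w \_ (@Omega R)) y ^+ 2).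
  by rewrite (patch_fun (f := fun x => x ^+ 2))// expr0n.
have L1w2 : Lp 1 (@Omega R) (fun y => w y ^+ 2) by apply/Lfun1_integrable; rewrite sqE.
have c1 := L1cvg_avg (m.-1, m.-1) (- pshift m./2 m./2) L1w.
have c2 := L1cvg_avg (m.-1, m.-1) (- pshift m./2 m./2) L1w2.
rewrite sqE in c2.
have c3 : L1cvg (fun n y => avg n (m.-1, m.-1) (w \_ (@Omega R)) (cell n y - pshift m./2 m./2) ^+ 2)
    (fun y => (w \_ (@Omega R)) y ^+ 2).
  by apply: (L1cvg_sqr _ c1 c2) => n y _; exact: avg_sqr_le.
have := L1cvg_lim (L1cvg_mask (measurable_grid_mask m./2 (m - m./2)) (cell_range_near _ _) c3).
have <- : L2norm (@Omega R) w ^+ 2 = intO (fun y => (w \_ (@Omega R)) y ^+ 2).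
  rewrite L2norm_sqr// -sqE Rintegral_patch; apply: eq_Rintegral => y; rewrite inE => Oy.
  by rewrite mem_set.
have e n : grid_norm2 (Tn m n w) ^+ 2 = intO (fun y => (grid_range m./2 (m - m./2) n (cell n y))%:R *
    avg n (m.-1, m.-1) (w \_ (@Omega R)) (cell n y - pshift m./2 m./2) ^+ 2).
  rewrite -(grid_sum n (fun z => avg n (m.-1, m.-1) (w \_ (@Omega R)) (z - pshift m./2 m./2) ^+ 2) m0 (leqnn _) (leqnn _)).
  rewrite grid_norm2_sqr; congr (_ * _); apply: eq_big => [k|k _]; last by rewrite TnE.
  by rewrite -(@in_MsetE R)// fsvalP.
by move=> h; under eq_fun do rewrite e; exact: h.
Qed.

(** Young's inequality 2 |x r| <= x^2 / K + K r^2. *)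
Lemma sqr_perturbation (K x r : R) : 0 < K ->
  `|(x - r) ^+ 2 - x ^+ 2| <= K^-1 * x ^+ 2 + (1 + K) * r ^+ 2.
Proof.
move=> K0; have Kn0 : K != 0 by rewrite gt_eqF.
have h1 : 0 <= K^-1 * (x - K * r) ^+ 2 by rewrite mulr_ge0 ?sqr_ge0// invr_ge0 ltW.
have h2 : 0 <= K^-1 * (x + K * r) ^+ 2 by rewrite mulr_ge0 ?sqr_ge0// invr_ge0 ltW.
have e1 : K^-1 * (x - K * r) ^+ 2 = K^-1 * x ^+ 2 - 2 * x * r + K * r ^+ 2 by field.
have e2 : K^-1 * (x + K * r) ^+ 2 = K^-1 * x ^+ 2 + 2 * x * r + K * r ^+ 2 by field.
have r0 := sqr_ge0 r; have e3 : (x - r) ^+ 2 - x ^+ 2 = r ^+ 2 - 2 * x * r by ring.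
by rewrite e3 ler_norml; apply/andP; split; nra.
Qed.

(** Young's inequality summed over the grid, with K = k + 1: for fixed K the terms in r vanish as n
    grows and those in x tend to L / K, which is small for large K. *)
Lemma grid_norm2_perturbation m (x r : forall n, grid_fun R m n) (L : R) :
  grid_norm2 (x n) ^+ 2 @[n --> \oo] --> L -> grid_norm2 (r n) @[n --> \oo] --> (0 : R) ->
  grid_norm2 (x n - r n) ^+ 2 @[n --> \oo] --> L.
Proof.
move=> cx cr.
have cr2 : grid_norm2 (r n) ^+ 2 @[n --> \oo] --> (0 : R).
  rewrite -[X in _ --> X](mulr0 0) (_ : (fun n => _) = (fun n => grid_norm2 (r n) * grid_norm2 (r n))).
    exact: cvgM.
  by apply/funext => n; rewrite expr2.
have cx0 : `|grid_norm2 (x n) ^+ 2 - L| @[n --> \oo] --> (0 : R).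
  by rewrite -(normr0 R) -(subrr L); apply: cvg_norm; apply: cvgB => //; exact: cvg_cst.
have key : `|grid_norm2 (x n - r n) ^+ 2 - grid_norm2 (x n) ^+ 2| @[n --> \oo] --> (0 : R).
  apply: (@cvg0_double _ _ (fun k n => k.+1%:R^-1 * `|grid_norm2 (x n) ^+ 2 - L| +
      (1 + k.+1%:R) * grid_norm2 (r n) ^+ 2) (fun k => L * k.+1%:R^-1)).
  - by move=> n.
  - move=> k n; have K0 : 0 < k.+1%:R :> R by [].
    apply: (@le_trans _ _ (k.+1%:R^-1 * grid_norm2 (x n) ^+ 2 + (1 + k.+1%:R) * grid_norm2 (r n) ^+ 2)).
      rewrite !grid_norm2_sqr -mulrBr -sumrB normrM ger0_norm ?sqr_ge0//.
      rewrite [_^-1 * (_ * _)]mulrCA [(1 + _) * (_ * _)]mulrCA -mulrDr.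
      rewrite ler_wpM2l ?sqr_ge0// !mulr_sumr -big_split/=.
      apply: (le_trans (ler_norm_sum _ _ _)); apply: ler_sum => i _.
      by rewrite !ffunE; exact: sqr_perturbation.
    have := ler_wpM2l (ltW (_ : 0 < k.+1%:R^-1 :> R)) (ler_norm (grid_norm2 (x n) ^+ 2 - L)).
    by rewrite invr_gt0 => /(_ K0); set a := k.+1%:R^-1; lra.
  - move=> k; apply: cvg0D; exact: cvg0Z.
  - by apply: cvg0Z; exact: cvg_harmonic.
rewrite -[X in _ --> X]add0r (_ : (fun n => _) = (fun n =>
  (grid_norm2 (x n - r n) ^+ 2 - grid_norm2 (x n) ^+ 2) + grid_norm2 (x n) ^+ 2)).
  by apply: cvgD => //; exact: norm_cvg0.
by apply/funext => n; rewrite subrK.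
Qed.

Lemma fidelity_cvg m (f : R * R -> R) (A : (R * R -> R) -> R * R -> R)
    (An : forall n, grid_fun R m n -> grid_fun R m n) (u : R * R -> R) : (0 < m)%N ->
  Lp 2 (@Omega R) f -> Lp 2 (@Omega R) u -> assumption_A1 A An ->
  grid_norm2 (An n (Tn m n u) - Tn m n f) ^+ 2 @[n --> \oo] --> L2norm (@Omega R) (A u \- f) ^+ 2.
Proof.
move=> m0 Lf Lu [[LA _ _] cA]; have LAu := LA _ Lu.
have := grid_norm2_perturbation (grid_norm2_Tn_cvg m0 (Lp2B LAu Lf)) (cA u Lu).
(* The discrete residual is the sampled continuous residual up to the consistency error, which tends
   to 0 by (A1). *)
have e n : Tn m n (A u \- f) - (Tn m n (A u) - An n (Tn m n u)) = An n (Tn m n u) - Tn m n f.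
  have -> : Tn m n (A u \- f) = Tn m n (A u) - Tn m n f.
    apply/ffunP => k; rewrite [RHS]ffunE [X in _ = _ + X]ffunE !TnE; try exact/Lp1_of_Lp2.
      have -> : (A u \- f) \_ (@Omega R) = (fun y => (A u \_ (@Omega R)) y + (-1) * (f \_ (@Omega R)) y).
        by apply/funext => y; rewrite !patchE; case: ifP => _; rewrite /= mulN1r ?subr0.
      have iA := Lp2_Lp1 LAu; have iF := Lp2_Lp1 Lf.
      by rewrite avgD ?avgZ ?mulN1r//; exact: integrableRZ.
    by apply: Lp1_of_Lp2; exact: Lp2B.
  by rewrite opprB addrC addrA subrK.
by under eq_fun do rewrite e.
Qed.

(** The bounds on v hold almost everywhere only, while [L1cvg_mul] asks for them at every point.
    Clamping changes neither averages nor integrals. *)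
Lemma W1_clamp r (v : R * R -> R) : W1_01 r (@Omega R) v ->
  exists v' : R * R -> R, [/\ Lp 1 (@Omega R) v', v' \_ (@Omega R) = v',
    forall y, 0 <= v' y <= 1 & {ae mu2, forall y, (v \_ (@Omega R)) y = v' y}].
Proof.
move=> [[Lv _] v01]; pose v' y := Num.max 0 (Num.min 1 ((v \_ (@Omega R)) y)).
have pv : v' \_ (@Omega R) = v'.
  apply/funext => y; rewrite patchE; case: ifPn => // Oy; rewrite /v' patchE (negPf Oy).
  by rewrite min_r// maxxx.
have iv := Lp1_integrable Lv; have /measurable_EFinP mv := measurable_int _ iv.
exists v'; split => //.
- apply/Lfun1_integrable; rewrite pv; apply: (integrableR_le _ _ _ (integrableR_norm measurableT iv)) => //.
    by apply: measurable_maxr => //; apply: measurable_minr.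
  move=> y _; rewrite /v'; set t := (v \_ _) y.
  have h0 : 0 <= Num.max 0 (Num.min 1 t) by rewrite le_max lexx.
  by rewrite (ger0_norm h0) ge_max normr_ge0 ge_min ler_norm orbT.
- by move=> y; rewrite le_max lexx ge_max ler01 ge_min lexx.
apply: filterS v01 => y hy; rewrite /v' patchE; case: ifPn => [|_]; last by rewrite min_r ?maxxx.
by rewrite inE => /hy/andP[h0 h1]; rewrite min_r// max_r.
Qed.

End Fidelity.

(** * Orders of multi-indices and the limit of the functionals *)

Lemma mlt_mord (a b : nat * nat) : mlt b a -> (mord b < mord a)%N.
Proof.
case: a b => [a1 a2] [b1 b2] /andP[/andP[/= l1 l2]]; rewrite /mord /=.
by rewrite -[(b1, b2) == _]/((b1 == a1) && (b2 == a2)); lia.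
Qed.

Lemma framelet_idx_mord_gt0 m (a : fidx m) : a \in framelet_idx m -> (0 < mord (midx a))%N.
Proof.
rewrite !inE lt0n; apply: contra; rewrite addn_eq0 => /andP[/eqP h1 /eqP h2].
by apply/eqP; case: a h1 h2 => a1 a2 /= h1 h2; congr (_, _); apply: val_inj.
Qed.

Lemma framelet_idx_gt0 m (a : fidx m) : a \in framelet_idx m -> (0 < m)%N.
Proof.
move=> /framelet_idx_mord_gt0; rewrite /mord /midx /=.
by have := ltn_ord a.1; have := ltn_ord a.2; lia.
Qed.

Lemma max_order_ge m (J : {set fidx m}) a : a \in J -> (mord (midx a) <= max_order J)%N.
Proof. by move=> aJ; rewrite /max_order; exact: leq_bigmax_cond. Qed.

Theorem theorem4p1 (R : realType) (m : nat)
    (q : nat -> int -> R) (varphi : fidx m -> R * R -> R)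
    (I I' I'' : {set fidx m})
    (f : R * R -> R) (A : (R * R -> R) -> R * R -> R)
    (An : forall n, {linear grid_fun R m n -> grid_fun R m n})
    (lam gam rho : nat -> fidx m -> R)
    (hq : bspline_masks m q)
    (hvarphi : framelet_antiderivatives q varphi)
    (hI : I \subset framelet_idx m) (hI0 : I != finset.set0)
    (hI' : I' \subset framelet_idx m) (hI'0 : I' != finset.set0)
    (hI'' : I'' \subset framelet_idx m) (hI''0 : I'' != finset.set0)
    (hII' : exists2 al, al \in I & forall be, be \in I' -> mlt (midx be) (midx al))
    (hf : Lp 2 (@Omega R) f)
    (hA1 : assumption_A1 A (fun n => An n))
    (hlam : assumption_A2 varphi I (max_order (I :|: I')%SET) lam)
    (hgam : assumption_A2 varphi I' (max_order (I :|: I')%SET) gam)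
    (hrho : assumption_A2 varphi I'' (max_order I'') rho) :
  forall u v : R * R -> R,
    W1 (max_order (I :|: I')%SET) (@Omega R) u ->
    W1_01 (max_order I'') (@Omega R) v ->
    energy_n q (lam n) (gam n) (rho n) f (An n) u v @[n --> \oo]
      --> energy I I' I'' f A u v.
Proof.
move=> u v Wu Wv.
have [a0 a0I] := set0Pn _ hI0; have m0 := framelet_idx_gt0 (fintype.subsetP hI _ a0I).
have /choice[c hc] : forall l, exists cl : R, (l <= m)%N -> cl != 0 /\ mask_of q m l cl.
  move=> l.
  have [lm|ml] := leqP l m; last by exists 0.
  by have [cl h1 h2] := mask_coef hq lm; exists cl.
have ordI al : al \in I -> (mord (midx al) <= max_order (I :|: I')%SET)%N.
  by move=> h; apply: max_order_ge; rewrite inE h.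
have ordI' al : al \in I' -> (mord (midx al) <= max_order (I :|: I')%SET)%N.
  by move=> h; apply: max_order_ge; rewrite inE h orbT.
have Lu : Lp 2 (@Omega R) u.
  apply: W1_Lp2; split; first exact: Wu.1.
  move=> a a2; apply: Wu.2; apply: (leq_trans a2).
  (* An element of I' has order at least 1, and al exceeds it strictly; this gives s >= 2, hence the
     derivatives needed for square integrability. *)
  have [al /ordI al_s hlt] := hII'; have [be be_I'] := set0Pn _ hI'0.
  apply: leq_trans al_s; apply: leq_trans (mlt_mord (hlt _ be_I')).
  exact: framelet_idx_mord_gt0 (fintype.subsetP hI' _ be_I').
have [v' [Lv' pv' v'01 vv']] := W1_clamp Wv.
have iv' : (@leb2 R).-integrable setT (EFin \o v') by rewrite -pv'; exact: Lp1_integrable.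
have iv := Lp1_integrable Wv.1.1.
(* The values of T_n v extended to all indices; computed from the clamped representative they lie in
   [0, 1] even off the grid. *)
pose Z n z := avg n (m.-1, m.-1) v' (z - pshift m./2 m./2).
have Z01 n z : 0 <= Z n z <= 1 by exact: avg_unit.
have TnZ n (k : Mset R m n) : Tn m n v k = Z n (val k).
  by rewrite TnE//; [exact: avg_ae|exact: Wv.1.1].
have cZ : L1cvg (fun n y => Z n (cell n y)) v'.
  by have := L1cvg_avg (m.-1, m.-1) (- pshift m./2 m./2) Lv'; rewrite pv'.
have c1Z : L1cvg (fun n y => 1 - Z n (cell n y)) (fun y => 1 - v' y).
  have c1 : L1cvg (fun _ _ => 1 : R) (fun=> 1).
    split; [by move=> n; exact: iO_cst|exact: iO_cst|].
    under eq_fun do under eq_Rintegral do rewrite subrr normr0.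
    by rewrite intO0; exact: cvg_cst.
  by have := L1cvgD c1 (L1cvgZ (-1) cZ); apply: L1cvg_ext => *; rewrite mulN1r.
have abs1 (t : R) : 0 <= t <= 1 -> `|t| <= 1 /\ `|1 - t| <= 1.
  by move=> /andP[t0 t1]; split; rewrite ger0_norm// ?subr_ge0// lerBlDr lerDl.
have t1 := @weighted_gradient_term_cvg _ _ _ _ m0 hc _ hq hvarphi _ _ _ u
  (fun n z => 1 - Z n z) _ hI ordI hlam Wu (fun n y _ => (abs1 _ (Z01 n _)).2)
  (fun y _ => (abs1 _ (v'01 y)).2) c1Z.
have t2 := @weighted_gradient_term_cvg _ _ _ _ m0 hc _ hq hvarphi _ _ _ u
  Z _ hI' ordI' hgam Wu (fun n y _ => (abs1 _ (Z01 n _)).1)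
  (fun y _ => (abs1 _ (v'01 y)).1) cZ.
have t3 := @gradient_term_cvg _ _ _ _ m0 hc _ hq hvarphi _ _ _ v hI'' (fun al => @max_order_ge m I'' al) hrho Wv.1.
have t4 := fidelity_cvg m0 hf Lu hA1.
have [_ iG _] := Wstep_cvg m0 hc hq hvarphi hI ordI hlam Wu.
have [_ iG' _] := Wstep_cvg m0 hc hq hvarphi hI' ordI' hgam Wu.
have mO := @measurable_Omega R.
have mv : measurable_fun (@Omega R) v.
  apply: iO_measurable; apply: eq_integrableR (integrable_Omega iv) => // y Oy.
  by rewrite patchE mem_set.
have mv' : measurable_fun (@Omega R) v' by exact: iO_measurable (integrable_Omega iv').
have vv'O : {ae @leb2 R, forall y, Omega y -> v y = v' y}.
  by apply: filterS vv' => y hy Oy; rewrite -hy patchE mem_set.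
(* The limits were obtained for v'; the integrals are now carried back to v, equal to it almost
   everywhere. *)
have e1 : \int[@leb2 R]_(x in @Omega R) ((1 - v' x) * gradnorm I u x) =
    \int[@leb2 R]_(x in @Omega R) ((1 - v x) * gradnorm I u x).
  apply: ae_eq_Rintegral => //.
  - by apply: measurable_funM; [exact: measurable_funB|exact: iO_measurable].
  - by apply: measurable_funM; [exact: measurable_funB|exact: iO_measurable].
  - by apply: filterS vv'O => y hy Oy; rewrite hy.
have e2 : \int[@leb2 R]_(x in @Omega R) (v' x * gradnorm I' u x) =
    \int[@leb2 R]_(x in @Omega R) (v x * gradnorm I' u x).
  apply: ae_eq_Rintegral => //.
  - by apply: measurable_funM => //; exact: iO_measurable.
  - by apply: measurable_funM => //; exact: iO_measurable.
  - by apply: filterS vv'O => y hy Oy; rewrite hy.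
rewrite e1 in t1; rewrite e2 in t2; rewrite /energy.
rewrite (_ : (fun n => _) = (fun n =>
  (2 ^- n) ^+ 2 * (\sum_(k in Kset m n q) (1 - Z n (val k)) * Wnorm q (lam n) (Tn m n u) k) +
  (2 ^- n) ^+ 2 * (\sum_(k in Kset m n q) Z n (val k) * Wnorm q (gam n) (Tn m n u) k) +
  (2 ^- n) ^+ 2 * (\sum_(k in Kset m n q) Wnorm q (rho n) (Tn m n v) k) +
  2^-1 * grid_norm2 (An n (Tn m n u) - Tn m n f) ^+ 2)).
  apply: cvgD; first by apply: cvgD => //; exact: cvgD.
  by apply: cvgM => //; exact: cvg_cst.
apply/funext => n; rewrite /energy_n; congr (_ * _ + _ * _ + _ + _).
  by apply: eq_bigr => k _; rewrite TnZ.
by apply: eq_bigr => k _; rewrite TnZ.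
Qed.
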